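(* Let $\mathbf T$ be a filtered abelian category, let $k\geq 2$, and let $A=\bigoplus_{1\le r\le k}A_r$, where $A_r$ is a nonzero pure object of $\mathbf T$ of weight $p_r$ and $p_1<\cdots<p_k$. There exist sets $S'_\ell(A)$ for $1\leq \ell\leq k-1$ and maps $$S'_{k-1}(A)\xrightarrow{\Theta_{k-1}} S'_{k-2}(A) \xrightarrow{\Theta_{k-2}} S'_{k-3}(A) \rightarrow \cdots \rightarrow S'_2(A) \xrightarrow{\Theta_{2}} S'_{1}(A) \qquad (\star)$$ with the following properties: (a) There are canonical bijections $S'_{k-1}(A)\cong S'(A)$ and $S'_1(A)\cong \prod_{r} Ext^1(A_{r+1},A_{r})$. (b) Let $2\leq \ell\leq k-1$. Every nonempty fiber of the map $\Theta_\ell: S'_{\ell}(A)\rightarrow S'_{\ell-1}(A)$ is canonically a torsor for $\prod_{r}Ext^1(A_{r+\ell},A_r)$. (c) Let $2\leq \ell\leq k-1$. If the groups $Ext^2(A_{r+\ell},A_r)$ $(1\leq r\leq k-\ell)$ vanish, then the map $\Theta_\ell$ is surjective. (d) There is a natural action of $Aut(A)$ on each $S'_\ell(A)$ ($1\leq \ell\leq k-1$) such that, setting $S_\ell(A)=S'_\ell(A)/Aut(A)$, the maps in $(\star)$ and in part (a) descend to maps $$S_{k-1}(A)\rightarrow S_{k-2}(A) \rightarrow S_{k-3}(A) \rightarrow \cdots \rightarrow S_2(A)\rightarrow S_{1}(A)$$ and $$S_{k-1}(A)\cong S(A) \qquad\text{and}\qquad S_1(A)\cong \Big( \prod_{r}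 Ext^1(A_{r+1},A_{r})\Big)\Big/Aut(A),$$ the action of $Aut(A)=\prod_{1\leq j\leq k}Aut(A_j)$ on $\prod_{r} Ext^1(A_{r+1},A_{r})$ being by pushforwards and pullbacks. (e) Let $2\leq \ell\leq k-1$. Denote the induced map $S_{\ell}(A)\rightarrow S_{\ell-1}(A)$ also by $\Theta_\ell$. For every $\epsilon \in S_{\ell-1}(A)$ and every $\epsilon'\in S'_{\ell-1}(A)$ above $\epsilon$, the fiber $\Theta_\ell^{-1}(\epsilon)$ is the image of the fiber $\Theta_\ell^{-1}(\epsilon')$ under the quotient map $S'_\ell(A)\twoheadrightarrow S_\ell(A)$. Moreover, there exists a group $\Gamma(\epsilon')$ acting on the fiber $\Theta_\ell^{-1}(\epsilon')$ such that the map $\Theta_\ell^{-1}(\epsilon') \twoheadrightarrow \Theta_\ell^{-1}(\epsilon)$ induces a bijection $$\Theta_\ell^{-1}(\epsilon')/\Gamma(\epsilon') \cong \Theta_\ell^{-1}(\epsilon).$$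
   Context: A filtered abelian category is an abelian category $\mathbf T$ (in which every Yoneda $Ext^i(X,Y)$ is a set) equipped with a weight filtration: exact functors $W_n:\mathbf T\to\mathbf T$ ($n\in\mathbb Z$) such that for each object $X$ the $W_nX$ form an increasing filtration of $X$ by subobjects, with $W_nX=0$ for $n\ll 0$ and $W_nX=X$ for $n\gg 0$, and the inclusions $W_{n-1}X\subset W_nX$ give a morphism of functors $W_{n-1}\to W_n$. The associated graded of $X$ is $Gr^WX=\bigoplus_n W_nX/W_{n-1}X$. An object $X$ is pure of weight $n$ if $W_{n-1}X=0$ and $W_nX=X$. $S(A)$ is the set of isomorphism classes of objects $X$ of $\mathbf T$ such that $Gr^WX$ is isomorphic to $A$ (no isomorphism being recorded). $S'(A)$ is the set of equivalence classes of pairs $(X,\phi)$ of an object $X$ of $\mathbf T$ and an isomorphism $\phi:Gr^WX\to A$, where $(X,\phi)$ and $(X',\phi')$ are equivalent if there is an isomorphism $f:X\to X'$ with $\phi'\circ Gr^Wf=\phi$. The group $Aut(A)=\prod_r Aut(A_r)$ acts on $S'(A)$ by $\sigma\cdot(X,\phi)=(X,\sigma\phi)$, and $(X,\phi)\mapsto X$ induces a bijection $S'(A)/Aut(A)\cong S(A)$. The action of $Aut(A)$ on $\prod_r Ext^1(A_{r+1},A_r)$ by pushforwards and pullbacks is: $\sigma=(\sigma_r)$ sends $(\mathcal E_r)_r$ to $\big((\sigma_r)_*(\sigma_{r+1}^{-1})^*\mathcal E_r\big)_r$. In each product $\prod_r Ext^1(A_{r+\ell},A_r)$ (including $\ell=1$),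 the index $r$ runs over $1\le r\le k-\ell$. *)

(* Defs.v *)
(* Mathematical Components, with the classical axioms of mathcomp.classical.boolp. *)
From HB Require Import structures.
From Stdlib Require Import Relation_Operators.
From mathcomp Require Import all_boot all_order all_algebra.
From mathcomp Require Import boolp.

Set Implicit Arguments.
Unset Strict Implicit.
Unset Printing Implicit Defensive.

Import Order.TTheory GRing.Theory Num.Theory.
Local Open Scope ring_scope.

(* Meant for equivalence relations. *)
Definition quot (T : Type) (R : T -> T -> Prop) : Type :=
  {P : T -> Prop | exists x, P = R x}.

Definition cls (T : Type) (R : T -> T -> Prop) (x : T) : quot R :=
  exist _ (R x) (ex_intro _ x erefl).

Definition repr (T : Type) (R : T -> T -> Prop) (c : quot R) : T :=
  sval (cid (svalP c)).

(* Groups enter through their multiplication and unit only, so that the same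
   notions serve [groupType]s, automorphism groups and Ext groups. *)
Definition is_action (G S : Type) (mul : G -> G -> G) (one : G)
    (act : G -> S -> S) : Prop :=
  (forall x, act one x = x) /\
  (forall g h x, act (mul g h) x = act g (act h x)).

Definition orbit_rel (G S : Type) (act : G -> S -> S) (x y : S) : Prop :=
  exists g, act g x = y.

Definition orbits (G S : Type) (act : G -> S -> S) : Type :=
  quot (orbit_rel act).

Definition orb (G S : Type) (act : G -> S -> S) (x : S) : orbits act :=
  cls (orbit_rel act) x.

Definition fiber (S S' : Type) (f : S -> S') (y : S') : Type :=
  {x : S | f x = y}.

(* [act] makes the subset [F] of [S] a torsor for the group [G]. *)
Definition is_torsor (G S : Type) (mul : G -> G -> G) (one : G)
    (act : G -> S -> S) (F : S -> Prop) : Prop :=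
  [/\ exists x, F x,
      forall g x, F x -> F (act g x),
      forall x, F x -> act one x = x,
      forall g h x, F x -> act (mul g h) x = act g (act h x)
    & forall x y, F x -> F y -> exists! g, act g x = y].

Record additive_category := AdditiveCategory {
  ob :> Type;
  hom : ob -> ob -> zmodType;
  idm : forall X, hom X X;
  hcomp : forall X Y Z, hom Y Z -> hom X Y -> hom X Z;
  hcompA : forall X Y Z V (h : hom Z V) (g : hom Y Z) (f : hom X Y),
    hcomp h (hcomp g f) = hcomp (hcomp h g) f;
  comp1f : forall X Y (f : hom X Y), hcomp (idm Y) f = f;
  compf1 : forall X Y (f : hom X Y), hcomp f (idm X) = f;
  compDl : forall X Y Z (g h : hom Y Z) (f : hom X Y),
    hcomp (g + h) f = hcomp g f + hcomp h f;
  compDr : forall X Y Z (g : hom Y Z) (f h : hom X Y),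
    hcomp g (f + h) = hcomp g f + hcomp g h;
  (* finite direct sums; the empty family gives the zero object *)
  dsum : forall I : finType, (I -> ob) -> ob;
  inj : forall (I : finType) (F : I -> ob) (i : I), hom (F i) (dsum F);
  proj : forall (I : finType) (F : I -> ob) (i : I), hom (dsum F) (F i);
  projK : forall (I : finType) (F : I -> ob) i,
    hcomp (proj F i) (inj F i) = idm (F i);
  proj0 : forall (I : finType) (F : I -> ob) i j, i != j ->
    hcomp (proj F i) (inj F j) = 0;
  sum_inj_proj : forall (I : finType) (F : I -> ob),
    \sum_i hcomp (inj F i) (proj F i) = idm (dsum F)
}.

Arguments idm {a} X.
Arguments hcomp {a X Y Z} g f.
Arguments dsum {a I} F.
Arguments inj {a I} F i.
Arguments proj {a I} F i.

Notation "g \oc f" := (hcomp g f) (at level 40, left associativity) : ring_scope.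

Section Morphisms.
Variable C : additive_category.
Implicit Types X Y Z : C.

Definition mono X Y (f : hom X Y) : Prop :=
  forall Z (g h : hom Z X), f \oc g = f \oc h -> g = h.

Definition epi X Y (f : hom X Y) : Prop :=
  forall Z (g h : hom Y Z), g \oc f = h \oc f -> g = h.

Definition is_iso X Y (f : hom X Y) : Prop :=
  exists g : hom Y X, g \oc f = idm X /\ f \oc g = idm Y.

Record iso X Y := Iso {
  iso_hom :> hom X Y;
  iso_inv : hom Y X;
  iso_homK : iso_inv \oc iso_hom = idm X;
  iso_invK : iso_hom \oc iso_inv = idm Y
}.

Definition is_zero X : Prop := idm X = 0.

End Morphisms.

Record abelian_category := AbelianCategory {
  acat :> additive_category;
  ker : forall X Y : acat, hom X Y -> acat;
  kmap : forall (X Y : acat) (f : hom X Y), hom (ker f) X;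
  ker0 : forall (X Y : acat) (f : hom X Y), f \oc kmap f = 0;
  kmap_mono : forall (X Y : acat) (f : hom X Y), mono (kmap f);
  ker_fac : forall (X Y Z : acat) (f : hom X Y) (g : hom Z X),
    f \oc g = 0 -> exists h : hom Z (ker f), kmap f \oc h = g;
  coker : forall X Y : acat, hom X Y -> acat;
  cmap : forall (X Y : acat) (f : hom X Y), hom Y (coker f);
  coker0 : forall (X Y : acat) (f : hom X Y), cmap f \oc f = 0;
  cmap_epi : forall (X Y : acat) (f : hom X Y), epi (cmap f);
  coker_fac : forall (X Y Z : acat) (f : hom X Y) (g : hom Y Z),
    g \oc f = 0 -> exists h : hom (coker f) Z, h \oc cmap f = g;
  (* every monomorphism is the kernel of its cokernel, and dually *)
  mono_normal : forall (X Y Z : acat) (f : hom X Y) (g : hom Z Y),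
    mono f -> cmap f \oc g = 0 -> exists h : hom Z X, f \oc h = g;
  epi_normal : forall (X Y Z : acat) (f : hom X Y) (g : hom X Z),
    epi f -> g \oc kmap f = 0 -> exists h : hom Y Z, h \oc f = g
}.

Arguments ker {a X Y} f.
Arguments kmap {a X Y} f.
Arguments coker {a X Y} f.
Arguments cmap {a X Y} f.

Section Abelian.
Variable C : abelian_category.
Implicit Types X Y Z A B : C.

(* The first equation says that the image of [f] lies in the kernel of [g],
   the second that the kernel of [g] lies in the image of [f], the latter being
   the kernel of [cmap f]. *)
Definition exact X Y Z (f : hom X Y) (g : hom Y Z) : Prop :=
  g \oc f = 0 /\ cmap f \oc kmap g = 0.

Definition short_exact X Y Z (f : hom X Y) (g : hom Y Z) : Prop :=
  [/\ mono f, exact f g & epi g].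

Lemma comp0f X Y Z (f : hom X Y) : (0 : hom Y Z) \oc f = 0.
Proof. by apply: (addIr (0 \oc f)); rewrite -compDl !add0r. Qed.

Lemma compf0 X Y Z (f : hom Y Z) : f \oc (0 : hom X Y) = 0.
Proof. by apply: (addIr (f \oc 0)); rewrite -compDr !add0r. Qed.

Lemma compNf X Y Z (g : hom Y Z) (f : hom X Y) : (- g) \oc f = - (g \oc f).
Proof. by apply: (addIr (g \oc f)); rewrite -compDl !addNr comp0f. Qed.

Lemma compfN X Y Z (g : hom Y Z) (f : hom X Y) : g \oc (- f) = - (g \oc f).
Proof. by apply: (addIr (g \oc f)); rewrite -compDr !addNr compf0. Qed.

Lemma comp_suml X Y Z (I : finType) (G : I -> hom Y Z) (f : hom X Y) :
  (\sum_i G i) \oc f = \sum_i (G i \oc f).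
Proof.
by apply: (big_morph (fun g => g \oc f)) => [x y|];
  rewrite ?compDl ?comp0f.
Qed.

Lemma comp_sumr X Y Z (I : finType) (g : hom Y Z) (F : I -> hom X Y) :
  g \oc (\sum_i F i) = \sum_i (g \oc F i).
Proof.
by apply: (big_morph (fun f => g \oc f)) => [x y|];
  rewrite ?compDr ?compf0.
Qed.

Lemma mono0 X Y (f : hom X Y) :
  (forall Z (g : hom Z X), f \oc g = 0 -> g = 0) -> mono f.
Proof.
move=> f0 Z g h fgh; apply/eqP; rewrite -subr_eq0; apply/eqP/f0.
by rewrite compDr compfN fgh subrr.
Qed.

Lemma epi0 X Y (f : hom X Y) :
  (forall Z (g : hom Y Z), g \oc f = 0 -> g = 0) -> epi f.
Proof.
move=> f0 Z g h fgh; apply/eqP; rewrite -subr_eq0; apply/eqP/f0.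
by rewrite compDl compNf fgh subrr.
Qed.

Lemma mono_eq0 X Y Z (f : hom X Y) (g : hom Z X) :
  mono f -> f \oc g = 0 -> g = 0.
Proof. by move=> fm fg; apply: fm; rewrite fg compf0. Qed.

Lemma epi_eq0 X Y Z (f : hom X Y) (g : hom Y Z) :
  epi f -> g \oc f = 0 -> g = 0.
Proof. by move=> fe gf; apply: fe; rewrite gf comp0f. Qed.

Lemma exact_lift X Y Z V (f : hom X Y) (g : hom Y Z) (t : hom V Y) :
  short_exact f g -> g \oc t = 0 -> exists u : hom V X, f \oc u = t.
Proof.
move=> [fm [_ fg] _] /ker_fac [s <-].
by apply: mono_normal => //; rewrite hcompA fg comp0f.
Qed.

Lemma exact_desc X Y Z V (f : hom X Y) (g : hom Y Z) (t : hom Y V) :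
  short_exact f g -> t \oc f = 0 -> exists u : hom Z V, u \oc g = t.
Proof.
move=> [_ [_ fg] ge] /coker_fac [s <-].
by apply: epi_normal => //; rewrite -hcompA fg compf0.
Qed.

Lemma id_mono X : mono (idm X).
Proof. by move=> Z g h; rewrite !comp1f. Qed.

Lemma id_epi X : epi (idm X).
Proof. by move=> Z g h; rewrite !compf1. Qed.

Lemma cmap_id X : cmap (idm X) = 0.
Proof. by rewrite -[LHS]compf1 coker0. Qed.

Lemma kmap_id X : kmap (idm X) = 0.
Proof. by rewrite -[LHS]comp1f ker0. Qed.

Definition iso_id X : iso X X :=
  Iso (comp1f (idm X)) (comp1f (idm X)).

Definition iso_sym X Y (f : iso X Y) : iso Y X :=
  Iso (iso_invK f) (iso_homK f).

Lemma iso_compK X Y Z (g : iso Y Z) (f : iso X Y) :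
  (iso_inv f \oc iso_inv g) \oc (iso_hom g \oc iso_hom f) = idm X.
Proof. by rewrite hcompA -(hcompA _ _ (iso_hom g)) iso_homK compf1 iso_homK. Qed.

Definition iso_comp X Y Z (g : iso Y Z) (f : iso X Y) : iso X Z :=
  @Iso _ X Z (iso_hom g \oc iso_hom f) (iso_inv f \oc iso_inv g)
    (iso_compK g f) (iso_compK (iso_sym f) (iso_sym g)).

Definition bisum X Y : C := dsum (fun b : bool => if b then X else Y).
Definition in1 X Y : hom X (bisum X Y) :=
  inj (fun b : bool => if b then X else Y) true.
Definition in2 X Y : hom Y (bisum X Y) :=
  inj (fun b : bool => if b then X else Y) false.
Definition pr1 X Y : hom (bisum X Y) X :=
  proj (fun b : bool => if b then X else Y) true.
Definition pr2 X Y : hom (bisum X Y) Y :=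
  proj (fun b : bool => if b then X else Y) false.

Lemma pr1_in1 X Y : pr1 X Y \oc in1 X Y = idm X.
Proof. exact: (projK (fun b : bool => if b then X else Y) true). Qed.
Lemma pr2_in2 X Y : pr2 X Y \oc in2 X Y = idm Y.
Proof. exact: (projK (fun b : bool => if b then X else Y) false). Qed.
Lemma pr1_in2 X Y : pr1 X Y \oc in2 X Y = 0.
Proof.
exact: (@proj0 _ _ (fun b : bool => if b then X else Y) true false isT).
Qed.
Lemma pr2_in1 X Y : pr2 X Y \oc in1 X Y = 0.
Proof.
exact: (@proj0 _ _ (fun b : bool => if b then X else Y) false true isT).
Qed.
Lemma in_pr X Y :
  in1 X Y \oc pr1 X Y + in2 X Y \oc pr2 X Y = idm (bisum X Y).
Proof.
have := sum_inj_proj (fun b : bool => if b then X else Y).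
by rewrite big_bool.
Qed.

Lemma pr1_in1A X Y Z (f : hom Z X) : pr1 X Y \oc (in1 X Y \oc f) = f.
Proof. by rewrite hcompA pr1_in1 comp1f. Qed.
Lemma pr2_in2A X Y Z (f : hom Z Y) : pr2 X Y \oc (in2 X Y \oc f) = f.
Proof. by rewrite hcompA pr2_in2 comp1f. Qed.
Lemma pr1_in2A X Y Z (f : hom Z Y) : pr1 X Y \oc (in2 X Y \oc f) = 0.
Proof. by rewrite hcompA pr1_in2 comp0f. Qed.
Lemma pr2_in1A X Y Z (f : hom Z X) : pr2 X Y \oc (in1 X Y \oc f) = 0.
Proof. by rewrite hcompA pr2_in1 comp0f. Qed.

(* 0 -> A -> E -> B -> 0; in [Ext1 B A] and [Ext2 B A] below the quotient
   object likewise comes first, as in Ext^i(B, A). *)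
Record extension B A := Extension {
  emid :> C;
  einj : hom A emid;
  eproj : hom emid B;
  e_exact : short_exact einj eproj
}.

Definition ext_iso B A (E E' : extension B A) : Prop :=
  exists f : iso E E', f \oc einj E = einj E' /\ eproj E' \oc f = eproj E.

Definition Ext1 B A : Type := quot (@ext_iso B A).

Section Pullback.
Variables (A B B' : C) (g : hom B' B) (E : extension B A).

Let d : hom (bisum E B') B := eproj E \oc pr1 E B' - g \oc pr2 E B'.

Lemma pull_inj_ex : exists h : hom A (ker d), kmap d \oc h = in1 E B' \oc einj E.
Proof.
apply: ker_fac; rewrite /d compDl compNf -!hcompA pr1_in1A pr2_in1A.
rewrite compf0 subr0.
by have [_ [-> _] _] := e_exact E.
Qed.

Let i := sval (cid pull_inj_ex).
Let iE : kmap d \oc i = in1 E B' \oc einj E := svalP (cid pull_inj_ex).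

Lemma pull_exact : short_exact i (pr2 E B' \oc kmap d).
Proof.
have [im [pi0 _] pe] := e_exact E.
have d1 : d \oc in1 E B' = eproj E.
  by rewrite compDl compNf -!hcompA pr1_in1 pr2_in1 compf1 compf0 subr0.
split; first (apply: mono0 => Z u iu; apply: (mono_eq0 im)).
- have: kmap d \oc (i \oc u) = 0 by rewrite iu compf0.
  rewrite hcompA iE => /(congr1 (fun t => pr1 E B' \oc t)).
  by rewrite !hcompA pr1_in1 comp1f compf0.
- split; first by rewrite -hcompA iE hcompA pr2_in1 comp0f.
  set t := kmap (pr2 E B' \oc kmap d).
  have t2 : pr2 E B' \oc (kmap d \oc t) = 0 by rewrite hcompA ker0.
  have t1 : eproj E \oc (pr1 E B' \oc (kmap d \oc t)) = 0.
    have: d \oc (kmap d \oc t) = 0 by rewrite hcompA ker0 comp0f.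
    by rewrite compDl compNf -(hcompA g) t2 compf0 subr0 -hcompA.
  have [u uE] := exact_lift (e_exact E) t1.
  have -> : t = i \oc u.
    apply: (@kmap_mono _ _ _ d); rewrite hcompA iE -hcompA uE.
    by rewrite -[LHS]comp1f -in_pr compDl -!hcompA t2 compf0 addr0.
  by rewrite hcompA coker0 comp0f.
- apply: epi0 => Z h; rewrite hcompA => hp.
  have de : epi d.
    apply: epi0 => V m md; apply: (epi_eq0 pe).
    by rewrite -d1 hcompA md comp0f.
  have [m mE] := epi_normal de hp.
  have m0 : m = 0.
    apply: (epi_eq0 pe).
    by rewrite -d1 hcompA mE -hcompA pr2_in1 compf0.
  by rewrite -[h]compf1 -(pr2_in2 E) hcompA -mE m0 !comp0f.
Qed.

Definition pull_ext : extension B' A := Extension pull_exact.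

End Pullback.

Section Pushout.
Variables (A A' B : C) (s : hom A A') (E : extension B A).

Let d : hom A (bisum E A') := in1 E A' \oc einj E - in2 E A' \oc s.

Lemma push_proj_ex :
  exists h : hom (coker d) B, h \oc cmap d = eproj E \oc pr1 E A'.
Proof.
apply: coker_fac; rewrite /d compDr compfN -!hcompA pr1_in1A pr1_in2A.
rewrite compf0 subr0.
by have [_ [-> _] _] := e_exact E.
Qed.

Let p := sval (cid push_proj_ex).
Let pE : p \oc cmap d = eproj E \oc pr1 E A' := svalP (cid push_proj_ex).

Lemma push_exact : short_exact (cmap d \oc in2 E A') p.
Proof.
have [im [pi0 _] pe] := e_exact E.
have d1 : pr1 E A' \oc d = einj E.
  by rewrite compDr compfN !hcompA pr1_in1 pr1_in2 comp1f comp0f subr0.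
split.
- apply: mono0 => Z h; rewrite -hcompA => hp.
  have dm : mono d.
    apply: mono0 => V m md; apply: (mono_eq0 im).
    by rewrite -d1 -hcompA md compf0.
  have [m mE] := mono_normal dm hp.
  have m0 : m = 0.
    apply: (mono_eq0 im).
    by rewrite -d1 -hcompA mE hcompA pr1_in2 comp0f.
  by rewrite -[h]comp1f -(pr2_in2 E) -hcompA -mE m0 !compf0.
- split; first by rewrite hcompA pE -hcompA pr1_in2 compf0.
  set t := cmap (cmap d \oc in2 E A').
  have t2 : (t \oc cmap d) \oc in2 E A' = 0 by rewrite -hcompA coker0.
  have t1 : ((t \oc cmap d) \oc in1 E A') \oc einj E = 0.
    have: (t \oc cmap d) \oc d = 0 by rewrite -hcompA coker0 compf0.
    by rewrite compDr compfN (hcompA _ _ s) t2 comp0f subr0 hcompA.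
  have [u uE] := exact_desc (e_exact E) t1.
  have -> : t = u \oc p.
    apply: (@cmap_epi _ _ _ d); rewrite -hcompA pE hcompA uE.
    by rewrite -[LHS]compf1 -in_pr compDr !hcompA t2 comp0f addr0.
  by rewrite -hcompA ker0 compf0.
- apply: epi0 => Z u up; apply: (epi_eq0 pe).
  have: (u \oc p) \oc cmap d = 0 by rewrite up comp0f.
  rewrite -hcompA pE => /(congr1 (fun t => t \oc in1 E A')).
  by rewrite -!hcompA pr1_in1 compf1 comp0f.
Qed.

Definition push_ext : extension B A' := Extension push_exact.

End Pushout.

Section DirectSum.
Variables (A B A' B' : C) (E : extension B A) (E' : extension B' A').

Let i : hom (bisum A A') (bisum E E') :=
  in1 E E' \oc einj E \oc pr1 A A' + in2 E E' \oc einj E' \oc pr2 A A'.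
Let p : hom (bisum E E') (bisum B B') :=
  in1 B B' \oc eproj E \oc pr1 E E' + in2 B B' \oc eproj E' \oc pr2 E E'.

Lemma bisum_exact : short_exact i p.
Proof.
have [im [pi _] pe] := e_exact E; have [im' [pi' _] pe'] := e_exact E'.
have i1 : pr1 E E' \oc i = einj E \oc pr1 A A'.
  by rewrite compDr !hcompA pr1_in1 pr1_in2 comp1f !comp0f addr0.
have i2 : pr2 E E' \oc i = einj E' \oc pr2 A A'.
  by rewrite compDr !hcompA pr2_in2 pr2_in1 comp1f !comp0f add0r.
have p1 : pr1 B B' \oc p = eproj E \oc pr1 E E'.
  by rewrite compDr !hcompA pr1_in1 pr1_in2 comp1f !comp0f addr0.
have p2 : pr2 B B' \oc p = eproj E' \oc pr2 E E'.
  by rewrite compDr !hcompA pr2_in2 pr2_in1 comp1f !comp0f add0r.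
have p1' : p \oc in1 E E' = in1 B B' \oc eproj E.
  by rewrite compDl -!hcompA pr1_in1 pr2_in1 compf1 !compf0 addr0.
have p2' : p \oc in2 E E' = in2 B B' \oc eproj E'.
  by rewrite compDl -!hcompA pr2_in2 pr1_in2 compf1 !compf0 add0r.
split.
- apply: mono0 => Z u iu.
  have u1 : pr1 A A' \oc u = 0.
    by apply: (mono_eq0 im); rewrite hcompA -i1 -hcompA iu compf0.
  have u2 : pr2 A A' \oc u = 0.
    by apply: (mono_eq0 im'); rewrite hcompA -i2 -hcompA iu compf0.
  by rewrite -[u]comp1f -in_pr compDl -!hcompA u1 u2 !compf0 addr0.
- split.
    rewrite compDr !hcompA p1' p2' -(hcompA _ (eproj E)) -(hcompA _ (eproj E')).
    by rewrite pi pi' !compf0 !comp0f addr0.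
  set t := kmap p.
  have t1 : eproj E \oc (pr1 E E' \oc t) = 0.
    by rewrite hcompA -p1 -hcompA ker0 compf0.
  have t2 : eproj E' \oc (pr2 E E' \oc t) = 0.
    by rewrite hcompA -p2 -hcompA ker0 compf0.
  have [u uE] := exact_lift (e_exact E) t1.
  have [v vE] := exact_lift (e_exact E') t2.
  have -> : t = i \oc (in1 A A' \oc u + in2 A A' \oc v).
    rewrite -[LHS]comp1f -in_pr compDl -!hcompA -uE -vE.
    rewrite compDr !(compDl _ _ (_ \oc _)) -!hcompA !(hcompA (pr1 A A')).
    rewrite !(hcompA (pr2 A A')) pr1_in1 pr1_in2 pr2_in1 pr2_in2.
    by rewrite !comp1f !comp0f !compf0 addr0 add0r.
  by rewrite hcompA coker0 comp0f.
- apply: epi0 => Z u up.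
  have u1 : u \oc in1 B B' = 0.
    by apply: (epi_eq0 pe); rewrite -hcompA -p1' hcompA up comp0f.
  have u2 : u \oc in2 B B' = 0.
    by apply: (epi_eq0 pe'); rewrite -hcompA -p2' hcompA up comp0f.
  by rewrite -[u]compf1 -in_pr compDr !hcompA u1 u2 !comp0f addr0.
Qed.

Definition bisum_ext : extension (bisum B B') (bisum A A') :=
  Extension bisum_exact.

End DirectSum.

Lemma split_exact A B : short_exact (in1 A B) (pr2 A B).
Proof.
split.
- apply: mono0 => Z u /(congr1 (fun t => pr1 A B \oc t)).
  by rewrite hcompA pr1_in1 comp1f compf0.
- split; first exact: pr2_in1.
  rewrite -[kmap _]comp1f -in_pr compDl -!hcompA ker0 compf0 addr0.
  by rewrite hcompA coker0 comp0f.
- apply: epi0 => Z u /(congr1 (fun t => t \oc in2 A B)).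
  by rewrite -hcompA pr2_in2 compf1 comp0f.
Qed.

Definition split_ext B A : extension B A := Extension (split_exact A B).

(* Operations on classes are computed on chosen representatives; the resulting
   class does not depend on the choice. *)
Definition Ext1_push A A' B (s : hom A A') (c : Ext1 B A) : Ext1 B A' :=
  cls (@ext_iso B A') (push_ext s (repr c)).

Definition Ext1_pull A B B' (g : hom B' B) (c : Ext1 B A) : Ext1 B' A :=
  cls (@ext_iso B' A) (pull_ext g (repr c)).

Definition Ext1_zero B A : Ext1 B A := cls (@ext_iso B A) (split_ext B A).

(* Baer sum: pull the direct sum back along the diagonal of [B] and push it
   forward along the codiagonal of [A]. *)
Definition Ext1_add B A (c c' : Ext1 B A) : Ext1 B A :=
  cls (@ext_iso B A)
    (push_ext (pr1 A A + pr2 A A)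
      (pull_ext (in1 B B + in2 B B) (bisum_ext (repr c) (repr c')))).

Record extension2 B A := Extension2 {
  emid1 : C;
  emid2 : C;
  e2inj : hom A emid1;
  e2mid : hom emid1 emid2;
  e2proj : hom emid2 B;
  e2_mono : mono e2inj;
  e2_exact1 : exact e2inj e2mid;
  e2_exact2 : exact e2mid e2proj;
  e2_epi : epi e2proj
}.

Definition ext2_mor B A (E E' : extension2 B A) : Prop :=
  exists (f1 : hom (emid1 E) (emid1 E')) (f2 : hom (emid2 E) (emid2 E')),
    [/\ f1 \oc e2inj E = e2inj E', f2 \oc e2mid E = e2mid E' \oc f1
      & e2proj E' \oc f2 = e2proj E].

Definition Ext2 B A : Type :=
  quot (clos_refl_sym_trans _ (@ext2_mor B A)).

Lemma id0_exact A B : exact (idm A) (0 : hom A B).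
Proof. by split; rewrite ?comp0f // cmap_id comp0f. Qed.

Lemma zero_id_exact A B : exact (0 : hom A B) (idm B).
Proof. by split; rewrite ?compf0 // kmap_id compf0. Qed.

Definition trivial_ext2 B A : extension2 B A :=
  Extension2 (@id_mono A) (id0_exact A B) (zero_id_exact A B) (@id_epi B).

Definition Ext2_zero B A : Ext2 B A :=
  cls (clos_refl_sym_trans _ (@ext2_mor B A)) (trivial_ext2 B A).

Definition Ext2_vanishes B A : Prop := forall c : Ext2 B A, c = Ext2_zero B A.

End Abelian.

Record exact_functor (C : abelian_category) := ExactFunctor {
  fob :> C -> C;
  fmap : forall X Y, hom X Y -> hom (fob X) (fob Y);
  fmap_id : forall X, fmap (idm X) = idm (fob X);
  fmap_comp : forall X Y Z (g : hom Y Z) (f : hom X Y),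
    fmap (g \oc f) = fmap g \oc fmap f;
  fmap_add : forall X Y (f g : hom X Y), fmap (f + g) = fmap f + fmap g;
  fmap_exact : forall X Y Z (f : hom X Y) (g : hom Y Z),
    short_exact f g -> short_exact (fmap f) (fmap g)
}.

Arguments fmap {C} e {X Y} f.

Record filtered_category := FilteredCategory {
  fcat :> abelian_category;
  W : int -> exact_functor fcat;
  winj : forall (n : int) (X : fcat), hom (W n X) X;
  winj_mono : forall n X, mono (winj n X);
  (* [W n f] is the restriction of [f] *)
  winj_nat : forall n (X Y : fcat) (f : hom X Y),
    winj n Y \oc fmap (W n) f = f \oc winj n X;
  winc : forall (n : int) (X : fcat), hom (W (n - 1) X) (W n X);
  winc_winj : forall n X, winj n X \oc winc n X = winj (n - 1) X;
  winc_nat : forall n (X Y : fcat) (f : hom X Y),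
    winc n Y \oc fmap (W (n - 1)) f = fmap (W n) f \oc winc n X;
  W_low : forall X : fcat, exists a, forall n, n <= a -> is_zero (W n X);
  W_high : forall X : fcat, exists b, forall n, b <= n -> is_iso (winj n X)
}.

Arguments W {_} n.
Arguments winj {_} n X.
Arguments winc {_} n X.

Section Filtered.
Variable T : filtered_category.
Implicit Types X Y : T.

Definition pure (n : int) X : Prop :=
  is_zero (W (n - 1) X) /\ is_iso (winj n X).

Definition gr (n : int) X : T := coker (winc n X).

Lemma gr_map_ex n X Y (f : hom X Y) :
  exists h : hom (gr n X) (gr n Y),
    h \oc cmap (winc n X) = cmap (winc n Y) \oc fmap (W n) f.
Proof. by apply: coker_fac; rewrite -hcompA -winc_nat hcompA coker0 comp0f. Qed.

Definition gr_map n X Y (f : hom X Y) : hom (gr n X) (gr n Y) :=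
  sval (cid (gr_map_ex n f)).

(* The sum of [gr n X] over all [n] is formed over the weights between a lower
   and an upper bound of the filtration; the other [gr n X] are zero. *)
Definition low X : int := sval (cid (W_low X)).
Definition high X : int := sval (cid (W_high X)).
Definition weights X : seq int :=
  [seq low X + i%:Z | i <- iota 1 `|high X - low X|%N].

Definition Gr X : T := dsum (fun n : seq_sub (weights X) => gr (ssval n) X).

Definition gr_inj (n : int) X : hom (gr n X) (Gr X) :=
  match @idP (n \in weights X) with
  | ReflectT h => inj (fun m : seq_sub (weights X) => gr (ssval m) X) (SeqSub h)
  | ReflectF _ => 0
  end.

Definition gr_proj (n : int) X : hom (Gr X) (gr n X) :=
  match @idP (n \in weights X) with
  | ReflectT h => proj (fun m : seq_sub (weights X) => gr (ssval m) X) (SeqSub h)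
  | ReflectF _ => 0
  end.

Definition Gr_map X Y (f : hom X Y) : hom (Gr X) (Gr Y) :=
  \sum_(n : seq_sub (weights X))
    gr_inj (ssval n) Y \oc gr_map (ssval n) f \oc gr_proj (ssval n) X.

Definition obj_iso X Y : Prop := inhabited (iso X Y).

Section Graded.
Variables (k : nat) (A : 'I_k -> T).

Definition S_set : Type :=
  quot (fun X Y : {X : T | obj_iso (Gr X) (dsum A)} => obj_iso (sval X) (sval Y)).

Definition marked : Type := {X : T & iso (Gr X) (dsum A)}.

Definition marked_equiv (x x' : marked) : Prop :=
  exists f : iso (tag x) (tag x'),
    iso_hom (tagged x') \oc Gr_map f = iso_hom (tagged x).

Definition S'_set : Type := quot marked_equiv.

Definition mark (X : T) (phi : iso (Gr X) (dsum A)) : S'_set :=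
  cls marked_equiv (existT _ X phi).

Definition forget (c : S'_set) : S_set :=
  cls _ (exist (fun X => obj_iso (Gr X) (dsum A))
           (tag (repr c)) (inhabits (tagged (repr c)))).

(* There are no nonzero morphisms between pure objects of different weights, so
   every automorphism of [dsum A] is diagonal when the A_r are pure of distinct
   weights; its automorphism group is the product of the Aut(A_r). *)
Definition Aut : Type := forall r : 'I_k, iso (A r) (A r).
Definition Aut_mul (s t : Aut) : Aut := fun r => iso_comp (s r) (t r).
Definition Aut_one : Aut := fun r => iso_id (A r).

Definition diag (s : forall r, hom (A r) (A r)) : hom (dsum A) (dsum A) :=
  \sum_r inj A r \oc s r \oc proj A r.

Lemma diagM s t : diag s \oc diag t = diag (fun r => s r \oc t r).
Proof.
rewrite /diag comp_suml; apply: eq_bigr => r _; rewrite comp_sumr.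
rewrite (bigD1 r) //= big1 => [|j jr].
  by rewrite addr0 !hcompA -(hcompA _ (proj A r)) projK compf1.
rewrite !hcompA -(hcompA _ (proj A r)) proj0 1?eq_sym //.
by rewrite compf0 !comp0f.
Qed.

Lemma diag1 s : (forall r, s r = idm (A r)) -> diag s = idm (dsum A).
Proof.
move=> s1; rewrite -sum_inj_proj; apply: eq_bigr => r _.
by rewrite s1 compf1.
Qed.

Lemma diagK (s : Aut) :
  diag (fun r => iso_inv (s r)) \oc diag (fun r => iso_hom (s r)) = idm (dsum A).
Proof. by rewrite diagM diag1 // => r; rewrite iso_homK. Qed.

Lemma diagVK (s : Aut) :
  diag (fun r => iso_hom (s r)) \oc diag (fun r => iso_inv (s r)) = idm (dsum A).
Proof. by rewrite diagM diag1 // => r; rewrite iso_invK. Qed.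

Definition diag_iso (s : Aut) : iso (dsum A) (dsum A) := Iso (diagK s) (diagVK s).

Definition S'_act (s : Aut) (c : S'_set) : S'_set :=
  mark (iso_comp (diag_iso s) (tagged (repr c))).

Lemma hi_proof l (r : 'I_(k - l)) : (r + l < k)%N.
Proof. by rewrite addnC -ltn_subRL. Qed.

(* With indices counted from 0, r < k - l corresponds to the pair (A_r, A_(r+l))
   = (A (lo r), A (hi r)). *)
Definition lo l (r : 'I_(k - l)) : 'I_k := widen_ord (leq_subr l k) r.
Definition hi l (r : 'I_(k - l)) : 'I_k := Ordinal (hi_proof r).

Definition ExtProd (l : nat) : Type :=
  forall r : 'I_(k - l), Ext1 (A (hi r)) (A (lo r)).

Definition ExtProd_add l (e e' : ExtProd l) : ExtProd l :=
  fun r => Ext1_add (e r) (e' r).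

Definition ExtProd_zero l : ExtProd l :=
  fun r => Ext1_zero (A (hi r)) (A (lo r)).

Definition ExtProd_act l (s : Aut) (e : ExtProd l) : ExtProd l :=
  fun r => Ext1_push (iso_hom (s (lo r)))
             (Ext1_pull (iso_inv (s (hi r))) (e r)).

Variable p : 'I_k -> int.

Definition to_piece X (phi : iso (Gr X) (dsum A)) (r : 'I_k) :
    hom (W (p r) X) (A r) :=
  proj A r \oc iso_hom phi \oc gr_inj (p r) X \oc cmap (winc (p r) X).

(* [c] is the class of
     0 -> Gr_(p_r) X -> W_(p_(r+1)) X / W_(p_r - 1) X -> Gr_(p_(r+1)) X -> 0,
   its ends being identified with A_r and A_(r+1) by [phi]; equivalently, the
   pushforward along [to_piece phi r] of the extension of A_(r+1) by W_(p_r) X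
   given by W_(p_(r+1)) X, which a morphism of extensions [q] from
   W_(p_(r+1)) X characterizes. *)
Definition consecutive_class X (phi : iso (Gr X) (dsum A)) (r : 'I_(k - 1))
    (c : Ext1 (A (hi r)) (A (lo r))) : Prop :=
  exists E : extension (A (hi r)) (A (lo r)),
  exists h : hom (W (p (lo r)) X) (W (p (hi r)) X),
  exists q : hom (W (p (hi r)) X) E,
    [/\ c = cls (@ext_iso _ _ _) E,
        winj (p (hi r)) X \oc h = winj (p (lo r)) X,
        q \oc h = einj E \oc to_piece phi (lo r)
      & eproj E \oc q = to_piece phi (hi r)].

End Graded.
End Filtered.

(* [descends Theta y x]: the composite S m -> ... -> S l of the maps [Theta]
   sends [x] to [y]. *)
Inductive descends (S : nat -> Type) (Theta : forall l, S l.+1 -> S l)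
    (l : nat) (y : S l) : forall m, S m -> Prop :=
  | descends_refl : descends Theta y y
  | descends_step m (x : S m.+1) :
      descends Theta y (Theta m x) -> descends Theta y x.

Arguments mark {T k A} X phi.
Arguments orb {G S} act x.

(* Main.v *)
(* An object with graded pieces A_a, ..., A_(a+l) (a block) has a subobject with
   the last piece removed and a quotient with the first piece removed.  S'_l is
   the set of families of blocks of l+1 consecutive pieces, the quotient of each
   being isomorphic to the subobject of the next.  A morphism that vanishes on
   the graded pieces is zero, so a morphism compatible with the markings of the
   graded pieces is unique, and this compatibility of isomorphism classes loses
   no information.

   A block X with quotient Z is the same thing as an element of Ext^1(Z, A_a),
   and its subobject is the pullback along Y -> Z, where Y is the subobject of Z
   and 0 -> Y -> Z -> A_b -> 0 is exact.  The fibres of Theta are thus governed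
   by the exact sequence
     Hom(Y, A_a) = 0 -> Ext^1(A_b, A_a) -> Ext^1(Z, A_a) -> Ext^1(Y, A_a)
       -> Ext^2(A_b, A_a). *)
From HB Require Import structures.
From Stdlib Require Import Relation_Operators.
From mathcomp Require Import all_boot all_order all_algebra zify.
From mathcomp Require Import boolp.
Require Import Defs.

Set Implicit Arguments.
Unset Strict Implicit.
Unset Printing Implicit Defensive.

Import Order.TTheory GRing.Theory Num.Theory.
Local Open Scope ring_scope.

(** Operations on isomorphism classes are computed on chosen representatives throughout. Rigidity
    makes this harmless: the functors [gr n] are exact and jointly kill only the zero object, so
    equality of maps, exactness and invertibility can be tested weight by weight. For marked blocks
    each such test becomes a comparison of intervals of indices, left to [lia].

    A fibre of [Theta] decouples into independent problems. By compatibility, the family [Theta x]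
    already records both the subobject and the quotient of every block of [x]; hence lifting a
    family, or moving inside a fibre, is done one block at a time, and the result is automatically
    compatible. A class c in Ext^1(A_b, A_a) moves a block with quotient Z by adding the pullback of
    c along Z -> A_b to its class in Ext^1(Z, A_a); this leaves the quotient alone, and also the
    subobject, because Y -> Z -> A_b is zero.

    The passage to orbits is formal once every map is equivariant: the group in (e) is the
    stabilizer of the chosen point upstairs. *)

Section Quotients.
Variables (U : Type) (R : U -> U -> Prop).

Definition is_equiv : Prop :=
  [/\ forall x, R x x, forall x y, R x y -> R y x
    & forall x y z, R x y -> R y z -> R x z].

Lemma cls_repr (c : quot R) : cls R (repr c) = c.
Proof.
rewrite /repr; case: (cid _) => x /= xE; case: c xE => P Pex /= xE.
by rewrite /cls; apply: eq_exist.
Qed.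

Hypothesis Req : is_equiv.

Lemma cls_eq x y : R x y -> cls R x = cls R y.
Proof.
case: Req => _ Rs Rt xy; apply: eq_exist; apply/funext => z.
by apply/propext; split=> [xz|yz]; [apply: Rt xz; apply: Rs | apply: Rt xy yz].
Qed.

Lemma cls_inj x y : cls R x = cls R y -> R x y.
Proof. by case: Req => Rr _ _ [] ->. Qed.

Lemma repr_cls x : R (repr (cls R x)) x.
Proof. by apply: cls_inj; rewrite cls_repr. Qed.

End Quotients.

(** * Diagram lemmas, functoriality of Ext^1 and the Baer sum *)

Section AbelianLemmas.
Variable C : abelian_category.
Implicit Types X Y Z V A B : C.

Lemma compBr X Y Z (g : hom Y Z) (f h : hom X Y) :
  g \oc (f - h) = g \oc f - g \oc h.
Proof. by rewrite compDr compfN. Qed.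

Lemma compBl X Y Z (g h : hom Y Z) (f : hom X Y) :
  (g - h) \oc f = g \oc f - h \oc f.
Proof. by rewrite compDl compNf. Qed.

Lemma mono_epi_iso X Y (f : hom X Y) : mono f -> epi f -> is_iso f.
Proof.
move=> fm fe; have cf : cmap f \oc idm Y = 0.
  by rewrite compf1; apply: (epi_eq0 fe); rewrite coker0.
have [g fg] := mono_normal fm cf; exists g; split=> //.
by apply: fm; rewrite hcompA fg comp1f compf1.
Qed.

Lemma iso_is_iso X Y (f : iso X Y) : is_iso f.
Proof. by exists (iso_inv f); split; [apply: iso_homK | apply: iso_invK]. Qed.

Definition to_iso X Y (f : hom X Y) (fi : is_iso f) : iso X Y :=
  @Iso _ X Y f (sval (cid fi)) (proj1 (svalP (cid fi))) (proj2 (svalP (cid fi))).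

Lemma is_iso_mono X Y (f : hom X Y) : is_iso f -> mono f.
Proof.
by case=> g [gf _] Z a b /(congr1 (hcomp g)); rewrite !hcompA gf !comp1f.
Qed.

Lemma is_iso_epi X Y (f : hom X Y) : is_iso f -> epi f.
Proof.
by case=> g [_ fg] Z a b /(congr1 (hcomp^~ g)); rewrite -!hcompA fg !compf1.
Qed.

Lemma is_iso_comp X Y Z (g : hom Y Z) (f : hom X Y) :
  is_iso g -> is_iso f -> is_iso (g \oc f).
Proof.
by move=> gi fi; apply: (iso_is_iso (iso_comp (to_iso gi) (to_iso fi))).
Qed.

Lemma is_iso_inv X Y (f : hom X Y) (g : hom Y X) :
  g \oc f = idm X -> f \oc g = idm Y -> is_iso g.
Proof. by move=> gf fg; exists f. Qed.

Lemma is_iso_cancel X Y Z (g : hom Y Z) (f : hom X Y) :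
  is_iso g -> is_iso (g \oc f) -> is_iso f.
Proof.
move=> [g' [g'g gg']] [u [uf fu]]; exists (u \oc g); split; first by rewrite -hcompA.
apply: (@is_iso_mono _ _ g); first by exists g'.
by rewrite hcompA hcompA fu comp1f compf1.
Qed.

Lemma iso_eq X Y (f g : iso X Y) : iso_hom f = iso_hom g -> f = g.
Proof.
case: f g => [f f' fK fV] [g g' gK gV] /= fg; move: gK gV; rewrite -fg => gK gV.
have e : f' = g' by rewrite -[f']compf1 -gV hcompA fK comp1f.
subst g'; congr Iso; apply: Prop_irrelevance.
Qed.

Lemma short_exact_cmap X Y (f : hom X Y) : mono f -> short_exact f (cmap f).
Proof.
by move=> fm; split=> //; [split; rewrite ?coker0 ?ker0 | apply: cmap_epi].
Qed.

Lemma short_exact_kmap X Y (f : hom X Y) : epi f -> short_exact (kmap f) f.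
Proof.
by move=> fe; split=> //; [apply: kmap_mono | split; rewrite ?ker0 ?coker0].
Qed.

Lemma short_exact0 X Y Z (f : hom X Y) (g : hom Y Z) :
  short_exact f g -> g \oc f = 0.
Proof. by case=> _ []. Qed.

(** Applied to [t = cmap f], the factorization property makes [cmap f] pass through [g], so that it
    kills [kmap g]. *)
Lemma exactI X Y Z (f : hom X Y) (g : hom Y Z) : g \oc f = 0 ->
  (forall V (t : hom Y V), t \oc f = 0 -> exists u, t = u \oc g) -> exact f g.
Proof.
move=> gf ex; split=> //; have [u ->] := ex _ _ (coker0 f).
by rewrite -hcompA ker0 compf0.
Qed.

Lemma epi_coker0 X Y (f : hom X Y) : is_zero (coker f) -> epi f.
Proof.
move=> c0; apply: epi0 => Z g gf.
by have [h <-] := coker_fac gf; rewrite -[h]compf1 c0 compf0 comp0f.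
Qed.

Lemma zero_to X Y (f : hom X Y) : is_zero Y -> f = 0.
Proof. by move=> Y0; rewrite -[f]comp1f Y0 comp0f. Qed.

Lemma zero_from X Y (f : hom X Y) : is_zero X -> f = 0.
Proof. by move=> X0; rewrite -[f]compf1 X0 compf0. Qed.

Lemma zero_iso X Y (f : hom X Y) : is_zero X -> is_zero Y -> is_iso f.
Proof. by move=> X0 Y0; exists 0; rewrite comp0f compf0 X0 Y0. Qed.

Lemma epi_coker_zero X Y (f : hom X Y) : epi f -> is_zero (coker f).
Proof.
move=> fe; apply: (@cmap_epi _ _ _ f); rewrite comp1f comp0f.
by apply: (epi_eq0 fe); rewrite coker0.
Qed.

Lemma mono_zero X Y (f : hom X Y) : mono f -> is_zero Y -> is_zero X.
Proof. by move=> fm Y0; apply: (mono_eq0 fm); apply: zero_to. Qed.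

Lemma epi_zero X Y (f : hom X Y) : epi f -> is_zero X -> is_zero Y.
Proof. by move=> fe X0; apply: (epi_eq0 fe); apply: zero_from. Qed.

Lemma short_exact_mid0 X Y Z (f : hom X Y) (g : hom Y Z) :
  short_exact f g -> is_zero X -> is_zero Z -> is_zero Y.
Proof.
move=> fg X0 Z0; have [u uE] := exact_lift fg (zero_to (g \oc idm Y) Z0).
by rewrite /is_zero -uE (zero_to u X0) compf0.
Qed.

Lemma short_exact_isol X Y Z (f : hom X Y) (g : hom Y Z) :
  short_exact f g -> is_zero Z -> is_iso f.
Proof.
move=> fg Z0; have [fm _ _] := fg; apply: mono_epi_iso => //.
have [u uE] := exact_lift fg (zero_to (g \oc idm Y) Z0).
by apply: epi0 => V h hf; rewrite -[h]compf1 -uE hcompA hf comp0f.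
Qed.

Lemma short_exact_isor X Y Z (f : hom X Y) (g : hom Y Z) :
  short_exact f g -> is_zero X -> is_iso g.
Proof.
move=> fg X0; have [_ _ ge] := fg; apply: mono_epi_iso => //.
have [u uE] := exact_desc fg (zero_from (idm Y \oc f) X0).
by apply: mono0 => V h hf; rewrite -[h]comp1f -uE -hcompA hf compf0.
Qed.

Lemma iso_short_exactl X Y Z (f : hom X Y) (g : hom Y Z) :
  is_iso f -> is_zero Z -> short_exact f g.
Proof.
move=> fi Z0; split; first exact: is_iso_mono.
  split; first exact: zero_to.
  have -> : cmap f = 0 by apply: (epi_eq0 (is_iso_epi fi)); rewrite coker0.
  by rewrite comp0f.
by apply: epi0 => V h _; apply: zero_from.
Qed.

Lemma iso_short_exactr X Y Z (f : hom X Y) (g : hom Y Z) :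
  is_zero X -> is_iso g -> short_exact f g.
Proof.
move=> X0 gi; split; last exact: is_iso_epi.
  by apply: mono0 => V h _; apply: zero_to.
split; first exact: zero_from.
have -> : kmap g = 0 by apply: (mono_eq0 (is_iso_mono gi)); rewrite ker0.
by rewrite compf0.
Qed.

Definition kmap_ext Y Z (g : hom Y Z) (ge : epi g) : extension Z (ker g) :=
  Extension (short_exact_kmap ge).

Definition ext_mor A A' B B' (s : hom A A') (g : hom B B')
    (E : extension B A) (E' : extension B' A') (f : hom E E') : Prop :=
  f \oc einj E = einj E' \oc s /\ eproj E' \oc f = g \oc eproj E.

Definition ext_hom A A' B B' (s : hom A A') (g : hom B B')
    (E : extension B A) (E' : extension B' A') : Prop :=
  exists f, @ext_mor A A' B B' s g E E' f.

Lemma einj_mono A B (E : extension B A) : mono (einj E).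
Proof. by case: (e_exact E). Qed.

Lemma eproj_epi A B (E : extension B A) : epi (eproj E).
Proof. by case: (e_exact E). Qed.

Lemma eproj_einj A B (E : extension B A) : eproj E \oc einj E = 0.
Proof. exact: short_exact0 (e_exact E). Qed.

Section PullbackUniv.
Variables (A B B' : C) (g : hom B' B) (E : extension B A).

Let d : hom (bisum E B') B := eproj E \oc pr1 E B' - g \oc pr2 E B'.

(** The universal property of the fibre product behind [pull_ext]. The local [d] repeats the one of
    the construction, to expose the kernel; later proofs use [pull_ext] only through this property
    and its exactness. *)
Lemma pull_map_ex : exists f : hom (pull_ext g E) E,
  ext_mor (idm A) g f /\
  forall Z (t : hom Z E) (w : hom Z B'), eproj E \oc t = g \oc w ->
    exists h : hom Z (pull_ext g E), f \oc h = t /\ eproj (pull_ext g E) \oc h = w.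
Proof.
pose kd : hom (pull_ext g E) (bisum E B') := kmap d.
have ki : kd \oc einj (pull_ext g E) = in1 E B' \oc einj E.
  exact: (svalP (cid (pull_inj_ex g E))).
have kp : eproj (pull_ext g E) = pr2 E B' \oc kd by [].
exists (pr1 E B' \oc kd); split; first split.
- by rewrite -hcompA ki pr1_in1A compf1.
- rewrite kp !hcompA; apply/eqP; rewrite -subr_eq0 -compBl; apply/eqP.
  exact: ker0.
- move=> Z t w tw.
  have [|h hE] := @ker_fac _ _ _ _ d (in1 E B' \oc t + in2 E B' \oc w).
    rewrite /d compBl !compDr -!hcompA pr1_in1A pr1_in2A pr2_in1A pr2_in2A.
    by rewrite !compf0 addr0 add0r tw subrr.
  exists h; rewrite kp /kd -!hcompA hE !compDr.
  by rewrite pr1_in1A pr1_in2A pr2_in1A pr2_in2A addr0 add0r.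
Qed.

End PullbackUniv.

Section PushoutUniv.
Variables (A A' B : C) (s : hom A A') (E : extension B A).

Let d : hom A (bisum E A') := in1 E A' \oc einj E - in2 E A' \oc s.

Lemma push_map_ex : exists f : hom E (push_ext s E),
  ext_mor s (idm B) f /\
  forall Z (t : hom E Z) (w : hom A' Z), t \oc einj E = w \oc s ->
    exists h : hom (push_ext s E) Z, h \oc f = t /\ h \oc einj (push_ext s E) = w.
Proof.
pose cd : hom (bisum E A') (push_ext s E) := cmap d.
have cp : eproj (push_ext s E) \oc cd = eproj E \oc pr1 E A'.
  exact: (svalP (cid (push_proj_ex s E))).
have ci : einj (push_ext s E) = cd \oc in2 E A' by [].
exists (cd \oc in1 E A'); split; first split.
- rewrite ci -!hcompA; apply/eqP; rewrite -subr_eq0 -compBr; apply/eqP.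
  exact: coker0.
- by rewrite hcompA cp -hcompA pr1_in1 compf1 comp1f.
- move=> Z t w tw.
  have [|h hE] := @coker_fac _ _ _ _ d (t \oc pr1 E A' + w \oc pr2 E A').
    rewrite /d compBr !compDl -!hcompA pr1_in1A pr1_in2A pr2_in1A pr2_in2A.
    by rewrite !compf0 addr0 add0r tw subrr.
  exists h; rewrite ci /cd !hcompA hE !compDl -!hcompA.
  by rewrite pr1_in1 pr1_in2 pr2_in1 pr2_in2 !compf0 !compf1 addr0 add0r.
Qed.

End PushoutUniv.

(** Stands in for choosing a preimage of an element: epimorphisms are stable under pullback, so [t]
    lifts along [g] after precomposition with an epimorphism. Diagram chases below rest on it. *)
Lemma epi_cover X Y Z (g : hom Y Z) (t : hom X Z) : epi g ->
  exists (P : C) (e : hom P X) (s : hom P Y), epi e /\ g \oc s = t \oc e.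
Proof.
move=> ge; have [f [[_ fE] _]] := pull_map_ex t (kmap_ext ge).
by exists (pull_ext t (kmap_ext ge)), (eproj _), f; split; first exact: eproj_epi.
Qed.

(** The image is taken as the cokernel of the kernel. A map killed by [m] lifts to X over an
    epimorphism; the lift lies in the kernel of [f], hence dies in that cokernel. *)
Lemma epi_mono_factor X Y (f : hom X Y) :
  exists (I : C) (q : hom X I) (m : hom I Y), [/\ epi q, mono m & f = m \oc q].
Proof.
have [m mE] := coker_fac (ker0 f).
exists (coker (kmap f)), (cmap (kmap f)), m; split=> //; first exact: cmap_epi.
apply: mono0 => Z t mt.
have [P [e [s [ee sE]]]] := epi_cover t (@cmap_epi _ _ _ (kmap f)).
apply: (epi_eq0 ee); rewrite -sE.
have /ker_fac [x <-] : f \oc s = 0 by rewrite -mE -hcompA sE hcompA mt comp0f.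
by rewrite hcompA coker0 comp0f.
Qed.

(** The short five lemma. It reduces [ext_iso] to the existence of a morphism of extensions, so that
    no inverse has to be built afterwards. *)
Lemma ext_hom_iso A B (E E' : extension B A) :
  ext_hom (idm A) (idm B) E E' -> ext_iso E E'.
Proof.
move=> [f []]; rewrite compf1 comp1f => fi fp.
have fm : mono f.
  apply: mono0 => Z t ft.
  have /(exact_lift (e_exact E)) [u uE] : eproj E \oc t = 0.
    by rewrite -fp -hcompA ft compf0.
  have : einj E' \oc u = 0 by rewrite -fi -hcompA uE.
  by move/(mono_eq0 (@einj_mono _ _ E')) => u0; rewrite -uE u0 compf0.
have fe : epi f.
  apply: epi0 => Z t tf.
  have /(exact_desc (e_exact E')) [u uE] : t \oc einj E' = 0.
    by rewrite -fi hcompA tf comp0f.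
  have : u \oc eproj E = 0 by rewrite -fp hcompA uE.
  by move/(epi_eq0 (@eproj_epi _ _ E)) => u0; rewrite -uE u0 comp0f.
by exists (to_iso (mono_epi_iso fm fe)).
Qed.

Lemma ext_iso_hom A B (E E' : extension B A) :
  ext_iso E E' -> ext_hom (idm A) (idm B) E E'.
Proof. by move=> [f [fi fp]]; exists f; split; rewrite ?compf1 ?comp1f. Qed.

Lemma ext_hom_id A B (E : extension B A) : ext_hom (idm A) (idm B) E E.
Proof. by exists (idm E); split; rewrite ?compf1 ?comp1f. Qed.

Lemma ext_hom_comp A A' A'' B B' B'' (s : hom A A') (s' : hom A' A'')
    (g : hom B B') (g' : hom B' B'') (E : extension B A) (E' : extension B' A')
    (E'' : extension B'' A'') :
  ext_hom s' g' E' E'' -> ext_hom s g E E' -> ext_hom (s' \oc s) (g' \oc g) E E''.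
Proof.
move=> [f' [fi' fp']] [f [fi fp]]; exists (f' \oc f); split.
  by rewrite -hcompA fi hcompA fi' -hcompA.
by rewrite hcompA fp' -hcompA fp hcompA.
Qed.

Lemma ext_iso_equiv A B : is_equiv (@ext_iso C B A).
Proof.
split=> [E|E E' [f [fi fp]]|E E' E'' /ext_iso_hom ff' /ext_iso_hom ff''].
- exact/ext_hom_iso/ext_hom_id.
- exists (iso_sym f); rewrite /= -fi -fp hcompA iso_homK comp1f.
  by rewrite -hcompA iso_invK compf1.
- apply: ext_hom_iso; have := ext_hom_comp ff'' ff'; by rewrite !compf1.
Qed.

Definition ext_cls A B (E : extension B A) : Ext1 B A := cls (@ext_iso C B A) E.

Lemma ext_cls_eq A B (E E' : extension B A) :
  ext_hom (idm A) (idm B) E E' -> ext_cls E = ext_cls E'.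
Proof. by move/ext_hom_iso; apply: cls_eq; apply: ext_iso_equiv. Qed.

Lemma ext_cls_inj A B (E E' : extension B A) :
  ext_cls E = ext_cls E' -> ext_hom (idm A) (idm B) E E'.
Proof. by move/(cls_inj (@ext_iso_equiv A B))/ext_iso_hom. Qed.

Lemma ext_cls_repr A B (c : Ext1 B A) : ext_cls (repr c) = c.
Proof. exact: cls_repr. Qed.

(** The fibre product supplies [h]; on A it induces some [u] with [einj E \oc u = einj E], and
    [einj E] is a monomorphism. *)
Lemma pull_univ A B B' (g : hom B' B) (E1 : extension B' A) (E : extension B A) :
  ext_hom (idm A) g E1 E -> ext_hom (idm A) (idm B') E1 (pull_ext g E).
Proof.
move=> [f1 [fi1 fp1]]; have [f [[fi fp] fu]] := pull_map_ex g E.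
have [h [hE hp]] := fu _ _ _ fp1; exists h; split; last by rewrite hp comp1f.
have /(exact_lift (e_exact _)) [u uE] :
  eproj (pull_ext g E) \oc (h \oc einj E1) = 0.
  by rewrite hcompA hp eproj_einj.
rewrite compf1 -uE; suff -> : u = idm A by rewrite compf1.
by apply: (@einj_mono _ _ E); rewrite -fi1 -hE -hcompA -uE hcompA fi compf1.
Qed.

Lemma push_univ A A' B B1 (s : hom A A') (g : hom B B1) (E : extension B A)
    (E1 : extension B1 A') :
  ext_hom s g E E1 -> ext_hom (idm A') g (push_ext s E) E1.
Proof.
move=> [f1 [fi1 fp1]]; have [f [[fi fp] fu]] := push_map_ex s E.
have [h [hE hi]] := fu _ _ _ fi1; exists h; split; first by rewrite hi compf1.
have /(exact_desc (e_exact _)) [u uE] :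
  (eproj E1 \oc h) \oc einj (push_ext s E) = 0.
  by rewrite -hcompA hi eproj_einj.
rewrite -uE; suff -> : u = g by [].
apply: (@eproj_epi _ _ E); rewrite -fp1 -hE hcompA -uE -hcompA fp.
by rewrite comp1f.
Qed.

Lemma Ext1_pullE A B B' (g : hom B' B) (E : extension B A) (E1 : extension B' A) :
  ext_hom (idm A) g E1 E -> Ext1_pull g (ext_cls E) = ext_cls E1.
Proof.
move=> EE; apply/esym/ext_cls_eq/pull_univ.
have [_ Hs _] := @ext_iso_equiv A B.
have := ext_iso_hom (Hs _ _ (repr_cls (@ext_iso_equiv A B) E)).
by move=> /ext_hom_comp /(_ EE); rewrite !comp1f.
Qed.

Lemma Ext1_pull_hom A B B' (g : hom B' B) (E : extension B A)
    (E1 : extension B' A) :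
  Ext1_pull g (ext_cls E) = ext_cls E1 -> ext_hom (idm A) g E1 E.
Proof.
have [f [ff _]] := pull_map_ex g E.
have pE : ext_hom (idm A) g (pull_ext g E) E by exists f.
rewrite (Ext1_pullE pE) => /esym/ext_cls_inj.
by move/(ext_hom_comp pE); rewrite !compf1.
Qed.

Lemma Ext1_pushE A A' B (s : hom A A') (E : extension B A) (E1 : extension B A') :
  ext_hom s (idm B) E E1 -> Ext1_push s (ext_cls E) = ext_cls E1.
Proof.
move=> EE; apply/ext_cls_eq/push_univ.
have := ext_iso_hom (repr_cls (@ext_iso_equiv A B) E).
by move/(ext_hom_comp EE); rewrite !compf1.
Qed.

Lemma Ext1_push_hom A A' B (s : hom A A') (E : extension B A)
    (E1 : extension B A') :
  Ext1_push s (ext_cls E) = ext_cls E1 -> ext_hom s (idm B) E E1.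
Proof.
have [f [ff _]] := push_map_ex s E.
have pE : ext_hom s (idm B) E (push_ext s E) by exists f.
rewrite (Ext1_pushE pE) => /ext_cls_inj.
by move/ext_hom_comp/(_ pE); rewrite !comp1f.
Qed.

Lemma pull_ext_hom A B B' (g : hom B' B) (E : extension B A) :
  exists E1, ext_hom (idm A) g E1 E /\ Ext1_pull g (ext_cls E) = ext_cls E1.
Proof.
have [f [ff _]] := pull_map_ex g E.
have pE : ext_hom (idm A) g (pull_ext g E) E by exists f.
by exists (pull_ext g E); split; last exact: Ext1_pullE.
Qed.

Lemma push_ext_hom A A' B (s : hom A A') (E : extension B A) :
  exists E1, ext_hom s (idm B) E E1 /\ Ext1_push s (ext_cls E) = ext_cls E1.
Proof.
have [f [ff _]] := push_map_ex s E.
have pE : ext_hom s (idm B) E (push_ext s E) by exists f.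
by exists (push_ext s E); split; last exact: Ext1_pushE.
Qed.

Lemma Ext1_pull_comp A B B' B'' (g : hom B' B) (h : hom B'' B') (c : Ext1 B A) :
  Ext1_pull (g \oc h) c = Ext1_pull h (Ext1_pull g c).
Proof.
rewrite -(ext_cls_repr c).
have [E1 [m1 ->]] := pull_ext_hom g (repr c).
have [E2 [m2 ->]] := pull_ext_hom h E1.
by apply: Ext1_pullE; have := ext_hom_comp m1 m2; rewrite compf1.
Qed.

Lemma Ext1_push_comp A A' A'' B (s : hom A' A'') (t : hom A A') (c : Ext1 B A) :
  Ext1_push (s \oc t) c = Ext1_push s (Ext1_push t c).
Proof.
rewrite -(ext_cls_repr c).
have [E1 [m1 ->]] := push_ext_hom t (repr c).
have [E2 [m2 ->]] := push_ext_hom s E1.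
by apply: Ext1_pushE; have := ext_hom_comp m2 m1; rewrite compf1.
Qed.

Lemma Ext1_pull_id A B (c : Ext1 B A) : Ext1_pull (idm B) c = c.
Proof. by rewrite -(ext_cls_repr c); apply/Ext1_pullE/ext_hom_id. Qed.

Lemma Ext1_push_id A B (c : Ext1 B A) : Ext1_push (idm A) c = c.
Proof. by rewrite -(ext_cls_repr c); apply/Ext1_pushE/ext_hom_id. Qed.

(** A morphism of extensions factors through the pushout of its source along [s]; the remaining
    factor is the identity on A', so this pushout is also the pullback of the target along [g]. *)
Lemma ext_hom_push_pull A A' B B' (s : hom A A') (g : hom B' B)
    (E' : extension B' A) (E : extension B A') : ext_hom s g E' E ->
  Ext1_push s (ext_cls E') = Ext1_pull g (ext_cls E).
Proof.
by move=> m; rewrite (Ext1_pullE (push_univ m));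
  have [E1 [m1 ->]] := push_ext_hom s E'; rewrite -(Ext1_pushE m1);
  apply: Ext1_pushE; have [f [ff _]] := push_map_ex s E'; exists f.
Qed.

Lemma Ext1_push_pull A A' B B' (s : hom A A') (g : hom B' B) (c : Ext1 B A) :
  Ext1_push s (Ext1_pull g c) = Ext1_pull g (Ext1_push s c).
Proof.
rewrite -(ext_cls_repr c).
have [E1 [m1 ->]] := pull_ext_hom g (repr c).
have [E2 [m2 ->]] := push_ext_hom s (repr c).
by apply: ext_hom_push_pull; have := ext_hom_comp m2 m1; rewrite compf1 comp1f.
Qed.

Lemma Ext1_push0 A A' B (c : Ext1 B A) :
  Ext1_push (0 : hom A A') c = Ext1_zero B A'.
Proof.
rewrite -(ext_cls_repr c); apply: Ext1_pushE; exists (in2 A' B \oc eproj (repr c)).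
split=> /=; first by rewrite -hcompA eproj_einj !compf0.
by rewrite hcompA pr2_in2.
Qed.

Lemma Ext1_pull0 A B B' (c : Ext1 B A) :
  Ext1_pull (0 : hom B' B) c = Ext1_zero B' A.
Proof.
rewrite -(ext_cls_repr c); apply: Ext1_pullE; exists (einj (repr c) \oc pr1 A B').
split=> /=; first by rewrite -hcompA pr1_in1.
by rewrite hcompA eproj_einj !comp0f.
Qed.

(* By additivity Ext^1(B, A + A) = Ext^1(B, A)^2, which reduces the group laws of
   the Baer sum to the functoriality of pushforwards. *)
Lemma Ext1_pair A B (c c' : Ext1 B A) : exists D : Ext1 B (bisum A A),
  [/\ Ext1_push (pr1 A A) D = c, Ext1_push (pr2 A A) D = c'
    & Ext1_add c c' = Ext1_push (pr1 A A + pr2 A A) D].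
Proof.
set E := repr c; set E' := repr c'.
set D := pull_ext (in1 B B + in2 B B) (bisum_ext E E').
have [f [[fi fp] _]] := pull_map_ex (in1 B B + in2 B B) (bisum_ext E E').
exists (ext_cls D); split.
- rewrite -(ext_cls_repr c); apply: Ext1_pushE; exists (pr1 E E' \oc f); split.
    rewrite -hcompA fi compf1 /= compDr !hcompA pr1_in1 pr1_in2.
    by rewrite comp1f !comp0f addr0.
  have -> : eproj E \oc (pr1 E E' \oc f) = pr1 B B \oc (eproj (bisum_ext E E') \oc f).
    by rewrite /= !hcompA compDr !hcompA pr1_in1 pr1_in2 comp1f !comp0f addr0.
  by rewrite fp hcompA compDr pr1_in1 pr1_in2 addr0 !comp1f.
- rewrite -(ext_cls_repr c'); apply: Ext1_pushE; exists (pr2 E E' \oc f); split.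
    rewrite -hcompA fi compf1 /= compDr !hcompA pr2_in1 pr2_in2.
    by rewrite comp1f !comp0f add0r.
  have -> : eproj E' \oc (pr2 E E' \oc f) = pr2 B B \oc (eproj (bisum_ext E E') \oc f).
    by rewrite /= !hcompA compDr !hcompA pr2_in1 pr2_in2 comp1f !comp0f add0r.
  by rewrite fp hcompA compDr pr2_in1 pr2_in2 add0r !comp1f.
- have [E1 [m1 ->]] := push_ext_hom (pr1 A A + pr2 A A) D.
  by apply/ext_cls_eq/push_univ.
Qed.

(** Any extension with pushforwards E1 and E2 along the two projections maps to E1 + E2 over the
    diagonal of B. Its class is therefore the pullback of E1 + E2 along the diagonal, which involves
    only E1 and E2. *)
Lemma Ext1_pair_inj A B (D D' : Ext1 B (bisum A A)) :
  Ext1_push (pr1 A A) D = Ext1_push (pr1 A A) D' ->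
  Ext1_push (pr2 A A) D = Ext1_push (pr2 A A) D' -> D = D'.
Proof.
rewrite -(ext_cls_repr D) -(ext_cls_repr D').
have [E1 [m1 mE1]] := push_ext_hom (pr1 A A) (repr D).
have [E2 [m2 mE2]] := push_ext_hom (pr2 A A) (repr D).
rewrite mE1 mE2 => /esym/Ext1_push_hom m1' /esym/Ext1_push_hom m2'.
suff H (E : extension B (bisum A A)) :
    ext_hom (pr1 A A) (idm B) E E1 -> ext_hom (pr2 A A) (idm B) E E2 ->
    ext_cls E = Ext1_pull (in1 B B + in2 B B) (ext_cls (bisum_ext E1 E2)).
  by rewrite (H _ m1 m2) (H _ m1' m2').
move=> [f [fi fp]] [g [gi gp]]; apply/esym/Ext1_pullE.
exists (in1 E1 E2 \oc f + in2 E1 E2 \oc g); split=> /=.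
  by rewrite compf1 compDl -!hcompA fi gi.
rewrite compDl !compDr -!hcompA pr1_in1A pr1_in2A pr2_in1A pr2_in2A.
by rewrite !compf0 addr0 add0r fp gp !comp1f compDl.
Qed.

Lemma Ext1_addE A B (D : Ext1 B (bisum A A)) :
  Ext1_add (Ext1_push (pr1 A A) D) (Ext1_push (pr2 A A) D)
  = Ext1_push (pr1 A A + pr2 A A) D.
Proof.
have [D' [D1 D2 ->]] :=
  Ext1_pair (Ext1_push (pr1 A A) D) (Ext1_push (pr2 A A) D).
by rewrite (Ext1_pair_inj D1 D2).
Qed.

(** The pair formed by the two pushforwards is itself the pushforward of [c] along the morphism with
    components [s] and [t], and the codiagonal composed with that morphism is [s + t]. *)
Lemma Ext1_push_add A A' B (s t : hom A A') (c : Ext1 B A) :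
  Ext1_push (s + t) c = Ext1_add (Ext1_push s c) (Ext1_push t c).
Proof.
have := Ext1_addE (Ext1_push (in1 A' A' \oc s + in2 A' A' \oc t) c).
rewrite -!Ext1_push_comp compDl !compDr !pr1_in1A !pr1_in2A !pr2_in1A !pr2_in2A.
by rewrite add0r addr0.
Qed.

Lemma Ext1_pull_addl A B B' (g : hom B' B) (c c' : Ext1 B A) :
  Ext1_pull g (Ext1_add c c') = Ext1_add (Ext1_pull g c) (Ext1_pull g c').
Proof.
have [D [<- <- ->]] := Ext1_pair c c'.
by rewrite -!Ext1_push_pull Ext1_addE.
Qed.

Lemma Ext1_push_addl A A' B (s : hom A A') (c c' : Ext1 B A) :
  Ext1_push s (Ext1_add c c') = Ext1_add (Ext1_push s c) (Ext1_push s c').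
Proof.
have [D [<- <- ->]] := Ext1_pair c c'.
by rewrite -!Ext1_push_comp -Ext1_push_add compDr.
Qed.

Lemma Ext1_add0 A B (c : Ext1 B A) : Ext1_add c (Ext1_zero B A) = c.
Proof.
by rewrite -(Ext1_push0 A c) -{1}(Ext1_push_id c) -Ext1_push_add addr0 Ext1_push_id.
Qed.

Lemma Ext1_0add A B (c : Ext1 B A) : Ext1_add (Ext1_zero B A) c = c.
Proof.
by rewrite -(Ext1_push0 A c) -{2}(Ext1_push_id c) -Ext1_push_add add0r Ext1_push_id.
Qed.

Definition Ext1_opp A B (c : Ext1 B A) : Ext1 B A := Ext1_push (- idm A) c.

Lemma Ext1_addN A B (c : Ext1 B A) : Ext1_add c (Ext1_opp c) = Ext1_zero B A.
Proof.
by rewrite -{1}(Ext1_push_id c) -Ext1_push_add subrr Ext1_push0.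
Qed.

Lemma Ext1_Nadd A B (c : Ext1 B A) : Ext1_add (Ext1_opp c) c = Ext1_zero B A.
Proof.
by rewrite -{2}(Ext1_push_id c) -Ext1_push_add addNr Ext1_push0.
Qed.

(** Using [Ext1_pair] twice makes x, y and z pushforwards of a single class [D3]; z is first sent
    through [in1] to have the same coefficients as [D]. Associativity then becomes that of the sum
    of morphisms. *)
Lemma Ext1_addA A B (x y z : Ext1 B A) :
  Ext1_add x (Ext1_add y z) = Ext1_add (Ext1_add x y) z.
Proof.
have [D [<- <- ->]] := Ext1_pair x y.
set t := Ext1_push (in1 A A) (Ext1_zero B A).
have [D3 [D31 D32 _]] :=
  Ext1_pair D (Ext1_push (in1 A A) z).
have -> : z = Ext1_push (pr1 A A \oc pr2 (bisum A A) (bisum A A)) D3.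
  by rewrite Ext1_push_comp D32 -Ext1_push_comp pr1_in1 Ext1_push_id.
by rewrite -D31 -!Ext1_push_comp -!Ext1_push_add compDl addrA.
Qed.

Lemma Ext1_addIr A B (c d e : Ext1 B A) : Ext1_add c e = Ext1_add d e -> c = d.
Proof.
move/(congr1 (fun x => Ext1_add x (Ext1_opp e))).
by rewrite -!Ext1_addA Ext1_addN !Ext1_add0.
Qed.

End AbelianLemmas.

(** * The exact sequence of Ext groups *)

Section ExtSequence.
Variable C : abelian_category.
Variables (A B Z Z' : C) (i : hom Z' Z) (q : hom Z B).
Hypothesis iq : short_exact i q.

(** A splitting of the pullback is a lift [s] of [i] to E. Dividing E by the image of [s] leaves an
    extension of B by A whose pullback along [q] is E. *)
Lemma Ext1_pull_exact (e : Ext1 Z A) : Ext1_pull i e = Ext1_zero Z' A ->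
  exists c : Ext1 B A, Ext1_pull q c = e.
Proof.
rewrite -(ext_cls_repr e); set E := repr e.
move=> /Ext1_pull_hom [f [fi fp]].
pose s := f \oc in2 A Z'.
have sp : eproj E \oc s = i by rewrite hcompA fp -hcompA pr2_in2 compf1.
have [im _ qe] := iq.
have sm : mono s.
  by apply: mono0 => V t st; apply: (mono_eq0 im); rewrite -sp -hcompA st compf0.
have [r rE] : exists r, r \oc cmap s = q \oc eproj E.
  by apply: coker_fac; rewrite -hcompA sp; apply: short_exact0 iq.
have ex : short_exact (cmap s \oc einj E) r.
  split.
  - apply: mono0 => V t; rewrite -hcompA => /(mono_normal sm) [w wE].
    have w0 : w = 0.
      apply: (mono_eq0 im); rewrite -sp -hcompA wE hcompA eproj_einj.
      by rewrite comp0f.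
    by apply: (@einj_mono _ _ _ E); rewrite -wE w0 !compf0.
  - apply: exactI => [|V t].
      by rewrite hcompA rE -hcompA eproj_einj compf0.
    rewrite hcompA => /(exact_desc (e_exact E)) [u uE].
    have /(exact_desc iq) [v vE] : u \oc i = 0.
      by rewrite -sp hcompA uE -hcompA coker0 compf0.
    exists v; apply: (@cmap_epi _ _ _ s).
    by rewrite -uE -vE -!hcompA rE.
  - apply: epi0 => V t tr; apply: (epi_eq0 qe); apply: (epi_eq0 (@eproj_epi _ _ _ E)).
    by rewrite -hcompA -rE hcompA tr comp0f.
exists (ext_cls (Extension ex)); apply: Ext1_pullE; exists (cmap s).
by split; rewrite /= ?compf1.
Qed.

(** The pullback P of E to Z maps onto E with kernel a copy of Z'. If P is also the pullback of E',
    its map to E' sends that copy into A, hence to zero, and so descends to a morphism from E to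
    E'. *)
Lemma Ext1_pull_inj (c c' : Ext1 B A) : (forall f : hom Z' A, f = 0) ->
  Ext1_pull q c = Ext1_pull q c' -> c = c'.
Proof.
move=> Z'A0; rewrite -(ext_cls_repr c) -(ext_cls_repr c').
set E := repr c; set E' := repr c'.
have [im _ qe] := iq.
have [f [[fi fp] fu]] := pull_map_ex q E; set P := pull_ext q E in f fi fp fu *.
have -> : Ext1_pull q (ext_cls E) = ext_cls P by apply: Ext1_pullE; exists f.
move=> /esym/Ext1_pull_hom [f' [fi' fp']].
have fe : epi f.
  apply: epi0 => V h hf.
  have /(exact_desc (e_exact E)) [m mE] : h \oc einj E = 0.
    by rewrite -[einj E]compf1 -fi hcompA hf comp0f.
  suff m0 : m = 0 by rewrite -mE m0 comp0f.
  apply: (epi_eq0 qe); apply: (epi_eq0 (@eproj_epi _ _ _ P)).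
  by rewrite -hcompA -fp hcompA mE.
(* [w] is the copy of Z' in P: zero in E and [i] in Z, compatible since [q \oc i = 0]. *)
have [w [fw pw]] : exists w, f \oc w = 0 /\ eproj P \oc w = i.
  by apply: fu; rewrite compf0 (short_exact0 iq).
have f'w : f' \oc w = 0.
  have /(exact_lift (e_exact E')) [s <-] : eproj E' \oc (f' \oc w) = 0.
    by rewrite hcompA fp' -hcompA pw (short_exact0 iq).
  by rewrite (Z'A0 s) compf0.
(* The kernel of [f] factors through [w]: its component in Z dies in B, so it comes from Z', and
   subtracting [w \oc v] leaves a part of A on which [f] is injective. *)
have /(epi_normal fe) [u uE] : f' \oc kmap f = 0.
  set t := kmap f.
  have /(exact_lift iq) [v vE] : q \oc (eproj P \oc t) = 0.
    by rewrite hcompA -fp -hcompA ker0 compf0.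
  have /(exact_lift (e_exact P)) [s sE] : eproj P \oc (t - w \oc v) = 0.
    by rewrite compBr (hcompA _ w) pw vE subrr.
  have s0 : s = 0.
    apply: (@einj_mono _ _ _ E); rewrite compf0 -[einj E]compf1 -fi -hcompA sE.
    by rewrite compBr ker0 hcompA fw comp0f subrr.
  have -> : t = w \oc v by apply/eqP; rewrite -subr_eq0 -sE s0 compf0.
  by rewrite hcompA f'w comp0f.
apply: ext_cls_eq; exists u; split.
  by rewrite -[einj E]compf1 -fi hcompA uE fi'.
by apply: fe; rewrite -hcompA uE fp' comp1f fp.
Qed.

End ExtSequence.

(** * Vanishing of Ext^2 and extension of classes *)

Section Ext2.
Variable C : abelian_category.

Lemma exact_mono_lift X Y Z V (f : hom X Y) (g : hom Y Z) (t : hom V Y) :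
  mono f -> @exact C _ _ _ f g -> g \oc t = 0 -> exists u : hom V X, f \oc u = t.
Proof.
move=> fm [_ fg] /ker_fac [s <-].
by apply: mono_normal => //; rewrite hcompA fg comp0f.
Qed.

Lemma exact_epi_desc X Y Z V (f : hom X Y) (g : hom Y Z) (t : hom Y V) :
  epi g -> @exact C _ _ _ f g -> t \oc f = 0 -> exists u : hom Z V, u \oc g = t.
Proof.
move=> ge [_ fg] /coker_fac [s <-].
by apply: epi_normal => //; rewrite -hcompA fg compf0.
Qed.

Variables (A B : C).

(* The extension of im(e2mid) by A given by emid1 is the pullback of an extension
   X of emid2 by A.  This is invariant under morphisms of 2-extensions in both
   directions, hence under the equivalence relation that they generate;
   [ext2_splitsE] is the dual description of X as an extension of B by emid1. *)
Definition ext2_splits (E : extension2 B A) : Prop :=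
  exists (X : C) (u : hom (emid1 E) X) (v : hom X (emid2 E)),
    v \oc u = e2mid E /\ short_exact (u \oc e2inj E) v.

Lemma ext2_splitsE (E : extension2 B A) X (u : hom (emid1 E) X)
    (v : hom X (emid2 E)) : v \oc u = e2mid E ->
  short_exact (u \oc e2inj E) v <-> short_exact u (e2proj E \oc v).
Proof.
move=> vu; have [am ex1] := (@e2_mono _ _ _ E, e2_exact1 E).
have [ex2 pe] := (e2_exact2 E, @e2_epi _ _ _ E).
split=> [uv|[um uv pve]].
- have [uam _ ve] := uv; split.
  + apply: mono0 => V t ut.
    have /(exact_mono_lift am ex1) [s sE] : e2mid E \oc t = 0.
      by rewrite -vu -hcompA ut compf0.
    suff s0 : s = 0 by rewrite -sE s0 compf0.
    by apply: (mono_eq0 uam); rewrite -hcompA sE.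
  + apply: exactI => [|V t tu]; first by rewrite -hcompA vu; case: ex2.
    have /(exact_desc uv) [w wE] : t \oc (u \oc e2inj E) = 0.
      by rewrite hcompA tu comp0f.
    have /(exact_epi_desc pe ex2) [x xE] : w \oc e2mid E = 0.
      by rewrite -vu hcompA wE.
    by exists x; rewrite hcompA xE.
  + by apply: epi0 => V h hpv; apply: (epi_eq0 pe); apply: (epi_eq0 ve); rewrite -hcompA.
- split.
  + by apply: mono0 => V t; rewrite -hcompA => /(mono_eq0 um)/(mono_eq0 am).
  + split; first by rewrite hcompA vu; case: ex1.
    set t := kmap v.
    have /(exact_mono_lift um uv) [w wE] : (e2proj E \oc v) \oc t = 0.
      by rewrite -hcompA ker0 compf0.
    have /(exact_mono_lift am ex1) [s sE] : e2mid E \oc w = 0.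
      by rewrite -vu -hcompA wE ker0.
    by rewrite -wE -sE (hcompA u) hcompA coker0 comp0f.
  + apply: epi0 => V h hv.
    have /(exact_epi_desc pe ex2) [x xE] : h \oc e2mid E = 0.
      by rewrite -vu hcompA hv comp0f.
    suff x0 : x = 0 by rewrite -xE x0 comp0f.
    by apply: (epi_eq0 pve); rewrite hcompA xE.
Qed.

(** Each direction needs its own description of X. Forwards, the extension of B by [emid1 E] is
    pushed out along [f1]; backwards, the extension of [emid2 E'] by A is pulled back along [f2]. *)
Lemma ext2_splits_mor (E E' : extension2 B A) :
  ext2_mor E E' -> ext2_splits E <-> ext2_splits E'.
Proof.
move=> [f1 [f2 [f1i f2m f2p]]]; split=> [[X [u [v [vu]]]]|[X [u [v [vu uv]]]]].
- move/(ext2_splitsE vu) => uv; pose F := Extension uv.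
  have [g [[gi gp] gu]] := push_map_ex f1 F.
  have [v' [v'g v'i]] := gu _ (f2 \oc v) (e2mid E') (ltac:(by rewrite /= -hcompA vu)).
  exists (push_ext f1 F), (einj (push_ext f1 F)), v'; split=> //.
  apply/ext2_splitsE => //.
  suff -> : e2proj E' \oc v' = eproj (push_ext f1 F) by apply: e_exact.
  have /(exact_desc (e_exact _)) [w wE] :
      (e2proj E' \oc v') \oc einj (push_ext f1 F) = 0.
    by rewrite -hcompA v'i; case: (e2_exact2 E').
  rewrite -wE; suff -> : w = idm B by rewrite comp1f.
  apply: (@eproj_epi _ _ _ F); transitivity (w \oc (idm B \oc eproj F)).
    by rewrite comp1f.
  by rewrite -gp hcompA wE -hcompA v'g hcompA f2p gp comp1f.
- pose F := Extension uv.
  have [g [[gi gp] gu]] := pull_map_ex f2 F.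
  have [u' [gu' pu']] := gu _ (u \oc f1) (e2mid E) (ltac:(by rewrite /= hcompA vu f2m)).
  exists (pull_ext f2 F), u', (eproj (pull_ext f2 F)); split=> //.
  suff -> : u' \oc e2inj E = einj (pull_ext f2 F) by apply: e_exact.
  have /(exact_lift (e_exact _)) [w wE] :
      eproj (pull_ext f2 F) \oc (u' \oc e2inj E) = 0.
    by rewrite hcompA pu'; case: (e2_exact1 E).
  rewrite -wE; suff -> : w = idm A by rewrite compf1.
  apply: (@einj_mono _ _ _ F); transitivity ((einj F \oc idm A) \oc w).
    by rewrite compf1.
  by rewrite -gi -hcompA wE hcompA gu' -hcompA f1i gi compf1.
Qed.

(** Classes are predicates, so evaluating their equality at the trivial 2-extension yields a zigzag
    from E to it. Splitting is carried along the zigzag from the trivial 2-extension, which splits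
    through A + B. *)
Lemma ext2_vanishes_splits (E : extension2 B A) :
  Ext2_vanishes B A -> ext2_splits E.
Proof.
move/(_ (cls _ E)) => [] /(congr1 (fun P => P (trivial_ext2 B A))).
have E0 : clos_refl_sym_trans _ (@ext2_mor C B A) (trivial_ext2 B A) (trivial_ext2 B A).
  exact: rst_refl.
move=> EE; rewrite -EE in E0; suff [_ H] : ext2_splits E <-> ext2_splits (trivial_ext2 B A).
  apply: H; exists (bisum A B), (in1 A B), (pr2 A B); rewrite pr2_in1 /= compf1.
  by split=> //; apply: split_exact.
elim: E0 => [E1 E2 /ext2_splits_mor //|E1 //|E1 E2 _ [] //|E1 E2 E3 _ -> _ -> //].
Qed.

End Ext2.

(** The obstruction is the Yoneda product of [y] with [iq], the 2-extension A -> E -> Z -> B. An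
    object splitting it is exactly an extension of Z by A that pulls back to E. *)
Lemma Ext1_pull_surj (C : abelian_category) (A B Z Z' : C) (i : hom Z' Z)
    (q : hom Z B) (y : Ext1 Z' A) : short_exact i q -> Ext2_vanishes B A ->
  exists e : Ext1 Z A, Ext1_pull i e = y.
Proof.
move=> iq E0; rewrite -(ext_cls_repr y); set E := repr y.
have [im [qi _] qe] := iq.
have ex1 : exact (einj E) (i \oc eproj E).
  split; first by rewrite -hcompA eproj_einj compf0.
  have /(exact_lift (e_exact E)) [w <-] : eproj E \oc kmap (i \oc eproj E) = 0.
    by apply: (mono_eq0 im); rewrite hcompA ker0.
  by rewrite hcompA coker0 comp0f.
have ex2 : exact (i \oc eproj E) q.
  apply: exactI => [|V t]; first by rewrite hcompA qi comp0f.
  rewrite hcompA => /(epi_eq0 (@eproj_epi _ _ _ E)) /(exact_desc iq) [u <-].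
  by exists u.
have [X [u [v [vu uv]]]] :=
  ext2_vanishes_splits (Extension2 (@einj_mono _ _ _ E) ex1 ex2 qe) E0.
exists (ext_cls (Extension uv)); apply: Ext1_pullE; exists u.
by split; rewrite /= ?compf1.
Qed.

(** * The associated graded functors *)

Section ExactFunctors.
Variables (C : abelian_category) (F : exact_functor C).
Implicit Types X Y Z : C.

Lemma fmap0 X Y : fmap F (0 : hom X Y) = 0.
Proof. by apply: (addIr (fmap F 0)); rewrite -fmap_add !add0r. Qed.

Lemma fmap_sub X Y (f g : hom X Y) : fmap F (f - g) = fmap F f - fmap F g.
Proof. by apply: (addIr (fmap F g)); rewrite -fmap_add !subrK. Qed.

Lemma fmap_mono X Y (f : hom X Y) : mono f -> mono (fmap F f).
Proof. by move/short_exact_cmap/(fmap_exact F) => []. Qed.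

Lemma fmap_epi X Y (f : hom X Y) : epi f -> epi (fmap F f).
Proof. by move/short_exact_kmap/(fmap_exact F) => []. Qed.

Lemma fmap_iso X Y (f : hom X Y) : is_iso f -> is_iso (fmap F f).
Proof. by case=> g [gf fg]; exists (fmap F g); rewrite -!fmap_comp gf fg !fmap_id. Qed.

Lemma fmap_zero X : is_zero X -> is_zero (F X).
Proof. by move=> X0; rewrite /is_zero -fmap_id X0 fmap0. Qed.

End ExactFunctors.

Section Gr.
Variable T : filtered_category.
Implicit Types (X Y Z : T) (n m : int).

Lemma winc_mono n X : mono (winc n X).
Proof.
move=> Z g h gh; apply: (@winj_mono T (n - 1) X).
by rewrite -!winc_winj -!hcompA gh.
Qed.

Lemma gr_mapE n X Y (f : hom X Y) :
  gr_map n f \oc cmap (winc n X) = cmap (winc n Y) \oc fmap (W n) f.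
Proof. exact: (svalP (cid (gr_map_ex n f))). Qed.

Lemma gr_map_id n X : gr_map n (idm X) = idm (gr n X).
Proof. by apply: (@cmap_epi T); rewrite gr_mapE fmap_id comp1f compf1. Qed.

Lemma gr_map_comp n X Y Z (g : hom Y Z) (f : hom X Y) :
  gr_map n (g \oc f) = gr_map n g \oc gr_map n f.
Proof.
apply: (@cmap_epi T).
by rewrite gr_mapE fmap_comp hcompA -gr_mapE -!hcompA gr_mapE.
Qed.

Lemma gr_map_add n X Y (f g : hom X Y) :
  gr_map n (f + g) = gr_map n f + gr_map n g.
Proof.
by apply: (@cmap_epi T); rewrite compDl !gr_mapE fmap_add compDr.
Qed.

(** The nine lemma for the rows [W (n - 1)] and [W n], both exact because the W are exact
    functors. *)
Lemma gr_map_exact n X Y Z (f : hom X Y) (g : hom Y Z) :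
  short_exact f g -> short_exact (gr_map n f) (gr_map n g).
Proof.
move=> fg; have fgn := fmap_exact (W n) fg; have fgn1 := fmap_exact (W (n - 1)) fg.
have [fm _ ge] := fgn; split.
- apply: mono0 => V t ft.
  have [P [e [x [ee xe]]]] := epi_cover t (@cmap_epi _ _ _ (winc n X)).
  apply: (epi_eq0 ee); rewrite -xe.
  have /(exact_lift (short_exact_cmap (@winc_mono n Y))) [y yE] :
      cmap (winc n Y) \oc (fmap (W n) f \oc x) = 0.
    by rewrite hcompA -gr_mapE -hcompA xe hcompA ft comp0f.
  (* The element [y] of [W (n - 1) Y] dies in Z, so it comes from [W (n - 1) X]; strictness of [f]
     for the filtration is used here. *)
  have /(exact_lift fgn1) [x' x'E] : fmap (W (n - 1)) g \oc y = 0.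
    apply: (mono_eq0 (@winc_mono n Z)).
    by rewrite hcompA winc_nat -hcompA yE hcompA (short_exact0 fgn) comp0f.
  have <- : winc n X \oc x' = x.
    by apply: fm; rewrite hcompA -winc_nat -hcompA x'E yE.
  by rewrite hcompA coker0 comp0f.
- apply: exactI => [|V t tf].
    by rewrite -gr_map_comp (short_exact0 fg); apply: (@cmap_epi T);
      rewrite gr_mapE fmap0 compf0 comp0f.
  have /(exact_desc fgn) [u uE] : (t \oc cmap (winc n Y)) \oc fmap (W n) f = 0.
    by rewrite -hcompA -gr_mapE hcompA tf comp0f.
  have /coker_fac [v vE] : u \oc winc n Z = 0.
    have [_ _ ge1] := fgn1; apply: (epi_eq0 ge1).
    by rewrite -hcompA winc_nat hcompA uE -hcompA coker0 compf0.
  exists v; apply: (@cmap_epi T).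
  by rewrite -uE -vE -!hcompA gr_mapE.
- apply: epi0 => V t tg; apply: (epi_eq0 (@cmap_epi _ _ _ (winc n Z))).
  apply: (epi_eq0 ge).
  by rewrite -hcompA -gr_mapE hcompA tg comp0f.
Qed.

Definition grF n : exact_functor T :=
  @ExactFunctor T (gr n) (gr_map n) (gr_map_id n) (gr_map_comp n)
    (gr_map_add n) (gr_map_exact n).

Lemma gr_map0 n X Y : gr_map n (0 : hom X Y) = 0.
Proof. exact: (fmap0 (grF n)). Qed.

Lemma gr_map_sub n X Y (f g : hom X Y) :
  gr_map n (f - g) = gr_map n f - gr_map n g.
Proof. exact: (fmap_sub (grF n)). Qed.

Lemma gr_mono n X Y (f : hom X Y) : mono f -> mono (gr_map n f).
Proof. exact: (@fmap_mono _ (grF n)). Qed.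

Lemma gr_epi n X Y (f : hom X Y) : epi f -> epi (gr_map n f).
Proof. exact: (@fmap_epi _ (grF n)). Qed.

Lemma gr_iso n X Y (f : hom X Y) : is_iso f -> is_iso (gr_map n f).
Proof. exact: (@fmap_iso _ (grF n)). Qed.

Lemma gr_zero n X : is_zero (W n X) -> is_zero (gr n X).
Proof. exact: epi_zero (@cmap_epi _ _ _ _). Qed.

Lemma winc_iso_gr0 n X : is_iso (winj n X) -> is_iso (winj (n - 1) X) ->
  is_zero (gr n X).
Proof.
move=> i i1; apply: epi_coker_zero; apply: epi0 => V h hw.
have [g [gw _]] := i.
have hE : h = (h \oc g) \oc winj n X by rewrite -hcompA gw compf1.
suff hg : h \oc g = 0 by rewrite hE hg comp0f.
by apply: (epi_eq0 (is_iso_epi i1)); rewrite -winc_winj hcompA -hE.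
Qed.

(** Upward induction from a weight where [W] vanishes to one where it is all of X: a zero graded
    piece makes [winc] an epimorphism, so zero propagates. *)
Lemma gr_all0 X : (forall n, is_zero (gr n X)) -> is_zero X.
Proof.
move=> gr0; have [a aP] := W_low X; have [b bP] := W_high X.
have W0 (i : nat) : is_zero (W (a + i%:Z) X).
  elim: i => [|i IH]; first by apply: aP; rewrite addr0.
  apply: (epi_zero (epi_coker0 (gr0 (a + i.+1%:Z)))).
  by have -> : a + i.+1%:Z - 1 = a + i%:Z by lia.
have /is_iso_epi/epi_zero : is_iso (winj (a + `|b - a|%N%:Z) X) by apply: bP; lia.
exact.
Qed.

(** The graded pieces of the image of [f] embed in those of Y and are quotients of those of X
    through a zero map, so the image itself is zero. *)
Lemma gr_faithful X Y (f : hom X Y) : (forall n, gr_map n f = 0) -> f = 0.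
Proof.
move=> gf; have [I [q [m [qe mm fE]]]] := epi_mono_factor f.
suff I0 : is_zero I by rewrite fE (zero_from m I0) comp0f.
apply: gr_all0 => n; apply: (mono_eq0 (gr_mono mm)); rewrite compf1.
by apply: (epi_eq0 (gr_epi qe)); rewrite -gr_map_comp -fE.
Qed.

Lemma gr_faithful2 X Y (f g : hom X Y) :
  (forall n, gr_map n f = gr_map n g) -> f = g.
Proof.
move=> fg; apply/eqP; rewrite -subr_eq0; apply/eqP/gr_faithful => n.
by rewrite gr_map_sub fg subrr.
Qed.

Lemma gr_reflect_mono X Y (f : hom X Y) : (forall n, mono (gr_map n f)) -> mono f.
Proof.
move=> gm; apply: mono0 => V t ft; apply: gr_faithful => n.
by apply: (mono_eq0 (gm n)); rewrite -gr_map_comp ft gr_map0.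
Qed.

Lemma gr_reflect_epi X Y (f : hom X Y) : (forall n, epi (gr_map n f)) -> epi f.
Proof.
move=> gm; apply: epi0 => V t ft; apply: gr_faithful => n.
by apply: (epi_eq0 (gm n)); rewrite -gr_map_comp ft gr_map0.
Qed.

Lemma gr_reflect_iso X Y (f : hom X Y) :
  (forall n, is_iso (gr_map n f)) -> is_iso f.
Proof.
move=> gi; apply: mono_epi_iso.
  by apply: gr_reflect_mono => n; apply: is_iso_mono.
by apply: gr_reflect_epi => n; apply: is_iso_epi.
Qed.

Lemma gr_reflect_exact X Y Z (f : hom X Y) (g : hom Y Z) :
  (forall n, short_exact (gr_map n f) (gr_map n g)) -> short_exact f g.
Proof.
move=> gfg; split.
- by apply: gr_reflect_mono => n; case: (gfg n).
- split; apply: gr_faithful => n; rewrite gr_map_comp.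
    exact: short_exact0 (gfg n).
  have /(exact_lift (gfg n)) [s <-] : gr_map n g \oc gr_map n (kmap g) = 0.
    by rewrite -gr_map_comp ker0 gr_map0.
  by rewrite hcompA -gr_map_comp coker0 gr_map0 comp0f.
- by apply: gr_reflect_epi => n; case: (gfg n).
Qed.

Lemma W_incl n m X : n <= m ->
  exists j : hom (W n X) (W m X), winj m X \oc j = winj n X.
Proof.
move=> nm; have -> : m = n + `|m - n|%N%:Z by lia.
elim: `|m - n|%N => [|i [j jE]].
  by rewrite addr0; exists (idm _); rewrite compf1.
have {j jE} : exists j : hom (W n X) (W (n + i.+1%:Z - 1) X),
    winj (n + i.+1%:Z - 1) X \oc j = winj n X.
  by have -> : n + i.+1%:Z - 1 = n + i%:Z by [lia]; exists j.
case=> j jE; exists (winc _ X \oc j).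
by rewrite hcompA winc_winj.
Qed.

Lemma cmap_winj0 n m X : n <= m -> cmap (winj m X) \oc winj n X = 0.
Proof. by move=> /(W_incl X) [j <-]; rewrite hcompA coker0 comp0f. Qed.

Lemma winj_short_exact n X : short_exact (winj n X) (cmap (winj n X)).
Proof. exact: short_exact_cmap (@winj_mono T n X). Qed.

(** [W m X] maps onto [W m] of the quotient by exactness, while its image in the quotient is zero
    because [W m X] lies in [W n X]. *)
Lemma W_coker0 n m X : m <= n -> is_zero (W m (coker (winj n X))).
Proof.
move=> mn; have [_ _ ce] := fmap_exact (W m) (winj_short_exact n X).
apply: (epi_eq0 ce); rewrite comp1f.
apply: (mono_eq0 (@winj_mono T m _)).
by rewrite winj_nat; apply: cmap_winj0.
Qed.

Lemma gr_coker0 n m X : m <= n -> is_zero (gr m (coker (winj n X))).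
Proof. by move=> mn; apply/gr_zero/W_coker0. Qed.

(** The inclusion of [W n X] in [W m X] dies in the quotient by [W n X], so it lifts to
    [W m (W n X)]; the lift is a section of the monomorphism [winj]. *)
Lemma winj_W_iso n m X : n <= m -> is_iso (winj m (W n X)).
Proof.
move=> nm; have [j jE] := W_incl X nm.
have /(exact_lift (fmap_exact (W m) (winj_short_exact n X))) [s sE] :
    fmap (W m) (cmap (winj n X)) \oc j = 0.
  by apply: (mono_eq0 (@winj_mono T m _)); rewrite hcompA winj_nat -hcompA jE coker0.
apply: mono_epi_iso; first exact: winj_mono.
have ws : winj m (W n X) \oc s = idm _.
  apply: (@winj_mono T n X); rewrite compf1 hcompA -winj_nat.
  by rewrite -hcompA sE.
by apply: epi0 => V h hw; rewrite -[h]compf1 -ws hcompA hw comp0f.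
Qed.

Lemma gr_W0 n m X : n < m -> is_zero (gr m (W n X)).
Proof. by move=> nm; apply: winc_iso_gr0; apply: winj_W_iso; lia. Qed.

Lemma gr_winj_iso n m X : m <= n -> is_iso (gr_map m (winj n X)).
Proof.
move=> mn; apply: short_exact_isol (gr_map_exact m (winj_short_exact n X)) _.
exact: gr_coker0.
Qed.

Lemma gr_cmap_iso n m X : n < m -> is_iso (gr_map m (cmap (winj n X))).
Proof.
move=> mn; apply: short_exact_isor (gr_map_exact m (winj_short_exact n X)) _.
exact: gr_W0.
Qed.

(** Below n, both [W (n - 1) X] and [W n X] have the same piece of weight m as X, so nothing of
    weight m is left in their quotient; above n, [W n X] has no such piece. *)
Lemma gr_gr0 n m X : m != n -> is_zero (gr m (gr n X)).
Proof.
move=> mn; have ex := gr_map_exact m (short_exact_cmap (@winc_mono n X)).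
have [_ _ ge] := ex; have [lt_mn | le_nm] := ltP m n; last first.
  by apply: (epi_zero ge); apply: gr_W0; lia.
have wi : is_iso (gr_map m (winj n X)) by apply: gr_winj_iso; lia.
have wi1 : is_iso (gr_map m (winj (n - 1) X)) by apply: gr_winj_iso; lia.
have we : epi (gr_map m (winc n X)).
  apply: epi0 => V h hw; have [g [gw _]] := wi.
  suff hg : h \oc g = 0 by rewrite -[h]compf1 -gw hcompA hg comp0f.
  apply: (epi_eq0 (is_iso_epi wi1)).
  by rewrite -winc_winj gr_map_comp hcompA -(hcompA h) gw compf1.
apply: (epi_eq0 ge); rewrite comp1f; apply: (epi_eq0 we).
exact: short_exact0 ex.
Qed.

Lemma pure_gr0 n m X : pure n X -> m != n -> is_zero (gr m X).
Proof.
move=> [X0 Xi] mn; have [lt_mn | le_nm] := ltP m n; last first.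
  apply: (epi_zero (is_iso_epi (gr_iso m Xi))).
  by apply: gr_W0; lia.
have mn1 : m <= n - 1 by lia.
apply: (epi_zero (is_iso_epi (gr_winj_iso X mn1))).
exact: (fmap_zero (grF m)).
Qed.

Lemma pure_gr_ex n X : pure n X ->
  exists c : hom (gr n X) X, is_iso c /\ c \oc cmap (winc n X) = winj n X.
Proof.
move=> [X0 Xi].
have ci := short_exact_isor (short_exact_cmap (@winc_mono n X)) X0.
have [g [gc cg]] := ci; exists (winj n X \oc g); split.
  by apply: is_iso_comp => //; apply: is_iso_inv gc cg.
by rewrite -hcompA gc compf1.
Qed.

Definition pure_gr n X (h : pure n X) : hom (gr n X) X :=
  sval (cid (pure_gr_ex h)).

Lemma pure_gr_iso n X (h : pure n X) : is_iso (pure_gr h).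
Proof. by case: (svalP (cid (pure_gr_ex h))). Qed.

Lemma pure_grE n X (h : pure n X) : pure_gr h \oc cmap (winc n X) = winj n X.
Proof. by case: (svalP (cid (pure_gr_ex h))). Qed.

Lemma pure_gr_nat n X Y (h : pure n X) (f : hom Y X) :
  pure_gr h \oc gr_map n f \oc cmap (winc n Y) = f \oc winj n Y.
Proof. by rewrite -hcompA gr_mapE hcompA pure_grE winj_nat. Qed.

End Gr.

Section MorePure.
Variable T : filtered_category.
Implicit Types (X Y Z : T) (n m : int).

Lemma gr0_pure n X : (forall m, m != n -> is_zero (gr m X)) -> pure n X.
Proof.
move=> X0; split.
  apply: gr_all0 => m; have [mn|nm] := leP m (n - 1); last exact: gr_W0.
  apply: (mono_zero (is_iso_mono (gr_winj_iso X mn))).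
  by apply: X0; lia.
apply: gr_reflect_iso => m; have [mn|nm] := leP m n; first exact: gr_winj_iso.
by apply: zero_iso; [apply: gr_W0 | apply: X0; lia].
Qed.

Lemma pure_gr_full n X Y (u : hom (gr n X) (gr n Y)) : pure n X -> pure n Y ->
  exists f : hom X Y, gr_map n f = u.
Proof.
move=> hX hY; have [c [cX Xc]] := pure_gr_iso hX.
exists (pure_gr hY \oc u \oc c).
apply: (is_iso_mono (pure_gr_iso hY)); apply: (@cmap_epi T).
by rewrite pure_gr_nat -!hcompA -pure_grE (hcompA c) cX comp1f.
Qed.

Lemma hom_gr0 X Y (f : hom X Y) :
  (forall n, is_zero (gr n X) \/ is_zero (gr n Y)) -> f = 0.
Proof. by move=> XY; apply: gr_faithful => n; case: (XY n) => [/zero_from|/zero_to]. Qed.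

End MorePure.

(** * The direct sum of graded pieces and marked objects *)

Section GrSum.
Variable T : filtered_category.
Implicit Types (X Y Z : T) (n m : int).

(** [weights X] lists the n with [low X < n <= high X]. The value [low X] is left out since [W]
    already vanishes there; past [high X] both n and n - 1 give all of X. *)
Lemma notin_weights n X : n \notin weights X -> is_zero (gr n X).
Proof.
move=> nX; have lowP := svalP (cid (W_low X)); have highP := svalP (cid (W_high X)).
rewrite -/(low X) in lowP; rewrite -/(high X) in highP.
have [nlow|lown] := leP n (low X); first exact/gr_zero/lowP.
have [nhigh|highn] := leP n (high X); last by apply: winc_iso_gr0; apply: highP; lia.
case/negP: nX; apply/mapP; exists `|n - low X|%N; last by lia.
by rewrite mem_iota; lia.
Qed.

Lemma gr_injE X (n : seq_sub (weights X)) :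
  gr_inj (ssval n) X = inj (fun m : seq_sub (weights X) => gr (ssval m) X) n.
Proof.
case: n => n nX; rewrite /gr_inj /=; case: {-}_ / idP => // h.
by rewrite (bool_irrelevance h nX).
Qed.

Lemma gr_projE X (n : seq_sub (weights X)) :
  gr_proj (ssval n) X = proj (fun m : seq_sub (weights X) => gr (ssval m) X) n.
Proof.
case: n => n nX; rewrite /gr_proj /=; case: {-}_ / idP => // h.
by rewrite (bool_irrelevance h nX).
Qed.

Lemma gr_projK n X : gr_proj n X \oc gr_inj n X = idm (gr n X).
Proof.
have [nX|nX] := boolP (n \in weights X); last first.
  by rewrite (notin_weights nX); apply: zero_to; apply: notin_weights.
rewrite (gr_injE (SeqSub nX)) (gr_projE (SeqSub nX)).
exact: (projK (fun m : seq_sub (weights X) => gr (ssval m) X) (SeqSub nX)).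
Qed.

Lemma gr_proj_neq n m X : n != m -> gr_proj n X \oc gr_inj m X = 0.
Proof.
move=> nm; have [nX|nX] := boolP (n \in weights X); last first.
  by apply: zero_to; apply: notin_weights.
have [mX|mX] := boolP (m \in weights X); last first.
  by apply: zero_from; apply: notin_weights.
rewrite (gr_injE (SeqSub mX)) (gr_projE (SeqSub nX)).
by apply: (@proj0 _ _ (fun m : seq_sub (weights X) => gr (ssval m) X)
  (SeqSub nX) (SeqSub mX)).
Qed.

Lemma Gr_extl X Y (f g : hom (Gr X) Y) :
  (forall n, f \oc gr_inj n X = g \oc gr_inj n X) -> f = g.
Proof.
move=> fg; rewrite -[f]compf1 -[g]compf1 -sum_inj_proj !comp_sumr.
by apply: eq_bigr => n _; rewrite !hcompA -gr_injE fg.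
Qed.

Lemma dsum_extl (I : finType) (F : I -> T) Y (f g : hom (dsum F) Y) :
  (forall i, f \oc inj F i = g \oc inj F i) -> f = g.
Proof.
move=> fg; rewrite -[f]compf1 -[g]compf1 -sum_inj_proj !comp_sumr.
by apply: eq_bigr => n _; rewrite !hcompA fg.
Qed.

Lemma dsum_extr (I : finType) (F : I -> T) Y (f g : hom Y (dsum F)) :
  (forall i, proj F i \oc f = proj F i \oc g) -> f = g.
Proof.
move=> fg; rewrite -[f]comp1f -[g]comp1f -sum_inj_proj !comp_suml.
by apply: eq_bigr => n _; rewrite -!hcompA fg.
Qed.

Lemma Gr_map_inj n X Y (f : hom X Y) :
  Gr_map f \oc gr_inj n X = gr_inj n Y \oc gr_map n f.
Proof.
have [nX|nX] := boolP (n \in weights X); last first.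
  by rewrite [LHS]zero_from ?[RHS]zero_from //; apply: notin_weights.
rewrite /Gr_map comp_suml (bigD1 (SeqSub nX)) //= big1 => [|m mn].
  by rewrite addr0 -hcompA gr_projK compf1.
by rewrite -hcompA gr_proj_neq ?compf0.
Qed.

Lemma Gr_map_id X : Gr_map (idm X) = idm (Gr X).
Proof. by apply: Gr_extl => n; rewrite Gr_map_inj gr_map_id comp1f compf1. Qed.

Lemma Gr_map_comp X Y Z (g : hom Y Z) (f : hom X Y) :
  Gr_map (g \oc f) = Gr_map g \oc Gr_map f.
Proof.
apply: Gr_extl => n.
by rewrite -hcompA !Gr_map_inj gr_map_comp !hcompA Gr_map_inj.
Qed.

Variables (k : nat) (A : 'I_k -> T).

Lemma marked_equiv_equiv : is_equiv (@marked_equiv T k A).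
Proof.
split=> [x|x y [f fE]|x y z [f fE] [g gE]].
- by exists (iso_id (tag x)); rewrite /= Gr_map_id compf1.
- exists (iso_sym f); rewrite -fE -hcompA /= -Gr_map_comp iso_invK.
  by rewrite Gr_map_id compf1.
- by exists (iso_comp g f); rewrite /= Gr_map_comp hcompA gE fE.
Qed.

Lemma mark_eq X Y (phi : iso (Gr X) (dsum A)) (psi : iso (Gr Y) (dsum A))
    (f : iso X Y) :
  iso_hom psi \oc Gr_map f = iso_hom phi -> mark X phi = mark Y psi.
Proof. by move=> fE; apply: (cls_eq marked_equiv_equiv); exists f. Qed.

Lemma mark_inj X Y (phi : iso (Gr X) (dsum A)) (psi : iso (Gr Y) (dsum A)) :
  mark X phi = mark Y psi ->
  exists f : iso X Y, iso_hom psi \oc Gr_map f = iso_hom phi.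
Proof. by move/(cls_inj marked_equiv_equiv). Qed.

Lemma mark_repr X (phi : iso (Gr X) (dsum A)) :
  exists f : iso (tag (repr (mark X phi))) X,
    iso_hom phi \oc Gr_map f = iso_hom (tagged (repr (mark X phi))).
Proof. exact: (repr_cls marked_equiv_equiv (existT _ X phi)). Qed.

Lemma proj_diag (s : forall r, hom (A r) (A r)) r :
  proj A r \oc diag s = s r \oc proj A r.
Proof.
rewrite /diag comp_sumr (bigD1 r) //= big1 => [|j jr].
  by rewrite addr0 !hcompA projK comp1f.
by rewrite !hcompA proj0 1?eq_sym // !comp0f.
Qed.

Lemma S'_actE (s : Aut A) X (phi : iso (Gr X) (dsum A)) :
  S'_act s (mark X phi) = mark X (iso_comp (diag_iso s) phi).
Proof.
have [f fE] := mark_repr phi.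
by apply: (mark_eq (f := f)); rewrite /= -hcompA fE.
Qed.

Lemma S_rel_equiv : is_equiv
  (fun X Y : {X : T | obj_iso (Gr X) (dsum A)} => obj_iso (sval X) (sval Y)).
Proof.
split=> [x|x y [f]|x y z [f] [g]]; constructor.
- exact: iso_id.
- exact: iso_sym f.
- exact: iso_comp g f.
Qed.

Lemma forget_mark X (phi : iso (Gr X) (dsum A)) :
  forget (mark X phi)
  = cls _ (exist (fun X => obj_iso (Gr X) (dsum A)) X (inhabits phi)).
Proof.
have [f _] := mark_repr phi; apply: (cls_eq S_rel_equiv).
by constructor.
Qed.

Lemma forget_eq X Y (phi : iso (Gr X) (dsum A)) (psi : iso (Gr Y) (dsum A)) :
  forget (mark X phi) = forget (mark Y psi) <-> obj_iso X Y.
Proof.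
rewrite !forget_mark; split; first by move/(cls_inj S_rel_equiv).
by move=> XY; apply: (cls_eq S_rel_equiv).
Qed.

Lemma forget_surj (c : S_set A) : exists X (phi : iso (Gr X) (dsum A)),
  c = forget (mark X phi).
Proof.
rewrite -(cls_repr c); case: (repr c) => X [phi]; exists X, phi.
by rewrite forget_mark.
Qed.

End GrSum.

(** * Objects with marked graded pieces *)

Section Marked.
Variables (T : filtered_category) (k : nat) (A : 'I_k -> T) (p : 'I_k -> int).
Hypothesis hAp : forall r, pure (p r) (A r).
Hypothesis hp : forall r s : 'I_k, (r < s)%N -> p r < p s.

Lemma p_le (r s : 'I_k) : (p r <= p s) = (r <= s)%N.
Proof.
have [rs|sr] := leqP r s; last by apply/negbTE; rewrite -ltNge hp.
by move: rs; rewrite leq_eqVlt => /orP[/eqP/ord_inj->|/hp/ltW->]; rewrite ?lexx.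
Qed.

Lemma p_inj : injective p.
Proof. by move=> r s rs; apply/ord_inj/eqP; rewrite eqn_leq -!p_le rs lexx. Qed.

Definition window (a l : nat) (r : 'I_k) : bool := (a <= r <= a + l)%N.

(* [marking r] is meaningful only for r in the window [a, a + l]; outside of it its
   value is arbitrary and ignored. *)
Record block (a l : nat) := Block {
  block_ob :> T;
  marking : forall r, hom (gr (p r) block_ob) (A r);
  marking_iso : forall r, window a l r -> is_iso (marking r);
  block_gr0 : forall n, (forall r, window a l r -> n != p r) -> is_zero (gr n block_ob)
}.

(** Only pieces common to both windows are compared, so one notion covers inclusions of subobjects,
    projections to quotients and isomorphisms. *)
Definition marked_map a l a' l' (X : block a l) (Y : block a' l')
    (h : hom X Y) : Prop :=
  forall r, window a l r -> window a' l' r -> marking Y r \oc gr_map (p r) h = marking X r.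

Lemma block_gr_out a l (X : block a l) r : ~~ window a l r -> is_zero (gr (p r) X).
Proof.
by move=> ar; apply: block_gr0 => s as_; apply: contraNneq ar => /p_inj->.
Qed.

Lemma block_gr_cases a l (X : block a l) n :
  (exists2 r, window a l r & n = p r) \/ is_zero (gr n X).
Proof.
have [[r]|nr] := pselect (exists2 r, window a l r & n = p r).
  by move=> ra ->; left; exists r.
by right; apply: block_gr0 => r ra; apply/eqP => nE; apply: nr; exists r.
Qed.

Lemma marked_gr_iso a l a' l' (X : block a l) (Y : block a' l') (h : hom X Y) r :
  marked_map h -> window a l r -> window a' l' r -> is_iso (gr_map (p r) h).
Proof.
move=> hm ra ra'; apply: (is_iso_cancel (marking_iso Y ra')).
by rewrite hm //; apply: marking_iso.
Qed.

Lemma marked_unique a l a' l' (X : block a l) (Y : block a' l') (h h' : hom X Y) :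
  marked_map h -> marked_map h' -> h = h'.
Proof.
move=> hm hm'; apply: gr_faithful2 => n.
have [[r ra ->]|X0] := block_gr_cases X n; last first.
  by rewrite (zero_from (gr_map n h) X0) (zero_from (gr_map n h') X0).
have [ra'|/(block_gr_out Y) Y0] := boolP (window a' l' r); last first.
  by rewrite (zero_to (gr_map _ h) Y0) (zero_to (gr_map _ h') Y0).
by apply: (is_iso_mono (marking_iso Y ra')); rewrite hm ?hm'.
Qed.

Lemma marked_id a l (X : block a l) : marked_map (X := X) (Y := X) (idm X).
Proof. by move=> r _ _; rewrite gr_map_id compf1. Qed.

(** The window condition excludes a common piece of X and Z that is missing from Y: the composite
    would vanish on it. *)
Lemma marked_comp a l a' l' a'' l'' (X : block a l) (Y : block a' l')
    (Z : block a'' l'') (g : hom Y Z) (f : hom X Y) :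
  (forall r, window a l r -> window a'' l'' r -> window a' l' r) ->
  marked_map g -> marked_map f -> marked_map (X := X) (Y := Z) (g \oc f).
Proof.
move=> sub gm fm r rX rZ; have rY := sub r rX rZ.
by rewrite gr_map_comp hcompA gm ?fm.
Qed.

Lemma marked_iso a l a' l' (X : block a l) (Y : block a' l') (h : hom X Y) :
  (forall r, window a l r = window a' l' r) -> marked_map h -> is_iso h.
Proof.
move=> e hm; apply: gr_reflect_iso => n.
have [[r ra ->]|X0] := block_gr_cases X n; first by apply: marked_gr_iso => //; rewrite -e.
have [[r ra nE]|Y0] := block_gr_cases Y n; last exact: zero_iso.
by rewrite nE; apply: marked_gr_iso; rewrite ?e.
Qed.

(** In each weight the graded sequence is an isomorphism followed by zero, zero followed by an
    isomorphism, or entirely zero. *)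
Lemma marked_exact a l a' l' a'' l'' (X : block a l) (Y : block a' l')
    (Z : block a'' l'') (f : hom X Y) (g : hom Y Z) :
  (forall r, window a' l' r = window a l r (+) window a'' l'' r) ->
  (forall r, ~~ (window a l r && window a'' l'' r)) ->
  marked_map f -> marked_map g -> short_exact f g.
Proof.
move=> e e' fm gm; apply: gr_reflect_exact => n.
have [[r ->]|nE] := pselect (exists r, n = p r); last first.
  by apply: iso_short_exactl; [apply: zero_iso|]; apply: block_gr0 => r _;
    apply/eqP => nr; apply: nE; exists r.
have := e r; have := e' r.
have [ra|ra] := boolP (window a l r); have [rc|rc] := boolP (window a'' l'' r) => //= _ rb.
- apply: iso_short_exactl; last exact: block_gr_out.
  exact: marked_gr_iso.
- apply: iso_short_exactr; first exact: block_gr_out.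
  exact: marked_gr_iso.
- apply: iso_short_exactl; last exact: block_gr_out.
  by apply: zero_iso; apply: block_gr_out; rewrite ?rb.
Qed.

(** The obstruction is the map from Y to the cokernel of [h']. A weight of Y that occurs in X occurs
    in Y', so the cokernel has none of the weights of Y and the map vanishes. *)
Lemma marked_lift a1 l1 a2 l2 a3 l3 (Y : block a1 l1) (Y' : block a2 l2)
    (X : block a3 l3) (h : hom Y X) (h' : hom Y' X) :
  (forall r, window a2 l2 r -> window a3 l3 r) ->
  (forall r, window a1 l1 r -> window a3 l3 r -> window a2 l2 r) ->
  marked_map h -> marked_map h' ->
  exists g : hom Y Y', h' \oc g = h /\ marked_map g.
Proof.
move=> s23 s132 hm hm'.
have h'i r : window a2 l2 r -> is_iso (gr_map (p r) h').
  by move=> r2; apply: marked_gr_iso => //; apply: s23.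
have h'm : mono h'.
  apply: gr_reflect_mono => n.
  have [[r ra ->]|Y0] := block_gr_cases Y' n; first exact: is_iso_mono (h'i r ra).
  by apply: mono0 => V t _; apply: zero_to.
have ex := short_exact_cmap h'm.
have [g gE] : exists g, h' \oc g = h.
  apply: (exact_lift ex); apply: hom_gr0 => n.
  have [[r r1 ->]|Y0] := block_gr_cases Y n; [right | by left].
  have [r3|r3] := boolP (window a3 l3 r); last first.
    by apply: (epi_zero (gr_epi (@cmap_epi _ _ _ h'))); apply: block_gr_out.
  apply: (epi_eq0 (gr_epi (@cmap_epi _ _ _ h'))); rewrite comp1f.
  apply: (epi_eq0 (is_iso_epi (h'i r (s132 r r1 r3)))).
  by rewrite -gr_map_comp coker0 gr_map0.
exists g; split=> // r r1 r2.
by rewrite -(hm' r r2 (s23 r r2)) -hcompA -gr_map_comp gE hm //; apply: s23.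
Qed.

(** Dual to [marked_lift]: the kernel of [h'] has no weight in common with Y. *)
Lemma marked_desc a1 l1 a2 l2 a3 l3 (Y : block a1 l1) (Y' : block a2 l2)
    (X : block a3 l3) (h : hom X Y) (h' : hom X Y') :
  (forall r, window a2 l2 r -> window a3 l3 r) ->
  (forall r, window a1 l1 r -> window a3 l3 r -> window a2 l2 r) ->
  marked_map h -> marked_map h' ->
  exists g : hom Y' Y, g \oc h' = h /\ marked_map g.
Proof.
move=> s23 s132 hm hm'.
have h'i r : window a2 l2 r -> is_iso (gr_map (p r) h').
  by move=> r2; apply: marked_gr_iso => //; apply: s23.
have h'e : epi h'.
  apply: gr_reflect_epi => n.
  have [[r ra ->]|Y0] := block_gr_cases Y' n; first exact: is_iso_epi (h'i r ra).
  by apply: epi0 => V t _; apply: zero_from.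
have ex := short_exact_kmap h'e.
have [g gE] : exists g, g \oc h' = h.
  apply: (exact_desc ex); apply: hom_gr0 => n.
  have [[r r1 ->]|Y0] := block_gr_cases Y n; [left | by right].
  have [r3|r3] := boolP (window a3 l3 r); last first.
    by apply: (mono_zero (gr_mono (@kmap_mono _ _ _ h'))); apply: block_gr_out.
  apply: (mono_eq0 (gr_mono (@kmap_mono _ _ _ h'))); rewrite compf1.
  apply: (mono_eq0 (is_iso_mono (h'i r (s132 r r1 r3)))).
  by rewrite -gr_map_comp ker0 gr_map0.
exists g; split=> // r r2 r1.
have e : marking Y r \oc gr_map (p r) g \oc gr_map (p r) h' = marking X r.
  by rewrite -hcompA -gr_map_comp gE hm //; apply: s23.
apply: (is_iso_epi (h'i r r2)); rewrite e hm' //.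
exact: s23.
Qed.

Lemma marked_inv a l (X Y : block a l) (h : hom X Y) : marked_map h ->
  exists g : hom Y X, marked_map g.
Proof.
move=> hm; have [||g [_ gm]] := marked_lift _ _ (@marked_id a l Y) hm => //.
by exists g.
Qed.

Definition marked_iso_rel a l (X Y : block a l) : Prop :=
  exists h : hom X Y, marked_map h.

Definition blocks a l : Type := quot (@marked_iso_rel a l).

Definition block_cls a l (X : block a l) : blocks a l := cls (@marked_iso_rel a l) X.

Lemma marked_iso_equiv a l : is_equiv (@marked_iso_rel a l).
Proof.
split=> [X|X Y [h /marked_inv //]|X Y Z [f fm] [g gm]].
  by exists (idm X); apply: marked_id.
by exists (g \oc f); apply: marked_comp gm fm.
Qed.

Lemma block_cls_eq a l (X Y : block a l) (h : hom X Y) :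
  marked_map h -> block_cls X = block_cls Y.
Proof. by move=> hm; apply: (cls_eq (@marked_iso_equiv a l)); exists h. Qed.

Lemma block_cls_inj a l (X Y : block a l) : block_cls X = block_cls Y ->
  exists h : hom X Y, marked_map h.
Proof. by move/(cls_inj (@marked_iso_equiv a l)). Qed.

Lemma block_cls_repr a l (x : blocks a l) : block_cls (repr x) = x.
Proof. exact: cls_repr. Qed.

Lemma weight_cut (c : nat) : exists n, forall r, (p r <= n) = (r < c)%N.
Proof.
have [ck|kc] := ltnP c k.
  exists (p (Ordinal ck) - 1) => r.
  have -> : (p r <= p (Ordinal ck) - 1) = (p r < p (Ordinal ck)) by lia.
  by rewrite ltNge p_le -ltnNge.
(* When [c] is past the end, the top weight itself serves as the cut; with no index at all, any
   integer does. *)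
case: k kc A p hAp hp p_le => [|k'] kc A' p' hAp' hp' p_le'.
  by exists 0; case.
by exists (p' ord_max) => r; rewrite p_le' -ltnS /= !ltn_ord (leq_trans _ kc).
Qed.

(** The subobject is a step [W n X] of the filtration, with n cutting just above the index a + l;
    the marking is inherited along [winj]. *)
Lemma sub_ex a l (X : block a l.+1) :
  exists (Y : block a l) (h : hom Y X), marked_map h.
Proof.
have [n nP] := weight_cut (a + l).+1.
have hi r : window a l r -> is_iso (marking X r \oc gr_map (p r) (winj n X)).
  move=> ra; apply: is_iso_comp; first by apply: marking_iso; rewrite /window in ra *; lia.
  by apply: gr_winj_iso; rewrite nP; rewrite /window in ra; lia.
have h0 m : (forall r, window a l r -> m != p r) -> is_zero (gr m (W n X)).
  move=> mP; have [mn|nm] := leP m n; last exact: gr_W0.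
  apply: (mono_zero (is_iso_mono (gr_winj_iso X mn))).
  apply: block_gr0 => r ra; have [r1|] := boolP (window a l r); first exact: mP.
  by apply: contraNneq => mE; move: mn; rewrite mE nP /window in ra *; lia.
by exists (Block hi h0), (winj n X).
Qed.

(** The quotient is X modulo the step of the filtration that contains only the piece a. The quotient
    map is invertible on the surviving pieces, which transports their markings; elsewhere the filler
    is 0. *)
Lemma quo_ex a l (X : block a l.+1) :
  exists (Y : block a.+1 l) (h : hom X Y), marked_map h.
Proof.
have [n nP] := weight_cut a.+1.
have ci r : window a.+1 l r -> is_iso (gr_map (p r) (cmap (winj n X))).
  by move=> ra; apply: gr_cmap_iso; rewrite ltNge nP; rewrite /window in ra *; lia.
have [phi phiP] : exists phi : forall r, hom (gr (p r) (coker (winj n X))) (A r),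
    forall r, window a.+1 l r -> phi r \oc gr_map (p r) (cmap (winj n X)) = marking X r.
  suff ex r : exists f : hom (gr (p r) (coker (winj n X))) (A r),
      window a.+1 l r -> f \oc gr_map (p r) (cmap (winj n X)) = marking X r.
    by exists (fun r => sval (cid (ex r))) => r; exact: (svalP (cid (ex r))).
  have [/ci [g [gc _]]|_] := boolP (window a.+1 l r); last by exists 0.
  by exists (marking X r \oc g); rewrite -hcompA gc compf1.
have sX r : window a.+1 l r -> window a l.+1 r by rewrite /window; lia.
have hi r : window a.+1 l r -> is_iso (phi r).
  move=> ra; have [g [gc cg]] := ci r ra.
  have -> : phi r = marking X r \oc g by rewrite -phiP // -hcompA cg compf1.
  by apply: is_iso_comp; [exact/marking_iso/sX | exact: is_iso_inv gc cg].
have h0 m : (forall r, window a.+1 l r -> m != p r) -> is_zero (gr m (coker (winj n X))).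
  move=> mP; have [mn|nm] := leP m n; first exact: gr_coker0.
  apply: (epi_zero (is_iso_epi (gr_cmap_iso X nm))).
  apply: block_gr0 => r ra; have [r1|] := boolP (window a.+1 l r); first exact: mP.
  by apply: contraNneq => mE; move: nm; rewrite ltNge mE nP /window in ra *; lia.
exists (Block hi h0), (cmap (winj n X)) => r rX rY.
exact: phiP.
Qed.


Definition sub_cls a l (x : blocks a l.+1) : blocks a l :=
  block_cls (sval (cid (sub_ex (repr x)))).

Definition quo_cls a l (x : blocks a l.+1) : blocks a.+1 l :=
  block_cls (sval (cid (quo_ex (repr x)))).

(** Two subobjects with the same window factor through each other by [marked_lift], so neither the
    representative nor the chosen subobject matters. *)
Lemma sub_clsE a l (X : block a l.+1) (Y : block a l) (h : hom Y X) :
  marked_map h -> sub_cls (block_cls X) = block_cls Y.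
Proof.
move=> hm; rewrite /sub_cls; case: (cid _) => /= U [f fm].
have [g gm] := block_cls_inj (block_cls_repr (block_cls X)).
have [|||g' [_ g'm]] := marked_lift (h := g \oc f) (h' := h) _ _ _ hm.
- by move=> r; rewrite /window; lia.
- by move=> r; rewrite /window; lia.
- by apply: marked_comp gm fm => r; rewrite /window; lia.
exact: block_cls_eq g'm.
Qed.

Lemma quo_clsE a l (X : block a l.+1) (Y : block a.+1 l) (h : hom X Y) :
  marked_map h -> quo_cls (block_cls X) = block_cls Y.
Proof.
move=> hm; rewrite /quo_cls; case: (cid _) => /= U [f fm].
have [g gm] := block_cls_inj (esym (block_cls_repr (block_cls X))).
have [|||g' [_ g'm]] := marked_desc (h := f \oc g) (h' := h) _ _ _ hm.
- by move=> r; rewrite /window; lia.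
- by move=> r; rewrite /window; lia.
- by apply: marked_comp fm gm => r; rewrite /window; lia.
exact/esym/block_cls_eq/g'm.
Qed.

Lemma sub_cls_map a l (X : block a l.+1) (Y : block a l) :
  sub_cls (block_cls X) = block_cls Y ->
  exists h : hom Y X, marked_map h.
Proof.
have [U [f fm]] := sub_ex X; rewrite (sub_clsE fm) => /esym/block_cls_inj[g gm].
by exists (f \oc g); apply: marked_comp fm gm.
Qed.

Lemma quo_cls_map a l (X : block a l.+1) (Y : block a.+1 l) :
  quo_cls (block_cls X) = block_cls Y ->
  exists h : hom X Y, marked_map h.
Proof.
have [U [f fm]] := quo_ex X; rewrite (quo_clsE fm) => /block_cls_inj[g gm].
by exists (g \oc f); apply: marked_comp gm fm.
Qed.

(** Both sides are the middle of the block. The composite of the inclusion of U and the projection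
    to V lands in the subobject of V, and the resulting map exhibits that subobject as the quotient
    of U. *)
Lemma quo_sub_cls a l (x : blocks a l.+2) : quo_cls (sub_cls x) = sub_cls (quo_cls x).
Proof.
rewrite -(block_cls_repr x); have [U [f fm]] := sub_ex (repr x).
have [V [g gm]] := quo_ex (repr x); have [V' [h hm]] := sub_ex V.
have [|||u [_ um]] := marked_lift (h := g \oc f) (h' := h) _ _ _ hm.
- by move=> r; rewrite /window; lia.
- by move=> r; rewrite /window; lia.
- by apply: marked_comp gm fm => r; rewrite /window; lia.
by rewrite (sub_clsE fm) (quo_clsE um) (quo_clsE gm) (sub_clsE hm).
Qed.

(** The removed piece would have index a + l + 1, past the last one, so the inclusion of the
    subobject is an isomorphism. *)
Lemma sub_cls_inj a l : (k <= (a + l).+1)%N -> injective (@sub_cls a l).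
Proof.
move=> kal x y; rewrite -(block_cls_repr x) -(block_cls_repr y).
have [U [f fm]] := sub_ex (repr x); rewrite (sub_clsE fm) => /esym/sub_cls_map[h hm].
have [||g [_ gm]] := marked_lift _ _ (@marked_id _ _ (repr x)) fm.
- by move=> r; rewrite /window; lia.
- by move=> r; rewrite /window; have := ltn_ord r; lia.
by apply: (block_cls_eq (h := h \oc g)); apply: marked_comp hm gm => r;
  rewrite /window; have := ltn_ord r; lia.
Qed.

Lemma sub_cls_surj a l (y : blocks a l) : (k <= (a + l).+1)%N -> exists x, sub_cls x = y.
Proof.
move=> kal; rewrite -(block_cls_repr y); set Y := repr y.
have e r : window a l.+1 r = window a l r.
  by rewrite /window; have := ltn_ord r; lia.
have hi r : window a l.+1 r -> is_iso (marking Y r) by rewrite e; apply: marking_iso.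
have h0 n : (forall r, window a l.+1 r -> n != p r) -> is_zero (gr n Y).
  by move=> nP; apply: block_gr0 => r ra; apply: nP; rewrite e.
exists (block_cls (Block hi h0)).
apply: (sub_clsE (X := Block hi h0) (Y := Y) (h := idm Y)) => r _ _ /=.
by rewrite gr_map_id compf1.
Qed.

Lemma window0 (a r : 'I_k) : window a 0 r -> r = a.
Proof. by rewrite /window => ra; apply/ord_inj; lia. Qed.

(** [dfwith] puts the canonical identification at the index [a] and the filler 0 at all other
    indices. *)
Lemma point_iso (a r : 'I_k) : window a 0 r ->
  is_iso (dfwith (T := fun r => hom (gr (p r) (A a)) (A r)) (fun r => 0)
            (pure_gr (hAp a)) r).
Proof. by move=> /window0->; rewrite dfwith_in; apply: pure_gr_iso. Qed.

Lemma point_gr0 (a : 'I_k) n : (forall r, window a 0 r -> n != p r) ->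
  is_zero (gr n (A a)).
Proof.
by move=> nP; apply: (pure_gr0 (hAp a)); apply: nP; rewrite /window addn0 leqnn.
Qed.

Definition point (a : 'I_k) : block a 0 := Block (@point_iso a) (@point_gr0 a).

Lemma marking_point (a : 'I_k) : marking (point a) a = pure_gr (hAp a).
Proof. exact: dfwith_in. Qed.

(** A block of one piece is pure, where every map of graded pieces is induced by a morphism; past
    the end the window is empty and the zero map qualifies. *)
Lemma point_map a (X Y : block a 0) : exists h : hom X Y, marked_map h.
Proof.
have [ak|ka] := ltnP a k; last first.
  by exists 0 => r ra _; have := ltn_ord r; rewrite /window in ra; lia.
pose a' := Ordinal ak; have aE r : window a 0 r -> r = a' by apply: (@window0 a').
have pu (Z : block a 0) : pure (p a') Z.
  by apply: gr0_pure => m ma; apply: block_gr0 => r /aE->.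
have Ya : window a 0 a' by rewrite /window addn0 leqnn.
have [g [_ fg]] := marking_iso Y Ya.
have [f fE] := pure_gr_full (g \oc marking X a') (pu X) (pu Y).
by exists f => r /aE-> _; rewrite fE hcompA fg comp1f.
Qed.

Lemma blocks_point a (x y : blocks a 0) : x = y.
Proof.
rewrite -(block_cls_repr x) -(block_cls_repr y); have [h hm] := point_map (repr x) (repr y).
exact: block_cls_eq hm.
Qed.

Lemma bottom_ex (a : 'I_k) l (X : block a l) :
  exists h : hom (point a) X, marked_map (X := point a) h.
Proof.
elim: l X => [|l IH] X; first exact: point_map.
have [Y [f fm]] := sub_ex X; have [g gm] := IH Y.
by exists (f \oc g); apply: marked_comp fm gm => r; rewrite /window; lia.
Qed.

Lemma top_ex (b : 'I_k) c l (X : block c l) : b = (c + l)%N :> nat ->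
  exists h : hom X (point b), marked_map (Y := point b) h.
Proof.
elim: l c X => [|l IH] c X bE.
  move: X; rewrite -[c]addn0 -bE => X; exact: point_map.
have [Y [f fm]] := quo_ex X; have [|g gm] := IH _ Y; first by rewrite bE; lia.
by exists (g \oc f); apply: marked_comp gm fm => r; rewrite /window; lia.
Qed.

(** * Blocks as extensions of their quotient *)

Section Obj.
Variables (a : 'I_k) (l : nat).

(** The piece of weight p_a comes from A_a, because Z has none; the others come from Z. This is the
    marking of the middle object of an extension. *)
Lemma ext_phi_ex (Z : block a.+1 l) (E : extension Z (A a)) :
  exists phi : forall r, hom (gr (p r) E) (A r),
    (forall r, window a 0 r -> phi r \oc gr_map (p r) (einj E) = marking (point a) r) /\
    (forall r, window a.+1 l r -> phi r = marking Z r \oc gr_map (p r) (eproj E)).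
Proof.
suff ex r : exists f : hom (gr (p r) E) (A r),
    (window a 0 r -> f \oc gr_map (p r) (einj E) = marking (point a) r) /\
    (window a.+1 l r -> f = marking Z r \oc gr_map (p r) (eproj E)).
  by exists (fun r => sval (cid (ex r))); split=> r; case: (svalP (cid (ex r))).
have [ra|ra] := boolP (window a 0 r); last first.
  by exists (marking Z r \oc gr_map (p r) (eproj E)).
have raN : ~~ window a.+1 l r by rewrite /window in ra *; lia.
have [g [gi _]] := short_exact_isol (gr_map_exact (p r) (e_exact E)) (block_gr_out Z raN).
exists (marking (point a) r \oc g); split=> [_|]; last by rewrite (negPf raN).
by rewrite -hcompA gi compf1.
Qed.

Definition ext_phi (Z : block a.+1 l) (E : extension Z (A a)) :=
  sval (cid (@ext_phi_ex Z E)).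

Lemma windowS r : window a l.+1 r = window a 0 r (+) window a.+1 l r.
Proof. by rewrite /window; lia. Qed.

Lemma window_disjoint r : ~~ (window a 0 r && window a.+1 l r).
Proof. by rewrite /window; lia. Qed.

Lemma windowP r : window a l.+1 r -> window a 0 r \/ window a.+1 l r.
Proof. by rewrite windowS; case: (window a 0 r); [left | right]. Qed.

Lemma ext_phi_iso (Z : block a.+1 l) (E : extension Z (A a)) r : window a l.+1 r ->
  is_iso (@ext_phi Z E r).
Proof.
have [ep1 ep2] := svalP (cid (@ext_phi_ex Z E)).
have ex := gr_map_exact (p r) (e_exact E).
have dis := window_disjoint r; case/windowP => ra; last first.
  rewrite /ext_phi ep2 //; apply: is_iso_comp; first exact: marking_iso.
  apply: short_exact_isor ex _; apply: (block_gr_out (point a)).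
  by move: dis; rewrite ra andbT.
have [g [gi ig]] : is_iso (gr_map (p r) (einj E)).
  by apply: (short_exact_isol ex); apply: block_gr_out; move: dis; rewrite ra.
have -> : ext_phi E r = marking (point a) r \oc g.
  by rewrite -ep1 // -hcompA ig compf1.
by apply: is_iso_comp; [exact: (marking_iso (point a) ra) | exact: is_iso_inv gi ig].
Qed.

Lemma ext_gr0 (Z : block a.+1 l) (E : extension Z (A a)) n :
  (forall r, window a l.+1 r -> n != p r) -> is_zero (gr n E).
Proof.
move=> nP; apply: short_exact_mid0 (gr_map_exact n (e_exact E)) _ _.
  by apply: (@block_gr0 _ _ (point a)) => r ra; apply: nP; rewrite /window in ra *; lia.
by apply: block_gr0 => r ra; apply: nP; rewrite /window in ra *; lia.
Qed.

Definition ext_block (Z : block a.+1 l) (E : extension Z (A a)) : block a l.+1 :=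
  Block (@ext_phi_iso Z E) (@ext_gr0 Z E).

Lemma einj_marked (Z : block a.+1 l) (E : extension Z (A a)) :
  marked_map (X := point a) (Y := ext_block E) (einj E).
Proof.
by move=> r ra _; have [ep _] := svalP (cid (@ext_phi_ex Z E)); apply: ep.
Qed.

Lemma eproj_marked (Z : block a.+1 l) (E : extension Z (A a)) :
  marked_map (X := ext_block E) (Y := Z) (eproj E).
Proof.
by move=> r _ rZ; have [_ ep] := svalP (cid (@ext_phi_ex Z E)); apply/esym/ep.
Qed.

(** The two parts of the window are tested separately: the piece a through [i], invertible on it,
    and the others through the projection to Z. *)
Lemma ext_block_char l' (X : block a l') (Z : block a.+1 l) (E : extension Z (A a))
    (i : hom (point a) X) (f : hom X E) :
  marked_map i -> f \oc i = einj E -> marked_map (X := X) (Y := Z) (eproj E \oc f) ->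
  marked_map (X := X) (Y := ext_block E) f.
Proof.
move=> im fi fm r rX /windowP[] ra; last first.
  have -> : marking (ext_block E) r = marking Z r \oc gr_map (p r) (eproj E).
    by rewrite eproj_marked //; move: ra; rewrite /window; lia.
  by rewrite -hcompA -gr_map_comp fm.
apply: (is_iso_epi (marked_gr_iso im ra rX)).
rewrite im // -hcompA -gr_map_comp fi einj_marked //.
by rewrite /window in ra *; lia.
Qed.

End Obj.

Lemma ext_block_mor (a : 'I_k) l l' (Y : block a.+1 l') (Z : block a.+1 l)
    (h : hom Y Z) (F : extension Y (A a)) (E : extension Z (A a)) :
  (forall r, window a.+1 l' r -> window a.+1 l r) -> marked_map h ->
  ext_hom (idm (A a)) h F E ->
  exists f, marked_map (X := ext_block F) (Y := ext_block E) f.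
Proof.
move=> sub hm [f [fi fp]]; exists f.
apply: (ext_block_char (@einj_marked _ _ _ F)); first by rewrite fi compf1.
rewrite fp; apply: marked_comp hm (@eproj_marked _ _ _ F) => r.
by rewrite /window; lia.
Qed.

(** Both squares of a morphism of extensions consist of marked maps with common ends, so they
    commute by uniqueness. *)
Lemma ext_block_ermor (a : 'I_k) l l' (Y : block a.+1 l') (Z : block a.+1 l)
    (h : hom Y Z) (F : extension Y (A a)) (E : extension Z (A a)) f :
  marked_map h -> marked_map (X := ext_block F) (Y := ext_block E) f ->
  ext_hom (idm (A a)) h F E.
Proof.
move=> hm fm; exists f; split.
  rewrite compf1; apply: (marked_unique (X := point a) (Y := ext_block E)).
    by apply: marked_comp fm (@einj_marked _ _ _ F) => r; rewrite /window; lia.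
  exact: einj_marked.
apply: (marked_unique (X := ext_block F) (Y := Z)).
  by apply: marked_comp (@eproj_marked _ _ _ E) fm => r; rewrite /window; lia.
by apply: marked_comp hm (@eproj_marked _ _ _ F) => r; rewrite /window; lia.
Qed.

Definition glue (a : 'I_k) l (Z : block a.+1 l) (e : Ext1 Z (A a)) : blocks a l.+1 :=
  block_cls (ext_block (repr e)).

Lemma glueE (a : 'I_k) l (Z : block a.+1 l) (E : extension Z (A a)) :
  glue (ext_cls E) = block_cls (ext_block E).
Proof.
have := ext_iso_hom (repr_cls (@ext_iso_equiv _ (A a) Z) E).
case/(ext_block_mor _ (@marked_id _ _ Z)) => // f; exact: block_cls_eq.
Qed.

Lemma glue_inj (a : 'I_k) l (Z : block a.+1 l) : injective (@glue a l Z).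
Proof.
move=> e e'; rewrite -(ext_cls_repr e) -(ext_cls_repr e') !glueE => /block_cls_inj[f].
by move/(ext_block_ermor (@marked_id _ _ Z))/ext_cls_eq.
Qed.

Lemma quo_glue (a : 'I_k) l (Z : block a.+1 l) (e : Ext1 Z (A a)) :
  quo_cls (glue e) = block_cls Z.
Proof. by rewrite -(ext_cls_repr e) glueE (quo_clsE (@eproj_marked _ _ _ _)). Qed.

(** The marked maps from A_a to X and from X to Z have complementary windows, hence form a short
    exact sequence. *)
Lemma glue_surj (a : 'I_k) l (Z : block a.+1 l) (x : blocks a l.+1) :
  quo_cls x = block_cls Z ->
  exists e : Ext1 Z (A a), glue e = x.
Proof.
rewrite -(block_cls_repr x); set X := repr x => /quo_cls_map[g gm].
have [i im] := bottom_ex X.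
have ex := marked_exact (@windowS a l) (@window_disjoint a l) im gm.
exists (ext_cls (Extension ex)); rewrite glueE; apply/esym.
apply: (block_cls_eq (Y := ext_block (Extension ex)) (h := idm X)).
apply: (ext_block_char im); rewrite ?comp1f //.
by rewrite compf1.
Qed.

Lemma glue_pull (a : 'I_k) l (Y Z : block a.+1 l) (h : hom Y Z) (e : Ext1 Z (A a)) :
  marked_map h -> glue (Z := Y) (Ext1_pull h e) = glue e.
Proof.
move=> hm; rewrite -(ext_cls_repr e).
have [F [FE ->]] := pull_ext_hom h (repr e).
have [//|f fm] := ext_block_mor _ hm FE; rewrite !glueE; exact: block_cls_eq fm.
Qed.

Lemma sub_glue (a : 'I_k) l (Z : block a.+1 l.+1) (Y : block a.+1 l) (h : hom Y Z)
    (e : Ext1 Z (A a)) :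
  marked_map h -> sub_cls (glue e) = glue (Z := Y) (Ext1_pull h e).
Proof.
move=> hm; rewrite -(ext_cls_repr e).
have [F [FE ->]] := pull_ext_hom h (repr e).
have [|f fm] := ext_block_mor _ hm FE; first by move=> r; rewrite /window; lia.
by rewrite !glueE (sub_clsE fm).
Qed.

(** * Translation of a block by a class of Ext^1(A_b, A_a) *)

Section Torsor.
Variables (a b : 'I_k) (l : nat).
Hypothesis bE : b = (a + l.+2)%N :> nat.

(** Quantifying over every presentation of x inside the existential lets [translate] be computed
    with any of them. Two presentations differ by a marked isomorphism of quotients, which carries
    one class to the other and respects the unique marked map to A_b. *)
Lemma translate_ex (c : Ext1 (A b) (A a)) (x : blocks a l.+2) : exists x' : blocks a l.+2,
  forall (Z : block a.+1 l.+1) (e : Ext1 Z (A a)) (q : hom Z (point b)),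
    marked_map q -> x = glue e -> x' = glue (Ext1_add (Ext1_pull q c) e).
Proof.
have [e xE] := glue_surj (esym (block_cls_repr (quo_cls x))).
have [|q qm] := @top_ex b _ _ (repr (quo_cls x)); first by rewrite bE; lia.
exists (glue (Ext1_add (Ext1_pull q c) e)) => Z1 e1 q1 q1m x1E.
have [h hm] : exists h : hom Z1 (repr (quo_cls x)), marked_map h.
  by apply: block_cls_inj; rewrite block_cls_repr x1E quo_glue.
rewrite -(glue_pull _ hm) Ext1_pull_addl -Ext1_pull_comp.
have -> : q \oc h = q1.
  by apply: marked_unique q1m; apply: marked_comp qm hm => r; rewrite /window; lia.
suff -> : e1 = Ext1_pull h e by [].
by apply: glue_inj; rewrite (glue_pull _ hm) xE.
Qed.

Definition translate (c : Ext1 (A b) (A a)) (x : blocks a l.+2) : blocks a l.+2 :=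
  sval (cid (translate_ex c x)).

Lemma translateE (c : Ext1 (A b) (A a)) (Z : block a.+1 l.+1) (e : Ext1 Z (A a))
    (q : hom Z (point b)) :
  marked_map q -> translate c (glue e) = glue (Ext1_add (Ext1_pull q c) e).
Proof. by move=> qm; apply: (svalP (cid (translate_ex c (glue e)))). Qed.

Lemma glue_ex (x : blocks a l.+2) : exists (Z : block a.+1 l.+1) (e : Ext1 Z (A a))
    (q : hom Z (point b)), marked_map q /\ x = glue e.
Proof.
have [e xE] := glue_surj (esym (block_cls_repr (quo_cls x))).
have [|q qm] := @top_ex b _ _ (repr (quo_cls x)); first by rewrite bE; lia.
by exists (repr (quo_cls x)), e, q.
Qed.

Lemma top_exact (Z : block a.+1 l.+1) (Y : block a.+1 l) (i : hom Y Z)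
    (q : hom Z (point b)) :
  marked_map i -> marked_map q -> short_exact i q.
Proof.
move=> im qm; apply: marked_exact im qm => r; rewrite /window bE.
  by lia.
by lia.
Qed.

Lemma sub_translate c x : sub_cls (translate c x) = sub_cls x.
Proof.
have [Z [e [q [qm ->]]]] := glue_ex x; rewrite (translateE _ _ qm).
have [Y [i im]] := sub_ex Z; rewrite !(sub_glue _ im) Ext1_pull_addl -Ext1_pull_comp.
by rewrite (short_exact0 (top_exact im qm)) Ext1_pull0 Ext1_0add.
Qed.

Lemma quo_translate c x : quo_cls (translate c x) = quo_cls x.
Proof.
by have [Z [e [q [qm ->]]]] := glue_ex x; rewrite (translateE _ _ qm) !quo_glue.
Qed.

Lemma translate0 x : translate (Ext1_zero (A b) (A a)) x = x.
Proof.
have [Z [e [q [qm ->]]]] := glue_ex x; rewrite (translateE _ _ qm).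
(* The zero class is rewritten as a pullback along a zero morphism, so that functoriality shows its
   pullback along [q] to be zero. *)
by rewrite -(Ext1_pull0 (A b) (Ext1_zero (A b) (A a))) -Ext1_pull_comp comp0f
  Ext1_pull0 Ext1_0add.
Qed.

Lemma translateD c d x : translate (Ext1_add c d) x = translate c (translate d x).
Proof.
have [Z [e [q [qm ->]]]] := glue_ex x.
by rewrite !(translateE _ _ qm) Ext1_pull_addl Ext1_addA.
Qed.

(** With a common quotient Z, the two blocks are classes in Ext^1(Z, A_a) that agree on Y; their
    difference is pulled back from Ext^1(A_b, A_a). *)
Lemma translate_transitive x y :
  sub_cls x = sub_cls y -> quo_cls x = quo_cls y -> exists c, translate c x = y.
Proof.
have [Z [e [q [qm ->]]]] := glue_ex x; rewrite quo_glue => Lxy /esym/glue_surj[e' yE].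
have [Y [i im]] := sub_ex Z; rewrite -yE !(sub_glue _ im) in Lxy.
have [|c cE] := Ext1_pull_exact (e := Ext1_add e' (Ext1_opp e)) (top_exact im qm).
  rewrite Ext1_pull_addl -(glue_inj Lxy) /Ext1_opp -Ext1_push_pull.
  exact: Ext1_addN.
by exists c; rewrite (translateE _ _ qm) cE -Ext1_addA Ext1_Nadd Ext1_add0.
Qed.

(** All pieces of Y have index above a, so Hom(Y, A_a) = 0 and the pullback along [q] is
    injective. *)
Lemma translate_free c d x : translate c x = translate d x -> c = d.
Proof.
have [Z [e [q [qm ->]]]] := glue_ex x; rewrite !(translateE _ _ qm) => /glue_inj.
move/Ext1_addIr; have [Y [i im]] := sub_ex Z.
apply: (Ext1_pull_inj (top_exact im qm)) => f; apply: hom_gr0 => n.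
have [[r ra ->]|Y0] := block_gr_cases Y n; [right | by left].
by apply: (block_gr_out (point a)); rewrite /window in ra *; lia.
Qed.

(** The block y is a class over the subobject Y of Z; extending it to Z is obstructed only by
    Ext^2(A_b, A_a). *)
Lemma blocks_lift (y : blocks a l.+1) (z : blocks a.+1 l.+1) : Ext2_vanishes (A b) (A a) ->
  quo_cls y = sub_cls z -> exists x : blocks a l.+2, sub_cls x = y /\ quo_cls x = z.
Proof.
move=> E0; rewrite -(block_cls_repr z); set Z := repr z.
have [Y [i im]] := sub_ex Z; rewrite (sub_clsE im) => /glue_surj[d <-].
have [|q qm] := @top_ex b _ _ Z; first by rewrite bE; lia.
have [e eE] := Ext1_pull_surj d (top_exact im qm) E0.
by exists (glue e); rewrite (sub_glue _ im) eE quo_glue.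
Qed.

End Torsor.

(** * The action of Aut(A) on blocks *)

Section Action.
Implicit Types s t : Aut A.

Lemma act_iso a l s (X : block a l) r : window a l r ->
  is_iso (iso_hom (s r) \oc marking X r).
Proof. by move=> ra; apply: is_iso_comp (iso_is_iso _) (marking_iso _ ra). Qed.

Definition act_block a l s (X : block a l) : block a l :=
  Block (@act_iso a l s X) (@block_gr0 _ _ X).

Lemma act_marked a l a' l' s (X : block a l) (Y : block a' l') (h : hom X Y) :
  marked_map h -> marked_map (X := act_block s X) (Y := act_block s Y) h.
Proof. by move=> hm r rX rY /=; rewrite -hcompA hm. Qed.

Definition act_cls a l s (x : blocks a l) : blocks a l := block_cls (act_block s (repr x)).

Lemma act_clsE a l s (X : block a l) : act_cls s (block_cls X) = block_cls (act_block s X).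
Proof.
have [h hm] := block_cls_inj (block_cls_repr (block_cls X)).
exact: block_cls_eq (act_marked s hm).
Qed.

Lemma sub_cls_act a l s (x : blocks a l.+1) : sub_cls (act_cls s x) = act_cls s (sub_cls x).
Proof.
rewrite -(block_cls_repr x); have [Y [h hm]] := sub_ex (repr x).
by rewrite act_clsE (sub_clsE hm) act_clsE (sub_clsE (act_marked s hm)).
Qed.

Lemma quo_cls_act a l s (x : blocks a l.+1) : quo_cls (act_cls s x) = act_cls s (quo_cls x).
Proof.
rewrite -(block_cls_repr x); have [Y [h hm]] := quo_ex (repr x).
by rewrite act_clsE (quo_clsE hm) act_clsE (quo_clsE (act_marked s hm)).
Qed.

Lemma act_cls1 a l (x : blocks a l) : act_cls (Aut_one A) x = x.
Proof.
rewrite -(block_cls_repr x) act_clsE.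
apply: (block_cls_eq (X := act_block _ (repr x)) (h := idm (repr x))) => r _ _ /=.
by rewrite gr_map_id compf1 comp1f.
Qed.

Lemma act_clsM a l s t (x : blocks a l) : act_cls (Aut_mul s t) x = act_cls s (act_cls t x).
Proof.
rewrite -(block_cls_repr x) !act_clsE.
apply: (block_cls_eq (X := act_block _ (repr x)) (Y := act_block s (act_block t (repr x)))
  (h := idm (repr x))) => r _ _ /=.
by rewrite gr_map_id compf1 hcompA.
Qed.

Lemma marking_point_nat (a : 'I_k) (f : hom (A a) (A a)) :
  marking (point a) a \oc gr_map (p a) f = f \oc marking (point a) a.
Proof.
rewrite marking_point; apply: (@cmap_epi T).
by rewrite pure_gr_nat -hcompA pure_grE.
Qed.

Lemma point_act (a : 'I_k) s :
  marked_map (X := point a) (Y := act_block s (point a)) (iso_inv (s a)).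
Proof.
move=> r /window0-> _; rewrite -[LHS]/(iso_hom (s a) \oc marking (point a) a \oc
  gr_map (p a) (iso_inv (s a))).
by rewrite -hcompA marking_point_nat hcompA iso_invK comp1f.
Qed.

Lemma act_point (a : 'I_k) s :
  marked_map (X := act_block s (point a)) (Y := point a) (iso_hom (s a)).
Proof. by move=> r /window0-> _; apply: marking_point_nat. Qed.

(** Changing the marking on the bottom piece by [s a] amounts to pushing the extension out along
    [s a]; the other changes of marking are absorbed in the quotient. *)
Lemma glue_act (a : 'I_k) l s (Z : block a.+1 l) (e : Ext1 Z (A a)) :
  act_cls s (glue e) = glue (Z := act_block s Z) (Ext1_push (iso_hom (s a)) e).
Proof.
rewrite -(ext_cls_repr e); have [F [[f [fi fp]] ->]] := push_ext_hom (iso_hom (s a)) (repr e).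
rewrite !glueE act_clsE; set E := repr e in f fi fp *.
apply: (block_cls_eq (X := act_block s (ext_block E))
  (Y := ext_block (Z := act_block s Z) F) (h := f)).
have im := act_marked s (@einj_marked _ _ _ E).
(* The standard marking of A_a matches the twisted one only after precomposition with the inverse of
   [s a]. *)
have im' : marked_map (X := point a) (Y := act_block s (ext_block E))
    (einj E \oc iso_inv (s a)).
  by apply: marked_comp im (@point_act a s).
apply: (ext_block_char (Z := act_block s Z) im').
  by rewrite hcompA fi -hcompA iso_invK compf1.
rewrite fp comp1f.
exact: act_marked (@eproj_marked _ _ _ E).
Qed.

(** The marked projection of the twisted quotient to A_b is [s b] after [q]; cancelling it accounts
    for the pullback along the inverse of [s b]. *)
Lemma translate_act (a b : 'I_k) l (bE : b = (a + l.+2)%N :> nat) s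
    (c : Ext1 (A b) (A a)) (x : blocks a l.+2) :
  act_cls s (translate bE c x) =
  translate bE (Ext1_push (iso_hom (s a)) (Ext1_pull (iso_inv (s b)) c)) (act_cls s x).
Proof.
have [Z [e [q [qm ->]]]] := glue_ex bE x; rewrite (translateE _ _ _ qm) !glue_act.
have sqm : marked_map (X := act_block s Z) (Y := point b) (iso_hom (s b) \oc q).
  by apply: marked_comp (@act_point b s) (act_marked s qm) => r; rewrite /window; lia.
rewrite (translateE _ _ _ sqm) Ext1_push_addl -!Ext1_push_pull -Ext1_pull_comp.
by rewrite hcompA iso_homK comp1f.
Qed.

End Action.

(** * Blocks of two pieces *)

Section Level1.
Variables (a b : 'I_k).
Hypothesis bE : b = a.+1 :> nat.

Lemma point_next_iso r : window a.+1 0 r -> is_iso (marking (point b) r).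
Proof. by move=> ra; apply: marking_iso; rewrite /window bE. Qed.

Lemma point_next_gr0 n : (forall r, window a.+1 0 r -> n != p r) -> is_zero (gr n (A b)).
Proof. by rewrite -bE; apply: point_gr0. Qed.

(** The object A_b as a block starting at [a.+1]. Since [b] and [a.+1] are only propositionally
    equal, it is rebuilt instead of cast from [point b]. *)
Definition point_next : block a.+1 0 := Block point_next_iso point_next_gr0.

Lemma beta_ex (x : blocks a 1) : exists e : Ext1 (A b) (A a), glue (Z := point_next) e = x.
Proof. exact: (@glue_surj a 0 point_next x (blocks_point _ _)). Qed.

Definition beta_cls (x : blocks a 1) : Ext1 (A b) (A a) := sval (cid (beta_ex x)).

Lemma beta_clsK x : glue (Z := point_next) (beta_cls x) = x.
Proof. exact: (svalP (cid (beta_ex x))). Qed.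

Lemma glue_nextK e : beta_cls (glue (Z := point_next) e) = e.
Proof. by apply: (@glue_inj _ _ point_next); rewrite beta_clsK. Qed.

Lemma beta_act (s : Aut A) x : beta_cls (act_cls s x) =
  Ext1_push (iso_hom (s a)) (Ext1_pull (iso_inv (s b)) (beta_cls x)).
Proof.
apply: (@glue_inj _ _ point_next); rewrite beta_clsK -{1}(beta_clsK x) glue_act.
rewrite Ext1_push_pull.
have hm : marked_map (X := point_next) (Y := act_block s point_next) (iso_inv (s b)).
  by move=> r r1 r2; apply: point_act; rewrite /window bE.
exact/esym/(glue_pull _ hm).
Qed.

End Level1.

(** * The sets S'_l *)

Section Families.

(* The index runs over all of [nat]: the blocks that reach beyond the last
   weight are determined by the others, [sub_cls] being bijective on them, and no
   bounds have to be carried along. *)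
Definition compatible l : (forall r, blocks r l) -> Prop :=
  match l with
  | 0 => fun _ => True
  | l'.+1 => fun x => forall r, quo_cls (x r) = sub_cls (x r.+1)
  end.

Definition family l : Type := {x : forall r, blocks r l | compatible x}.

Lemma family_eq l (x y : family l) : (forall r, sval x r = sval y r) -> x = y.
Proof.
case: x y => [x xP] [y yP] /= xy; apply: eq_exist.
exact: functional_extensionality_dep.
Qed.

Lemma Theta_compatible l (x : family l.+1) : compatible (fun r => sub_cls (sval x r)).
Proof.
case: l x => [|l] [x xP] //= r; by rewrite quo_sub_cls xP.
Qed.

Definition Theta l (x : family l.+1) : family l := exist _ _ (Theta_compatible x).

(** Because of this, a fibre of [Theta] prescribes the quotient of each block along with its
    subobject. *)
Lemma Theta_quo l (x : family l.+1) r : quo_cls (sval x r) = sval (Theta x) r.+1.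
Proof. by case: x. Qed.

Lemma family_act_compatible l (s : Aut A) (x : family l) :
  compatible (fun r => act_cls s (sval x r)).
Proof. by case: l x => [|l] [x xP] //= r; rewrite quo_cls_act sub_cls_act xP. Qed.

Definition family_act l (s : Aut A) (x : family l) : family l :=
  exist _ _ (family_act_compatible s x).

Lemma family_act_action l : is_action (@Aut_mul T k A) (@Aut_one T k A) (@family_act l).
Proof.
split=> [x|s t x]; apply: family_eq => r /=; first exact: act_cls1.
exact: act_clsM.
Qed.

Lemma Theta_act l (s : Aut A) (x : family l.+1) :
  Theta (family_act s x) = family_act s (Theta x).
Proof. by apply: family_eq => r /=; rewrite sub_cls_act. Qed.

(** Matching on [idP] provides the proof of the bound from which the ordinal is formed. Blocks
    reaching past the last piece stay fixed. *)
Definition tau_fun l (e : ExtProd A l.+2) (x : family l.+2) (r : nat) : blocks r l.+2 :=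
  match @idP (r < k - l.+2)%N with
  | ReflectT h => translate (a := lo (Ordinal h)) (b := hi (Ordinal h)) erefl
                    (e (Ordinal h)) (sval x r)
  | ReflectF _ => sval x r
  end.

Lemma tau_funE l (e : ExtProd A l.+2) (x : family l.+2) (r : 'I_(k - l.+2)) :
  tau_fun e x r = translate (a := lo r) (b := hi r) erefl (e r) (sval x r).
Proof.
case: r => r rk /=; rewrite /tau_fun; case: {-}_ / idP => // h.
by rewrite (bool_irrelevance h rk).
Qed.

Lemma tau_fun_out l (e : ExtProd A l.+2) (x : family l.+2) r :
  (k - l.+2 <= r)%N -> tau_fun e x r = sval x r.
Proof.
move=> kr; rewrite /tau_fun; case: {-}_ / idP => // h.
by move: kr; rewrite leqNgt h.
Qed.

Lemma sub_tau_fun l (e : ExtProd A l.+2) (x : family l.+2) r :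
  sub_cls (tau_fun e x r) = sub_cls (sval x r).
Proof.
rewrite /tau_fun; case: {-}_ / idP => // h.
exact: (@sub_translate (lo (Ordinal h)) (hi (Ordinal h)) l erefl).
Qed.

Lemma quo_tau_fun l (e : ExtProd A l.+2) (x : family l.+2) r :
  quo_cls (tau_fun e x r) = quo_cls (sval x r).
Proof.
rewrite /tau_fun; case: {-}_ / idP => // h.
exact: (@quo_translate (lo (Ordinal h)) (hi (Ordinal h)) l erefl).
Qed.

Lemma tau_fun_compatible l (e : ExtProd A l.+2) (x : family l.+2) :
  compatible (tau_fun e x).
Proof. by move=> r; rewrite sub_tau_fun quo_tau_fun; case: x. Qed.

(** The action starts at level 2, the source of the last map of the tower; the identity is a default
    value below it. *)
Definition tau l : ExtProd A l -> family l -> family l :=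
  match l with
  | l'.+2 => fun e x => exist _ _ (tau_fun_compatible e x)
  | _ => fun _ x => x
  end.

Lemma tau_torsor l (y : family l.+1) : (exists x, Theta x = y) ->
  is_torsor (@ExtProd_add T k A l.+2) (@ExtProd_zero T k A l.+2)
    (@tau l.+2) (fun x => Theta x = y).
Proof.
move=> nonempty; split=> //.
- by move=> e x <-; apply: family_eq => r /=; apply: sub_tau_fun.
- move=> x _; apply: family_eq => r /=; have [rk|kr] := ltnP r (k - l.+2).
    by rewrite (tau_funE _ _ (Ordinal rk)) /ExtProd_zero translate0.
  by rewrite tau_fun_out.
- move=> e e' x _; apply: family_eq => r /=; have [rk|kr] := ltnP r (k - l.+2).
    by rewrite !(tau_funE _ _ (Ordinal rk)) /= (tau_funE _ _ (Ordinal rk)) -translateD.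
  by rewrite tau_fun_out //= (tau_fun_out e) //= tau_fun_out.
- move=> x x' xy x'y; have xx' : Theta x = Theta x' by rewrite xy x'y.
  have Lxx' r : sub_cls (sval x r) = sub_cls (sval x' r).
    exact: (congr1 (fun z : family l.+1 => sval z r) xx').
  have Rxx' r : quo_cls (sval x r) = quo_cls (sval x' r) by rewrite !Theta_quo xx'.
  have ex (r : 'I_(k - l.+2)) := translate_transitive (a := lo r) (b := hi r) erefl
    (Lxx' r) (Rxx' r).
  exists (fun r => sval (cid (ex r))); split.
    apply: family_eq => r /=; have [rk|kr] := ltnP r (k - l.+2).
      by rewrite (tau_funE _ _ (Ordinal rk)); apply: (svalP (cid (ex (Ordinal rk)))).
    (* From this index on, a block is determined by its subobject, and the subobjects agree. *)
    rewrite tau_fun_out //; apply: sub_cls_inj (Lxx' r).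
    by lia.
  move=> e ee; apply: functional_extensionality_dep => r.
  have eE : tau_fun e x r = sval x' r by rewrite -ee.
  rewrite tau_funE in eE; case: (cid (ex r)) => c /= cE.
  by apply: (@translate_free (lo r) (hi r) l erefl _ _ (sval x r)); rewrite cE.
Qed.

(** Each block is lifted with subobject [y r] and quotient [y r.+1]. The latter is the subobject of
    the next lift, so the independent choices are compatible. *)
Lemma Theta_surj l (y : family l.+1) :
  (forall r : 'I_(k - l.+2), Ext2_vanishes (A (hi r)) (A (lo r))) ->
  exists x, Theta x = y.
Proof.
move=> E0.
have yP r : quo_cls (sval y r) = sub_cls (sval y r.+1) by case: (y).
have ex r : exists x : blocks r l.+2, sub_cls x = sval y r /\ quo_cls x = sval y r.+1.
  have [rk|kr] := ltnP r (k - l.+2).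
    exact: (blocks_lift (a := lo (Ordinal rk)) (b := hi (Ordinal rk)) erefl (E0 _) (yP r)).
  (* Past the end the lift exists without any condition, and its quotient is forced: it has the same
     subobject as [y r.+1]. *)
  have [|x xE] := @sub_cls_surj r _ (sval y r); first by lia.
  exists x; split=> //; apply: sub_cls_inj; first by lia.
  by rewrite -quo_sub_cls xE.
have xP : @compatible l.+2 (fun r => sval (cid (ex r))).
  by move=> r; case: (cid (ex r)) (cid (ex r.+1)) => x [_ /= ->] [x' [/= ->]].
by exists (exist _ _ xP); apply: family_eq => r /=; case: (cid (ex r)) => x [].
Qed.

Lemma tau_family_act l (s : Aut A) (e : ExtProd A l.+2) (x : family l.+2) :
  family_act s (tau e x) = tau (ExtProd_act s e) (family_act s x).
Proof.
apply: family_eq => r /=; have [rk|kr] := ltnP r (k - l.+2).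
  rewrite !(tau_funE _ _ (Ordinal rk)).
  exact: (@translate_act (lo (Ordinal rk)) (hi (Ordinal rk)) l erefl).
by rewrite !tau_fun_out.
Qed.

Lemma next_eq (r : 'I_(k - 1)) : hi r = (lo r).+1 :> nat.
Proof. by rewrite /= addn1. Qed.

Definition beta (x : family 1) : ExtProd A 1 := fun r => beta_cls (next_eq r) (sval x r).

Lemma compatible1 (x : forall r, blocks r 1) : compatible x.
Proof. by move=> r; apply: blocks_point. Qed.

(** Fills the indices that carry no Ext class when [beta] is inverted: the last point is used at k -
    1, a zero object beyond, each regarded as a longer block. *)
Lemma blocks_out_inhabited r : (k <= r.+1)%N -> exists x : blocks r 1, True.
Proof.
move=> kr; suff [y _] : exists y : blocks r 0, True.
  by have [|x _] := @sub_cls_surj r 0 y; [lia | exists x].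
have [rk|rk] := ltnP r k; first by exists (block_cls (point (Ordinal rk))).
pose X : T := dsum (fun i : void => match i return T with end).
have X0 : is_zero X by rewrite /is_zero -sum_inj_proj big1 // => -[].
have hi s : window r 0 s -> is_iso (0 : hom (gr (p s) X) (A s)).
  by move=> rs; have := ltn_ord s; rewrite /window in rs; lia.
have h0 n : (forall s, window r 0 s -> n != p s) -> is_zero (gr n X).
  by move=> _; exact: (@fmap_zero _ (grF T n) _ X0).
by exists (block_cls (Block hi h0)).
Qed.

Lemma beta_bij : bijective beta.
Proof.
have ex (e : ExtProd A 1) r : exists x : blocks r 1, forall h : (r < k - 1)%N,
    beta_cls (next_eq (Ordinal h)) x = e (Ordinal h).
  case/orP: (leqVgt (k - 1) r) => [kr|rk]; last first.
    exists (glue (Z := point_next (next_eq (Ordinal rk))) (e (Ordinal rk))) => h.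
    by rewrite (bool_irrelevance h rk) glue_nextK.
  have [|x _] := @blocks_out_inhabited r; first by lia.
  by exists x => h; exfalso; lia.
pose g e : family 1 := exist _ _ (compatible1 (fun r => sval (cid (ex e r)))).
exists g => [x|e].
  apply: family_eq => r /=; case: (cid (ex (beta x) r)) => y /= yE.
  have [rk|kr] := ltnP r (k - 1).
    by rewrite -(beta_clsK (next_eq (Ordinal rk)) y) yE beta_clsK.
  apply: sub_cls_inj; first by lia.
  exact: blocks_point.
apply: functional_extensionality_dep => -[r rk]; rewrite /beta /=.
by case: (cid (ex e r)).
Qed.

Lemma beta_family_act (s : Aut A) (x : family 1) :
  beta (family_act s x) = ExtProd_act s (beta x).
Proof.
apply: functional_extensionality_dep => r; rewrite /beta /=.
exact: (beta_act (next_eq r)).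
Qed.

(** The block at 0 contains every piece. Each later block has the quotient of its predecessor as
    subobject, which determines it because nothing is removed past the end. *)
Lemma family0_bij l : (k <= l.+2)%N -> bijective (fun x : family l.+1 => sval x 0%N).
Proof.
move=> kl; have ex r (x : blocks r l.+1) :
    exists x' : blocks r.+1 l.+1, sub_cls x' = quo_cls x.
  by apply: sub_cls_surj; lia.
pose g x0 := fix g r : blocks r l.+1 :=
  match r with 0 => x0 | r'.+1 => sval (cid (ex r' (g r'))) end.
have gP x0 : @compatible l.+1 (g x0).
  by move=> r /=; rewrite (svalP (cid (ex r _))).
exists (fun x0 => exist _ (g x0) (gP x0)) => [x|//].
apply: family_eq => /=; elim=> [//|r IH] /=; apply: sub_cls_inj; first by lia.
by rewrite (svalP (cid (ex r _))) IH; case: (x).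
Qed.

End Families.

(** * Blocks containing every piece, and S'(A) *)

Section Total.
Variable l : nat.
Hypothesis kl : (k <= l.+1)%N.

Lemma window_all r : window 0 l r.
Proof. by rewrite /window; have := ltn_ord r; lia. Qed.

Definition marks (X : block 0 l) (phi : iso (Gr X) (dsum A)) : Prop :=
  forall r, marking X r = proj A r \oc iso_hom phi \oc gr_inj (p r) X.

Lemma weight_cases n (X : T) :
  (forall n, (forall r, n != p r) -> is_zero (gr n X)) ->
  (exists r, n = p r) \/ is_zero (gr n X).
Proof.
move=> X0; have [[r ->]|nr] := pselect (exists r, n = p r); first by left; exists r.
by right; apply: X0 => r; apply/eqP => nE; apply: nr; exists r.
Qed.

Lemma block_weight (X : block 0 l) n : (exists r, n = p r) \/ is_zero (gr n X).
Proof. by apply: weight_cases => m mP; apply: block_gr0 => r _. Qed.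

Lemma marks_ex (X : block 0 l) : exists phi, marks (X := X) phi.
Proof.
pose v r : iso (gr (p r) X) (A r) := to_iso (marking_iso X (window_all r)).
pose f : hom (Gr X) (dsum A) := \sum_r inj A r \oc marking X r \oc gr_proj (p r) X.
pose g : hom (dsum A) (Gr X) := \sum_r gr_inj (p r) X \oc iso_inv (v r) \oc proj A r.
have fi r : f \oc gr_inj (p r) X = inj A r \oc marking X r.
  rewrite /f comp_suml (bigD1 r) //= big1 => [|s sr].
    by rewrite addr0 -hcompA gr_projK compf1.
  by rewrite -hcompA gr_proj_neq ?compf0 //; apply: contraNneq sr => /p_inj->.
have gi r : g \oc inj A r = gr_inj (p r) X \oc iso_inv (v r).
  rewrite /g comp_suml (bigD1 r) //= big1 => [|s sr].
    by rewrite addr0 -hcompA projK compf1.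
  by rewrite -hcompA proj0 ?compf0.
have gf : g \oc f = idm (Gr X).
  apply: Gr_extl => n; have [[r ->]|X0] := block_weight X n.
    rewrite -hcompA fi hcompA gi -hcompA -[marking X r]/(iso_hom (v r)).
    by rewrite iso_homK compf1 comp1f.
  by rewrite [LHS]zero_from ?[RHS]zero_from.
have fg : f \oc g = idm (dsum A).
  apply: dsum_extl => r; rewrite -hcompA gi hcompA fi -hcompA.
  by rewrite -[marking X r]/(iso_hom (v r)) iso_invK compf1 comp1f.
exists (Iso gf fg) => r; rewrite /= -hcompA fi hcompA projK comp1f.
by [].
Qed.

(** The source is pure of weight n and the target pure of weight p_r. Thus any isomorphism from
    [Gr X] to [dsum A] is diagonal, and is the same as a family of markings. *)
Lemma phi_off (X : T) (f : hom (Gr X) (dsum A)) r n : n != p r ->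
  proj A r \oc f \oc gr_inj n X = 0.
Proof.
move=> nr; apply: hom_gr0 => m; have [->|mn] := eqVneq m n.
  by right; apply: pure_gr0 nr; apply: hAp.
by left; apply: gr_gr0.
Qed.

Lemma phi_inv_off (X : T) (g : hom (dsum A) (Gr X)) r n : n != p r ->
  gr_proj n X \oc g \oc inj A r = 0.
Proof.
move=> nr; apply: hom_gr0 => m; have [->|mn] := eqVneq m n.
  by left; apply: pure_gr0 nr; apply: hAp.
by right; apply: gr_gr0.
Qed.

(** Both [phi] and its inverse are diagonal, so their components are mutually inverse; in a weight
    other than the p_r, the identity of [gr n X] factors through a zero map. *)
Lemma marks_block_ex (X : T) (phi : iso (Gr X) (dsum A)) :
  (forall r, is_iso (proj A r \oc iso_hom phi \oc gr_inj (p r) X)) /\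
  (forall n, (forall r, n != p r) -> is_zero (gr n X)).
Proof.
split=> [r|n nP].
  pose f := proj A r \oc iso_hom phi \oc gr_inj (p r) X.
  pose g := gr_proj (p r) X \oc iso_inv phi \oc inj A r.
  have fE : proj A r \oc iso_hom phi = f \oc gr_proj (p r) X.
    apply: Gr_extl => n; rewrite -(hcompA f).
    have [->|nr] := eqVneq n (p r); first by rewrite gr_projK compf1.
    by rewrite phi_off // gr_proj_neq 1?eq_sym // compf0.
  have gE : gr_proj (p r) X \oc iso_inv phi = g \oc proj A r.
    apply: dsum_extl => s; rewrite -(hcompA g).
    have [->|sr] := eqVneq s r; first by rewrite projK compf1.
    rewrite proj0 1?eq_sym // compf0 phi_inv_off //.
    by apply: contraNneq sr => /p_inj->.
  exists g; split.
    rewrite /f !hcompA -gE -(hcompA _ (iso_inv phi)) iso_homK compf1.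
    exact: gr_projK.
  rewrite /g !hcompA -fE -(hcompA _ (iso_hom phi)) iso_invK compf1.
  exact: projK.
have h0 : gr_proj n X \oc iso_inv phi = 0.
  by apply: dsum_extl => r; rewrite phi_inv_off // comp0f.
rewrite /is_zero -gr_projK -[gr_proj n X]compf1 -(iso_homK phi) hcompA h0.
by rewrite !comp0f.
Qed.

Definition marks_block (X : T) (phi : iso (Gr X) (dsum A)) : block 0 l :=
  @Block 0 l X (fun r => proj A r \oc iso_hom phi \oc gr_inj (p r) X)
    (fun r _ => proj1 (marks_block_ex phi) r)
    (fun n nP => proj2 (marks_block_ex phi) n (fun r => nP r (window_all r))).

Lemma marks_blockP (X : T) (phi : iso (Gr X) (dsum A)) : marks (X := marks_block phi) phi.
Proof. by []. Qed.

Lemma marks_marked (X Y : block 0 l) phi psi (h : hom X Y) :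
  marks (X := X) phi -> marks (X := Y) psi ->
  marked_map h <-> iso_hom psi \oc Gr_map h = iso_hom phi.
Proof.
move=> mX mY; split=> [hm|hE].
  apply: dsum_extr => r; apply: Gr_extl => n.
  have [->|nr] := eqVneq n (p r); last by rewrite !phi_off.
  by rewrite -mX -hm ?window_all // mY -!hcompA Gr_map_inj.
by move=> r _ _; rewrite mX mY -hE -!hcompA Gr_map_inj.
Qed.

Lemma marks_mark_eq (X Y : block 0 l) phi psi :
  marks (X := X) phi -> marks (X := Y) psi ->
  block_cls X = block_cls Y <-> mark X phi = mark Y psi.
Proof.
move=> mX mY; split=> [/block_cls_inj[h hm]|/mark_inj[f fE]]; last first.
  by apply: (block_cls_eq (h := iso_hom f)); apply/(marks_marked _ mX mY).
apply: (mark_eq (f := to_iso (marked_iso (fun=> erefl) hm))).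
exact/(marks_marked _ mX mY).
Qed.

Definition alpha_cls (x : blocks 0 l) : S'_set A :=
  mark (repr x) (sval (cid (marks_ex (repr x)))).

Lemma alpha_clsE (X : block 0 l) phi : marks (X := X) phi ->
  alpha_cls (block_cls X) = mark X phi.
Proof.
move=> mX; have mR := svalP (cid (marks_ex (repr (block_cls X)))).
by apply/(marks_mark_eq mR mX); rewrite block_cls_repr.
Qed.

Lemma alpha_cls_bij : bijective alpha_cls.
Proof.
pose g (c : S'_set A) := block_cls (marks_block (tagged (repr c))).
exists g => [x|c].
  have [h hE] := mark_repr (sval (cid (marks_ex (repr x)))).
  rewrite -[RHS]block_cls_repr /g -/(alpha_cls x).
  apply/(marks_mark_eq (marks_blockP _) (svalP (cid (marks_ex (repr x))))).
  exact: mark_eq hE.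
rewrite /g (alpha_clsE (marks_blockP (tagged (repr c)))).
transitivity (cls (@marked_equiv T k A) (repr c)); last exact: cls_repr.
by case: (repr c).
Qed.

Lemma alpha_cls_act (s : Aut A) x : alpha_cls (act_cls s x) = S'_act s (alpha_cls x).
Proof.
rewrite -(block_cls_repr x) act_clsE; have [phi m] := marks_ex (repr x).
rewrite (alpha_clsE m) S'_actE; apply: alpha_clsE => r.
by rewrite /= m !hcompA proj_diag.
Qed.

Lemma forget_alpha (x y : blocks 0 l) :
  forget (alpha_cls x) = forget (alpha_cls y) <-> exists s, act_cls s x = y.
Proof.
rewrite -(block_cls_repr x) -(block_cls_repr y); set X := repr x; set Y := repr y.
have [phi mX] := marks_ex X; have [psi mY] := marks_ex Y.
rewrite (alpha_clsE mX) (alpha_clsE mY) forget_eq; split=> [[f]|[s]]; last first.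
  rewrite act_clsE => /block_cls_inj[h /marked_iso hi].
  by constructor; apply: to_iso (hi _).
have fi r : is_iso (gr_map (p r) f) := gr_iso (p r) (iso_is_iso f).
(* [s] measures the failure of [f] to respect the markings; twisting X by it makes [f] marked. *)
pose s r : iso (A r) (A r) := iso_comp (to_iso (marking_iso Y (window_all r)))
  (iso_comp (to_iso (fi r)) (iso_sym (to_iso (marking_iso X (window_all r))))).
have fm : marked_map (X := act_block s X) (Y := Y) (iso_hom f).
  move=> r _ _ /=; rewrite -!hcompA; case: (cid (marking_iso X _)) => g /= [-> _].
  by rewrite compf1.
by exists s; rewrite act_clsE; apply: block_cls_eq fm.
Qed.

Lemma forget_alpha_surj (c : S_set A) : exists x, forget (alpha_cls x) = c.
Proof.
have [X [phi ->]] := forget_surj c.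
by exists (block_cls (marks_block phi)); rewrite (alpha_clsE (marks_blockP phi)).
Qed.

End Total.

(** * Composites of [Theta] and the classes of consecutive pieces *)

Section Subquotients.

(** Stated with a map out of [W (p b) X], the form required by [consecutive_class]; for b the last
    index of Y, it presents Y as a quotient of that step of the filtration. *)
Definition subquotient a' l' a l (b : 'I_k) (X : block a' l') (Y : block a l) : Prop :=
  exists q : hom (W (p b) X) Y, forall r, window a l r ->
    marking Y r \oc gr_map (p r) q = marking X r \oc gr_map (p r) (winj (p b) X).

Lemma subquotient_refl a l (b : 'I_k) (X Y : block a l) : block_cls X = block_cls Y ->
  subquotient b X Y.
Proof.
move=> /block_cls_inj[h hm]; exists (h \oc winj (p b) X) => r ra.
by rewrite gr_map_comp hcompA hm.
Qed.

Lemma subquotient_R a' l' a l (b : 'I_k) (X : block a' l'.+1) (V : block a'.+1 l')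
    (Y : block a l) (g : hom X V) :
  (a' < a)%N -> (a + l <= a' + l'.+1)%N -> marked_map g -> subquotient b V Y ->
  subquotient b X Y.
Proof.
move=> aa al gm [q qP]; exists (q \oc fmap (W (p b)) g) => r ra.
rewrite gr_map_comp hcompA qP // -hcompA -gr_map_comp winj_nat gr_map_comp hcompA.
by rewrite gm //; move: ra; rewrite /window; lia.
Qed.

(** The piece of X missing from U lies above b, so [f] is invertible on [W (p b)] and the map [q] is
    transported along the inverse. *)
Lemma subquotient_L a' l' a l (b : 'I_k) (X : block a' l'.+1) (U : block a' l')
    (Y : block a l) (f : hom U X) :
  (a' <= a)%N -> (a + l <= a' + l')%N -> (b <= a' + l')%N -> marked_map f ->
  subquotient b U Y -> subquotient b X Y.
Proof.
move=> aa al bl' fm [q qP].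
have [g [gf fg]] : is_iso (fmap (W (p b)) f).
  apply: gr_reflect_iso => n; have [nb|bn] := leP n (p b); last first.
    by apply: zero_iso; apply: gr_W0.
  apply: (is_iso_cancel (gr_winj_iso X nb)).
  rewrite -gr_map_comp winj_nat gr_map_comp; apply: is_iso_comp (gr_winj_iso U nb).
  have [[r ra nE]|U0] := block_gr_cases U n.
    by rewrite nE; apply: (marked_gr_iso fm) => //; move: ra; rewrite /window; lia.
  have [[r ra nE]|X0] := block_gr_cases X n; last exact: zero_iso.
  rewrite nE; apply: (marked_gr_iso fm) => //.
  by move: nb ra; rewrite nE p_le /window; lia.
exists (q \oc g) => r ra.
rewrite gr_map_comp hcompA qP //.
have rU : window a' l' r by rewrite /window in ra *; lia.
have rX : window a' l'.+1 r by rewrite /window in ra *; lia.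
by rewrite -fm // -!(hcompA (marking X r)) -!gr_map_comp -winj_nat -hcompA fg compf1.
Qed.

Lemma to_point_gr a l (X : block a l) (r : 'I_k) :
  marking (point r) r \oc gr_map (p r) (marking X r \oc cmap (winc (p r) X))
  = marking X r \oc gr_map (p r) (winj (p r) X).
Proof.
rewrite marking_point; apply: (@cmap_epi T); rewrite pure_gr_nat.
rewrite -!hcompA gr_mapE; congr (_ \oc (_ \oc _)).
by apply: (@winj_mono T (p r) X); rewrite winj_nat.
Qed.

(** Both equations are tested on graded pieces. In the first, the source has nothing in the upper
    weight, and on the lower piece both sides give the marking of X. *)
Lemma subquotient_consecutive l (X : block 0 l) (phi : iso (Gr X) (dsum A))
    (r : 'I_(k - 1)) (E : extension (A (hi r)) (A (lo r))) :
  marks (X := X) phi -> (k <= l.+1)%N ->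
  subquotient (hi r) X (ext_block (Z := point_next (next_eq r)) E) ->
  consecutive_class p phi (ext_cls E).
Proof.
move=> mX kl [q qP]; set Y := ext_block _ in q qP.
have toE s : to_piece p phi s = marking X s \oc cmap (winc (p s) X).
  by rewrite /to_piece mX.
have [h hE] : exists h : hom (W (p (lo r)) X) (W (p (hi r)) X),
    winj (p (hi r)) X \oc h = winj (p (lo r)) X.
  by apply: W_incl; rewrite p_le /=; lia.
exists E, h, q; split=> //.
- apply: gr_faithful2 => n.
  have [[s sr ->]|Y0] := block_gr_cases Y n; last first.
    by rewrite [LHS]zero_to ?[RHS]zero_to.
  apply: (is_iso_mono (marking_iso Y sr)).
  case/windowP: (sr) => [/window0 sE|sb]; last first.
    rewrite [gr_map _ _]zero_from; last first.
      by apply: gr_W0; rewrite ltNge p_le; rewrite /window in sb *; lia.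
    rewrite [gr_map _ (_ \oc to_piece _ _ _)]zero_from //.
    by apply: gr_W0; rewrite ltNge p_le; rewrite /window in sb *; lia.
  subst s; rewrite toE [gr_map _ (q \oc h)]gr_map_comp.
  rewrite [gr_map _ (einj E \oc _)]gr_map_comp !hcompA qP //.
  have -> : marking Y (lo r) \oc gr_map (p (lo r)) (einj E) = marking (point (lo r)) (lo r).
    by apply: (einj_marked (Z := point_next (next_eq r))); rewrite // /window addn0 leqnn.
  by rewrite -(hcompA (marking X _)) -gr_map_comp hE to_point_gr.
- apply: gr_faithful2 => n; have [->|nr] := eqVneq n (p (hi r)); last first.
    have Z0 := pure_gr0 (hAp (hi r)) nr.
    by rewrite [LHS]zero_to ?[RHS]zero_to.
  have hr : window (hi r) 0 (hi r) by rewrite /window addn0 leqnn.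
  have hr' : window (lo r).+1 0 (hi r) by rewrite /window addn0 /=; lia.
  have hr'' : window (lo r) 1 (hi r) by rewrite /window /=; lia.
  apply: (is_iso_mono (marking_iso (point (hi r)) hr)).
  rewrite toE to_point_gr gr_map_comp hcompA.
  have -> : marking (point (hi r)) (hi r) \oc gr_map (p (hi r)) (eproj E) = marking Y (hi r).
    exact: (@eproj_marked (lo r) 0 (point_next (next_eq r)) E (hi r) hr'' hr').
  exact: qP.
Qed.

(** Induction on the descent, for all positions of Y in X at once. If Y ends before X does, the last
    piece of X is dropped; otherwise Y starts strictly later, since l <= m, and the first piece is
    dropped. *)
Lemma descends_subquotient l (y : family l) m (x : family m) : descends Theta y x ->
  (l <= m)%N /\
  forall (r r' : nat) (b : 'I_k), (r' <= r)%N -> (r + l <= r' + m)%N ->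
    (b <= r + l)%N -> forall (Y : block r l) (X : block r' m),
    block_cls Y = sval y r -> block_cls X = sval x r' -> subquotient b X Y.
Proof.
elim=> [|{}m {}x _ [lm IH]].
  split=> // r r' b rr' rl bb Y X YE XE.
  have e : r' = r by lia.
  subst r'; apply: subquotient_refl; by rewrite XE.
split=> [|r r' b rr' rl bb Y X YE XE]; first by lia.
have [rlm|rlm] := leqP (r + l) (r' + m).
  have [U [f fm]] := sub_ex X.
  have UE : block_cls U = sval (Theta x) r' by rewrite /= -XE (sub_clsE fm).
  apply: subquotient_L fm (IH r r' b rr' rlm bb Y U YE UE) => //.
  exact: leq_trans bb rlm.
have [V [g gm]] := quo_ex X.
have VE : block_cls V = sval (Theta x) r'.+1 by rewrite -Theta_quo -XE (quo_clsE gm).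
have r'r : (r' < r)%N by lia.
apply: subquotient_R gm (IH r r'.+1 b r'r _ bb Y V YE VE) => //.
by lia.
Qed.

Lemma descends_consecutive l (y : family 1) (x : family l) (X : T)
    (phi : iso (Gr X) (dsum A)) (kl : (k <= l.+1)%N) :
  descends Theta y x -> alpha_cls kl (sval x 0%N) = mark X phi ->
  forall r, consecutive_class p phi (beta y r).
Proof.
move=> yx aE r; have [l1 sq] := descends_subquotient yx.
have XE : block_cls (marks_block kl phi) = sval x 0%N.
  apply: (bij_inj (alpha_cls_bij kl)); rewrite aE.
  by apply: alpha_clsE; apply: marks_blockP.
rewrite -(ext_cls_repr (beta y r)).
apply: (subquotient_consecutive (marks_blockP kl phi) kl).
apply: (sq (lo r) 0%N (hi r)) => //; first by rewrite /=; have := ltn_ord r; lia.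
exact: (beta_clsK (next_eq r)).
Qed.

End Subquotients.


End Marked.

Lemma inj_surj_bij (U V : Type) (f : U -> V) :
  injective f -> (forall y, exists x, f x = y) -> bijective f.
Proof.
move=> fi fs; exists (fun y => sval (cid (fs y))) => [x|y].
  by apply: fi; apply: (svalP (cid (fs (f x)))).
exact: (svalP (cid (fs y))).
Qed.

(** * Quotients by Aut(A) *)

Section AutGroup.
Variables (T : filtered_category) (k : nat) (A : 'I_k -> T).

Definition Aut_inv (s : Aut A) : Aut A := fun r => iso_sym (s r).

Lemma Aut_eq (s t : Aut A) : (forall r, iso_hom (s r) = iso_hom (t r)) -> s = t.
Proof. by move=> st; apply: functional_extensionality_dep => r; apply: iso_eq. Qed.

Lemma Aut_mulA : associative (@Aut_mul T k A).
Proof. by move=> s t u; apply: Aut_eq => r /=; rewrite hcompA. Qed.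

Lemma Aut_mul1 : left_id (Aut_one A) (@Aut_mul T k A).
Proof. by move=> s; apply: Aut_eq => r /=; rewrite comp1f. Qed.

Lemma Aut_1mul : right_id (Aut_one A) (@Aut_mul T k A).
Proof. by move=> s; apply: Aut_eq => r /=; rewrite compf1. Qed.

Lemma Aut_mulV : left_inverse (Aut_one A) Aut_inv (@Aut_mul T k A).
Proof. by move=> s; apply: Aut_eq => r /=; rewrite iso_homK. Qed.

Lemma Aut_Vmul : right_inverse (Aut_one A) Aut_inv (@Aut_mul T k A).
Proof. by move=> s; apply: Aut_eq => r /=; rewrite iso_invK. Qed.

Section Orbits.
Variables (S : Type) (act : Aut A -> S -> S).
Hypothesis actP : is_action (@Aut_mul T k A) (Aut_one A) act.

Lemma actK s x : act (Aut_inv s) (act s x) = x.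
Proof. by case: actP => a1 aM; rewrite -aM Aut_mulV a1. Qed.

Lemma orbit_equiv : is_equiv (orbit_rel act).
Proof.
case: actP => a1 aM; split=> [x|x y [s <-]|x y z [s <-] [t <-]].
- by exists (Aut_one A).
- by exists (Aut_inv s); apply: actK.
- by exists (Aut_mul t s); rewrite aM.
Qed.

Lemma orb_eq s x : orb act (act s x) = orb act x.
Proof. by apply/esym/(cls_eq orbit_equiv); exists s. Qed.

Lemma orb_inj x y : orb act x = orb act y -> exists s, act s x = y.
Proof. by move/(cls_inj orbit_equiv). Qed.

Lemma orb_repr (z : orbits act) : orb act (repr z) = z.
Proof. exact: cls_repr. Qed.

(** The action axioms are an argument of the type, so that the group structure, which depends on
    them, can be attached to it as an instance. *)
Definition stab of is_action (@Aut_mul T k A) (Aut_one A) act := fun x : S =>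
  {s : Aut A | act s x = x}.

Variable x : S.
Local Notation stabx := (stab actP x).

Lemma stab_one_subproof : act (Aut_one A) x = x.
Proof. by case: actP. Qed.

Lemma stab_mul_subproof (s t : stabx) : act (Aut_mul (sval s) (sval t)) x = x.
Proof. by case: actP s t => _ aM [s sx] [t tx] /=; rewrite aM tx. Qed.

Lemma stab_inv_subproof (s : stabx) : act (Aut_inv (sval s)) x = x.
Proof. by case: s => s sx /=; rewrite -{1}sx actK. Qed.

Definition stab_one : stabx := exist _ _ stab_one_subproof.
Definition stab_mul (s t : stabx) : stabx := exist _ _ (stab_mul_subproof s t).
Definition stab_inv (s : stabx) : stabx := exist _ _ (stab_inv_subproof s).

Lemma stab_eq (s t : stabx) : sval s = sval t -> s = t.
Proof. by case: s t => [s sx] [t tx] /= st; apply: eq_exist. Qed.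

Lemma stab_mulA : associative stab_mul.
Proof. by move=> s t u; apply/stab_eq/Aut_mulA. Qed.

Lemma stab_mul1 : left_id stab_one stab_mul.
Proof. by move=> s; apply/stab_eq/Aut_mul1. Qed.

Lemma stab_1mul : right_id stab_one stab_mul.
Proof. by move=> s; apply/stab_eq/Aut_1mul. Qed.

Lemma stab_mulV : left_inverse stab_one stab_inv stab_mul.
Proof. by move=> s; apply/stab_eq/Aut_mulV. Qed.

Lemma stab_Vmul : right_inverse stab_one stab_inv stab_mul.
Proof. by move=> s; apply/stab_eq/Aut_Vmul. Qed.

HB.instance Definition _ := gen_eqMixin stabx.
HB.instance Definition _ := gen_choiceMixin stabx.
HB.instance Definition _ := isGroup.Build stabx stab_mulA stab_mul1 stab_1mul
  stab_mulV stab_Vmul.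

End Orbits.

Section Equivariant.
Variables (S S' : Type) (act : Aut A -> S -> S) (act' : Aut A -> S' -> S').
Hypotheses (actP : is_action (@Aut_mul T k A) (Aut_one A) act)
  (actP' : is_action (@Aut_mul T k A) (Aut_one A) act').
Variable f : S -> S'.
Hypothesis fP : forall s x, f (act s x) = act' s (f x).

Definition orb_map (z : orbits act) : orbits act' := orb act' (f (repr z)).

Lemma orb_mapE x : orb_map (orb act x) = orb act' (f x).
Proof.
have [s sE] := orb_inj actP (orb_repr (orb act x)).
by rewrite -[in RHS]sE fP orb_eq.
Qed.

Lemma orb_map_bij : bijective f -> bijective orb_map.
Proof.
move=> fb; apply: inj_surj_bij => [z z'|z]; last first.
  case: fb => g _ gf; exists (orb act (g (repr z))).
  by rewrite orb_mapE gf orb_repr.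
rewrite -(orb_repr z) -(orb_repr z') !orb_mapE => /(orb_inj actP')[s].
by rewrite -fP => /(bij_inj fb) <-; rewrite orb_eq.
Qed.

Lemma fiber_orb_map (y : S') (z : orbits act) :
  orb_map z = orb act' y <-> exists x, f x = y /\ orb act x = z.
Proof.
split=> [|[x [<- <-]]]; last exact: orb_mapE.
rewrite -(orb_repr z) orb_mapE => /(orb_inj actP')[s sy].
by exists (act s (repr z)); rewrite fP orb_eq.
Qed.

(** The group is the stabilizer of y. Surjectivity of [b] moves a representative into the fibre over
    y itself; injectivity holds because an element joining two points of that fibre must fix y. *)
Lemma fiber_orbits (y : S') : exists (Gamma : groupType)
    (gact : Gamma -> fiber f y -> fiber f y)
    (b : orbits gact -> fiber orb_map (orb act' y)),
  [/\ is_action (fun g h : Gamma => (g * h)%g) 1%g gact, bijective b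
    & forall x : fiber f y, sval (b (orb gact x)) = orb act (sval x)].
Proof.
pose Gamma : groupType := stab actP' y.
have gP (g : Gamma) (x : fiber f y) : f (act (sval g) (sval x)) = y.
  by rewrite fP (svalP x) (svalP g).
pose gact (g : Gamma) x : fiber f y := exist (fun x => f x = y) _ (gP g x).
have fib_eq (x x' : fiber f y) : sval x = sval x' -> x = x'.
  by case: x x' => [x xP] [x' x'P] /= e; apply: eq_exist.
have gactP : is_action (fun g h : Gamma => (g * h)%g) 1%g gact.
  by case: actP => a1 aM; split=> [x|g h x]; apply: fib_eq; [apply: a1 | apply: aM].
have gequiv : is_equiv (orbit_rel gact).
  case: gactP => a1 aM; split=> [x|x x' [g <-]|x x' x'' [g <-] [h <-]].
  - by exists 1%g.
  - by exists (g^-1)%g; rewrite -aM mulVg a1.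
  - by exists (h * g)%g; rewrite aM.
have bP (c : orbits gact) : orb_map (orb act (sval (repr c))) = orb act' y.
  by rewrite orb_mapE (svalP (repr c)).
pose b c : fiber orb_map (orb act' y) := exist (fun z => orb_map z = orb act' y) _ (bP c).
have bE x : sval (b (orb gact x)) = orb act (sval x).
  have [g gE] := repr_cls gequiv x.
  by rewrite -[in RHS]gE /= orb_eq.
exists Gamma, gact, b; split=> //; apply: inj_surj_bij.
  move=> c c' /(congr1 sval) /= /(orb_inj actP)[s sE].
  rewrite -(cls_repr c) -(cls_repr c'); apply: (cls_eq gequiv).
  have sy : act' s y = y.
    by rewrite -{1}(svalP (repr c)) -fP sE (svalP (repr c')).
  by exists (exist (fun s => act' s y = y) s sy : Gamma); apply: fib_eq.
case=> z zP; have [x [xy xz]] := proj1 (fiber_orb_map y z) zP.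
exists (orb gact (exist (fun x => f x = y) x xy)).
apply: eq_exist; rewrite -[RHS]xz.
exact: (bE (exist (fun x => f x = y) x xy)).
Qed.

End Equivariant.

Lemma ExtProd_action : is_action (@Aut_mul T k A) (Aut_one A) (@ExtProd_act T k A 1).
Proof.
split=> [e|s t e]; apply: functional_extensionality_dep => r.
  by rewrite /ExtProd_act /= Ext1_pull_id Ext1_push_id.
by rewrite /ExtProd_act /= Ext1_pull_comp Ext1_push_comp !Ext1_push_pull.
Qed.

End AutGroup.

Theorem theorem3p3p1 (T : filtered_category) (k : nat)
    (A : 'I_k -> T) (p : 'I_k -> int)
    (hk : (2 <= k)%N)
    (hA0 : forall r, ~ is_zero (A r))
    (hAp : forall r, pure (p r) (A r))
    (hp : forall r s : 'I_k, (r < s)%N -> p r < p s) :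
  exists (S' : nat -> Type) (Theta : forall l : nat, S' l.+1 -> S' l)
    (alpha : S' k.-1 -> S'_set A) (beta : S' 1%N -> ExtProd A 1)
    (tau : forall l : nat, ExtProd A l -> S' l -> S' l),
  [/\ (* (a) *)
      [/\ bijective alpha, bijective beta &
        forall (x : S' k.-1) (y : S' 1%N), descends Theta y x ->
        forall (X : T) (phi : iso (Gr X) (dsum A)), alpha x = mark X phi ->
        forall r, consecutive_class p phi (beta y r)],
      (* (b) *)
      forall l : nat, (0 < l)%N -> (l.+1 < k)%N ->
      forall y : S' l, (exists x, Theta l x = y) ->
        is_torsor (@ExtProd_add T k A l.+1) (@ExtProd_zero T k A l.+1)
          (tau l.+1) (fun x => Theta l x = y),
      (* (c) *)
      forall l : nat, (0 < l)%N -> (l.+1 < k)%N ->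
        (forall r : 'I_(k - l.+1), Ext2_vanishes (A (hi r)) (A (lo r))) ->
        forall y : S' l, exists x : S' l.+1, Theta l x = y
    & exists act : forall l : nat, Aut A -> S' l -> S' l,
      [/\ (* (d), upstairs *)
          [/\ forall l : nat, (0 < l)%N -> (l < k)%N ->
                is_action (@Aut_mul T k A) (@Aut_one T k A) (act l),
              forall l : nat, (0 < l)%N -> (l.+1 < k)%N ->
                forall (s : Aut A) (x : S' l.+1),
                  Theta l (act l.+1 s x) = act l s (Theta l x),
              forall (s : Aut A) (x : S' k.-1),
                alpha (act k.-1 s x) = S'_act s (alpha x),
              forall (s : Aut A) (x : S' 1%N),
                beta (act 1%N s x) = ExtProd_act s (beta x)
            & forall l : nat, (0 < l)%N -> (l.+1 < k)%N ->
                forall (s : Aut A) (e : ExtProd A l.+1) (x : S' l.+1),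
                  act l.+1 s (tau l.+1 e x)
                  = tau l.+1 (ExtProd_act s e) (act l.+1 s x)]
        & exists (Thetabar : forall l : nat, orbits (act l.+1) -> orbits (act l))
            (alphabar : orbits (act k.-1) -> S_set A)
            (betabar : orbits (act 1%N) -> orbits (@ExtProd_act T k A 1)),
          [/\ (* (d), on the quotients *)
              forall l : nat, (0 < l)%N -> (l.+1 < k)%N ->
                forall x : S' l.+1,
                  Thetabar l (orb (act l.+1) x) = orb (act l) (Theta l x),
              bijective alphabar /\
              (forall x : S' k.-1,
                 alphabar (orb (act k.-1) x) = forget (alpha x)),
              bijective betabar /\
              (forall x : S' 1%N,
                 betabar (orb (act 1%N) x)
                 = orb (@ExtProd_act T k A 1) (beta x))
            & (* (e) *)
              forall l : nat, (0 < l)%N -> (l.+1 < k)%N ->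
              forall (eps : orbits (act l)) (eps' : S' l),
                orb (act l) eps' = eps ->
                (forall z : orbits (act l.+1),
                   Thetabar l z = eps <->
                   exists x : S' l.+1,
                     Theta l x = eps' /\ orb (act l.+1) x = z) /\
                exists (Gamma : groupType)
                  (gact : Gamma -> fiber (Theta l) eps' ->
                          fiber (Theta l) eps')
                  (b : orbits gact -> fiber (Thetabar l) eps),
                  [/\ is_action (fun g h : Gamma => (g * h)%g) 1%g gact,
                      bijective b
                    & forall x : fiber (Theta l) eps',
                        sval (b (orb gact x)) = orb (act l.+1) (sval x)]]]].
Proof.
(* Writing k as n + 2 makes [k.-1] reduce to the successor [n.+1], the form of level required by
   [family0_bij]. *)
case: k A p hk hA0 hAp hp => [|[|n]] // A p _ _ hAp hp.
have n2 : (n.+2 <= n.+2)%N by [].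
pose S' := family hAp hp.
pose act l : Aut A -> S' l -> S' l := @family_act _ _ _ _ hAp hp l.
have actP l : is_action (@Aut_mul T n.+2 A) (Aut_one A) (act l).
  exact: family_act_action.
pose Th l : S' l.+1 -> S' l := @Theta _ _ _ _ hAp hp l.
have ThP l (s : Aut A) x : Th l (act l.+1 s x) = act l s (Th l x) by apply: Theta_act.
pose be : S' 1%N -> ExtProd A 1 := @beta _ _ _ _ hAp hp.
have bP (s : Aut A) x : be (act 1%N s x) = ExtProd_act s (be x) by apply: beta_family_act.
pose ev (x : S' n.+1) := sval x 0%N.
have evb : bijective ev := family0_bij hAp hp (leqnn n.+2).
pose al (x : S' n.+1) := alpha_cls hp n2 (ev x).
have alb : bijective al := bij_comp (alpha_cls_bij hAp hp n2) evb.
exists S', Th, al, be, (@tau _ _ _ _ hAp hp); split.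
- split=> //; first exact: beta_bij.
  by move=> x y yx X phi xE r; apply: (descends_consecutive yx xE).
- by case=> [//|l] _ _ y; apply: tau_torsor.
- by case=> [//|l] _ _ E0 y; apply: Theta_surj.
exists act; split.
  split=> //.
  - by move=> s x; apply: alpha_cls_act.
  - by case=> [//|l] _ _ s e x; apply: tau_family_act.
have faE (x y : S' n.+1) : forget (al x) = forget (al y) <-> exists s, act n.+1 s x = y.
  split=> [/(forget_alpha hAp hp n2)[s sE]|[s <-]].
    by exists s; apply: (bij_inj evb).
  by apply/(forget_alpha hAp hp n2); exists s.
have abE x : forget (al (repr (orb (act n.+1) x))) = forget (al x).
  by apply/faE/(orb_inj (actP _)); rewrite orb_repr.
exists (fun l => @orb_map _ _ _ _ _ (act l.+1) (act l) (Th l)).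
exists (fun z => forget (al (repr z))).
exists (@orb_map _ _ _ _ _ (act 1%N) (@ExtProd_act T n.+2 A 1) be); split.
- by move=> l _ _ x; apply: orb_mapE.
- split=> //; apply: inj_surj_bij => [z z' /faE[s sE]|c].
    by rewrite -(orb_repr z) -(orb_repr z') -sE orb_eq.
  have [x <-] := forget_alpha_surj hAp hp n2 c; case: evb => g _ gK.
  by exists (orb (act n.+1) (g x)); rewrite abE /al gK.
- split; last by move=> x; apply: orb_mapE => //; apply: ExtProd_action.
  by apply: orb_map_bij => //; [apply: ExtProd_action | apply: beta_bij].
move=> l _ _ eps eps' <-; split; first by move=> z; apply: fiber_orb_map.
exact: fiber_orbits.
Qed.
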